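(* Let $w_0=(v_0,u_0)\in\mathcal{W}$ be an initial condition such that the Gram matrix $G(u_0)$ is invertible, and denote by $\sigma_0^2$ the smallest eigenvalue of $G(u_0)$. Assume that the activation $\gamma$ is twice continuously differentiable and that $H_w$ is continuously differentiable in $w$ with eigenvalues in $[\mu_H,L_H]$ for positive $\mu_H,L_H$. Let $\mu_{GN}:=2\mu/(L_H(1+\alpha/\mu_H))$. Let $R$ be an arbitrary positive number and define $C_R:=\sup_{w\in\mathcal{B}(w_0,R)}\|\partial_wJ_w\|_{op}$. If the linear layer $v_0$ is almost optimal in the sense that $$\|\nabla\mathcal{L}(f_{w_0})\|<\epsilon,\qquad \epsilon:=\frac{\mu\,\mu_H\,\mu_{GN}}{8LN}\,\min(R,C_R^{-1})\,\min(\sigma_0,\sigma_0^2),$$ then the Gauss-Newton flow $\dot w_t=-\Phi(w_t)$ started at $w_0$ is defined at all times (its maximal time is $T=+\infty$), the objective converges to $0$ at a linear rate, namely $\mathcal{L}(f_{w_t})\le\mathcal{L}(f_{w_0})\,e^{-\mu_{GN}t}$, and the parameters $w_t$ remain within a ball of radius $R$ centered at $w_0$.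
   Context: Data: $x_1,\dots,x_N\in\mathcal{X}\subset\mathbb{R}^d$ are pairwise distinct, with targets $y_n=f^\star(x_n)$ for a real-valued function $f^\star$ on $\mathcal{X}$. $\hat{\mathbb{P}}$ is the empirical distribution of the $x_n$; $L_2(\hat{\mathbb{P}})$ is identified with $\mathbb{R}^N$, a function $f$ being identified with $(f(x_1),\dots,f(x_N))$. Network: $\gamma$ is a non-polynomial point-wise activation. $\mathcal{W}$ is the Hilbert space of parameters, in one of two cases. (Finite width) $\mathcal{W}=\mathbb{R}^M\times\mathbb{R}^{M\times d}$, $f_w(x)=\frac1M\sum_{i=1}^Mv_i\gamma(u_i^\top x)$ for $w=(v,u)$, and $G(u)_{n,n'}=\frac1M\sum_{i=1}^M\gamma(u_i^\top x_n)\gamma(u_i^\top x_{n'})$. (Infinite width) $\nu$ is a base probability measure with full support on $\mathcal{X}$ and finite second moment, $\mathcal{W}=L_2(\nu)\times L_2(\nu,\mathbb{R}^d)$, $f_w(x)=\int v(c)\gamma(u(c)^\top x)\,d\nu(c)$ for $w=(v,u)$, and $G(u)_{n,n'}=\int\gamma(u(c)^\top x_n)\gamma(u(c)^\top x_{n'})\,d\nu(c)$. $J_w:\mathcal{W}\to\mathbb{R}^N$ is the Jacobian of $(f_w(x_1),\dots,f_w(x_N))$ with respect to $w$ and $J_w^\top$ its adjoint; $\partial_wJ_w$ is the derivative of $w\mapsto J_w$; $\|\cdot\|_{op}$ is the operator norm; $\mathcal{B}(w,R)$ is the open ball of radius $R$ centered at $w$. Objective: $\mathcal{L}$ is a non-negative,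 $L$-smooth and $\mu$-strongly convex function on $L_2(\hat{\mathbb{P}})$, with minimum value $0$ achieved at $f^\star$. $\nabla\mathcal{L}(f_w)\in\mathbb{R}^N$ is the gradient of $\mathcal{L}$ with respect to the outputs $(f_w(x_1),\dots,f_w(x_N))$. Gauss-Newton vector field: $H_w$ is a symmetric positive operator on $L_2(\hat{\mathbb{P}})$, $\alpha\ge0$, $\varepsilon(w)=\alpha\,\sigma^2(w)$ where $\sigma^2(w)$ is the smallest eigenvalue of $A_w:=J_wJ_w^\top$, and $$\Phi(w)=(J_w^\top H_wJ_w+\varepsilon(w)I)^{-1}J_w^\top\nabla\mathcal{L}(f_w),$$ equivalently written, by the Woodbury identity, as $\Phi(w)=J_w^\top(J_wJ_w^\top+\varepsilon(w)H_w^{-1})^{-1}H_w^{-1}\nabla\mathcal{L}(f_w)$. $T$ is the maximal time up to which the unique solution of $\dot w_t=-\Phi(w_t)$ started at $w_0$ is defined.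
   Formalization: At finite width the parameter space R^M x R^{M x d} carries the inner product scaled by 1/M (so that J_v J_v^T = G(u)), which fixes the norm in the ball of radius R and in C_R; with the unscaled Euclidean inner product the claim fails for large M. *)

(* Defs.v *)
From HB Require Import structures.
From mathcomp Require Import all_boot all_order all_algebra.
From mathcomp Require Import generic_quotient ring_quotient ring lra.
From mathcomp Require Import all_classical all_reals all_analysis.
From mathcomp Require Import measurable_realfun.

Set Implicit Arguments.
Unset Strict Implicit.
Unset Printing Implicit Defensive.
Import Order.TTheory GRing.Theory Num.Theory.
Import numFieldNormedType.Exports.
Local Open Scope classical_set_scope.
Local Open Scope ring_scope.

HB.mixin Record isInnerNormed (R : realType) V of NormedModule R V := {
  inner : V -> V -> R;
  innerC : forall x y, inner x y = inner y x;
  innerDl : forall x y z, inner (x + y) z = inner x z + inner y z;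
  innerZl : forall a x y, inner (a *: x) y = a * inner x y;
  normr_inner : forall x : V, `|x| = Num.sqrt (inner x x);
  inner_ge0 : forall x, 0 <= inner x x
}.

#[short(type="innerType")]
HB.structure Definition InnerNormed (R : realType) :=
  {V of NormedModule R V & isInnerNormed R V}.

HB.factory Record Lmodule_isInner (R : realType) V of GRing.Lmodule R V := {
  dotp : V -> V -> R;
  dotpC : forall x y, dotp x y = dotp y x;
  dotpDl : forall x y z, dotp (x + y) z = dotp x z + dotp y z;
  dotpZl : forall a x y, dotp (a *: x) y = a * dotp x y;
  dotp_ge0 : forall x, 0 <= dotp x x;
  dotp_eq0 : forall x, dotp x x = 0 -> x = 0
}.

HB.builders Context R V of Lmodule_isInner R V.

Let nrm (x : V) : R := Num.sqrt (dotp x x).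

Let dotp_sq x y t :
  dotp (x + t *: y) (x + t *: y) = dotp x x + 2 * t * dotp x y + t ^+ 2 * dotp y y.
Proof.
rewrite dotpDl dotpZl (dotpC x) (dotpC y (_ + _)) !dotpDl !dotpZl (dotpC y x).
by ring.
Qed.

Let cauchy x y : dotp x y ^+ 2 <= dotp x x * dotp y y.
Proof.
have [y0|y0] := eqVneq (dotp y y) 0.
  have yE := dotp_eq0 y0.
  have -> : dotp x y = 0 by rewrite yE -(scale0r y) dotpC dotpZl mul0r.
  by rewrite expr0n mulr_ge0// dotp_ge0.
have yp : 0 < dotp y y by rewrite lt_neqAle eq_sym y0 dotp_ge0.
have := dotp_ge0 (x + (- (dotp x y / dotp y y)) *: y).
rewrite dotp_sq => h.
rewrite -subr_ge0 -(pmulr_lge0 _ (_ : 0 < (dotp y y)^-1)) ?invr_gt0//.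
by rewrite (le_trans h)// le_eqVlt; apply/orP; left; apply/eqP; field.
Qed.

Let nrmD x y : nrm (x + y) <= nrm x + nrm y.
Proof.
have := dotp_sq x y 1; rewrite scale1r mulr1 expr1n mul1r => E.
have n0 : 0 <= nrm x + nrm y by rewrite addr_ge0// sqrtr_ge0.
have c : dotp x y <= nrm x * nrm y.
  rewrite /nrm -sqrtrM ?dotp_ge0//; apply: le_trans (ler_norm _) _.
  by rewrite -sqrtr_sqr ler_wsqrtr// cauchy.
rewrite -(ler_pXn2r (_ : 0 < 2)%N) ?nnegrE ?sqrtr_ge0//.
rewrite sqrrD !sqr_sqrtr ?dotp_ge0// E; lra.
Qed.

Let nrmZ a x : nrm (a *: x) = `|a| * nrm x.
Proof.
by rewrite /nrm dotpZl dotpC dotpZl mulrA -expr2 sqrtrM ?sqr_ge0// sqrtr_sqr.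
Qed.

Let nrm_eq0 x : nrm x = 0 -> x = 0.
Proof.
by move=> /eqP; rewrite sqrtr_eq0 => h; apply/dotp_eq0/le_anti; rewrite h dotp_ge0.
Qed.

HB.instance Definition _ := Lmodule_isNormed.Build R V nrmD nrmZ nrm_eq0.
HB.instance Definition _ := isInnerNormed.Build R V
  dotpC dotpDl dotpZl (fun=> erefl) dotp_ge0.

HB.end.

Section L2.
Context d (T : measurableType d) (R : realType).
Variable mu : {measure set T -> \bar R}.

Local Open Scope quotient_scope.
Local Notation L2fun := (LfunType mu (lee1n 2)).

Definition ae0 : {pred L2fun} :=
  [pred f : L2fun | `[< (f : T -> R) = cst 0 %[ae mu] >]].

Let L2funB (f g : L2fun) t : (f - g) t = f t - g t. Proof. by []. Qed.
Let L2funD (f g : L2fun) t : (f + g) t = f t + g t. Proof. by []. Qed.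
Let L2funZ a (f : L2fun) t : (a *: f) t = a * f t. Proof. by []. Qed.

Lemma ae0_zmod_closed : zmod_closed ae0.
Proof.
split; first by rewrite inE; exact: aeW.
move=> f g; rewrite !inE => f0 g0.
apply: filterS2 f0 g0 => t /(_ I) ft /(_ I) gt _.
by rewrite L2funB ft gt subr0.
Qed.

HB.instance Definition _ := GRing.isZmodClosed.Build L2fun ae0 ae0_zmod_closed.

(* L_2(mu), real-valued: measurable square-integrable functions modulo
   almost everywhere equality. *)
Definition L2 : Type := Quotient.quot ae0.
HB.instance Definition _ := GRing.Zmodule.on L2.
HB.instance Definition _ := EqQuotient.on L2.

Definition L2_fun (f : L2) : T -> R := (repr f : L2fun).
Coercion L2_fun : L2 >-> Funclass.

Lemma L2_eqP (f g : L2fun) :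
  reflect ((f : T -> R) = g %[ae mu]) (\pi_L2 f == \pi_L2 g)%qT.
Proof.
rewrite -Quotient.idealrBE.
apply: (iffP (asboolP _)); apply: filterS => t /(_ I) h _.
  by apply/eqP; rewrite -subr_eq0 -L2funB; apply/eqP.
by rewrite L2funB h subrr.
Qed.

Lemma L2_funE (f : L2fun) : (\pi_L2 f : L2) = f %[ae mu].
Proof. by apply/L2_eqP; rewrite reprK. Qed.

Lemma L2_ext (f g : L2) : (f : T -> R) = g %[ae mu] -> f = g.
Proof. by move=> /L2_eqP/eqP; rewrite !reprK. Qed.

Definition L2_scale (a : R) (f : L2) : L2 := \pi_L2 (a *: (repr f : L2fun)).

Lemma L2_add_ae (f g : L2) : (f + g : L2) = (fun t => f t + g t) %[ae mu].
Proof.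
have -> : f + g = \pi_L2 ((repr f : L2fun) + repr g).
  by rewrite (Quotient.pi_add _ (repr f : L2fun)) !reprK.
exact: L2_funE.
Qed.

Lemma L2_zero_ae : (0 : L2) = cst 0 %[ae mu].
Proof.
have -> : (0 : L2) = \pi_L2 (0 : L2fun) by rewrite piE.
exact: L2_funE.
Qed.

Lemma L2_scaleE a (f : L2) : L2_scale a f = (fun t => a * f t) %[ae mu].
Proof. exact: L2_funE. Qed.

Let scaleA a b v : L2_scale a (L2_scale b v) = L2_scale (a * b) v.
Proof.
apply: L2_ext; apply: filterS3 (L2_scaleE a (L2_scale b v)) (L2_scaleE b v)
  (L2_scaleE (a * b) v) => t /(_ I) -> /(_ I) -> /(_ I) -> _.
by rewrite mulrA.
Qed.

Let scale1 : left_id 1 L2_scale.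
Proof.
move=> v; apply: L2_ext; apply: filterS (L2_scaleE 1 v) => t /(_ I) -> _.
by rewrite mul1r.
Qed.

Let scaleDr : right_distributive L2_scale +%R.
Proof.
move=> a v w; apply: L2_ext.
apply: filterS2 (filterI (L2_scaleE a (v + w)) (L2_add_ae v w))
  (filterI (L2_add_ae (L2_scale a v) (L2_scale a w))
           (filterI (L2_scaleE a v) (L2_scaleE a w))).
by move=> t [/(_ I) -> /(_ I) ->] [/(_ I) -> [/(_ I) -> /(_ I) ->]] _; rewrite mulrDr.
Qed.

Let scaleDl v : {morph L2_scale^~ v : a b / a + b}.
Proof.
move=> a b /=; apply: L2_ext.
apply: filterS2 (L2_scaleE (a + b) v)
  (filterI (L2_add_ae (L2_scale a v) (L2_scale b v))
           (filterI (L2_scaleE a v) (L2_scaleE b v))).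
by move=> t /(_ I) -> [/(_ I) -> [/(_ I) -> /(_ I) ->]] _; rewrite mulrDl.
Qed.

HB.instance Definition _ := GRing.Zmodule_isLmodule.Build R L2
  scaleA scale1 scaleDr scaleDl.

Definition L2_dot (f g : L2) : R := \int[mu]_t (f t * g t).

Lemma L2_mul_integrable (f g : L2) :
  mu.-integrable setT (EFin \o (fun t => f t * g t)).
Proof.
by apply/Lfun1_integrable; apply: Lfun2_mul_Lfun1; exact: LfunP.
Qed.

Lemma L2_measurable (f : L2) : measurable_fun setT f.
Proof. by rewrite /L2_fun; exact: measurable_funP. Qed.

Lemma L2_dotE (f g : L2) (h : T -> R) : measurable_fun setT h ->
  h = (fun t => f t * g t) %[ae mu] -> L2_dot f g = \int[mu]_t h t.
Proof.
move=> mh fgh; rewrite /L2_dot /Rintegral; congr fine.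
apply: ae_eq_integral => //.
- by apply/measurable_EFinP; apply: measurable_funM; exact: L2_measurable.
- exact/measurable_EFinP.
- by apply: filterS fgh => t /(_ I) /= -> _.
Qed.

Let dotC (f g : L2) : L2_dot f g = L2_dot g f.
Proof. by rewrite /L2_dot; apply: eq_Rintegral => t _; rewrite mulrC. Qed.

Let dotDl (f g h : L2) : L2_dot (f + g) h = L2_dot f h + L2_dot g h.
Proof.
rewrite (@L2_dotE _ _ (fun t => f t * h t + g t * h t)).
- by rewrite RintegralD//; exact: L2_mul_integrable.
- by apply: measurable_funD; apply: measurable_funM; exact: L2_measurable.
- by apply: filterS (L2_add_ae f g) => t /(_ I) -> _; rewrite mulrDl.
Qed.

Let dotZl a (f g : L2) : L2_dot (a *: f) g = a * L2_dot f g.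
Proof.
rewrite (@L2_dotE _ _ (fun t => a * (f t * g t))).
- by rewrite RintegralZl//; exact: L2_mul_integrable.
- by apply: measurable_funM => //; apply: measurable_funM; exact: L2_measurable.
- by apply: filterS (L2_scaleE a f) => t /(_ I) /= -> _; rewrite mulrA.
Qed.

Let dot_ge0 (f : L2) : 0 <= L2_dot f f.
Proof. by apply: Rintegral_ge0 => t _; rewrite -expr2 sqr_ge0. Qed.

Let dot_eq0 (f : L2) : L2_dot f f = 0 -> f = 0.
Proof.
move=> f0.
have i := L2_mul_integrable f f.
have h0 : (\int[mu]_t `|(f t * f t)%:E| = 0)%E.
  under eq_integral do rewrite gee0_abs ?lee_fin -?expr2 ?sqr_ge0//.
  under eq_integral do rewrite expr2.
  rewrite -[LHS]fineK; last exact: integrable_fin_num i.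
  by rewrite -[fine _]/(L2_dot f f) f0.
move/ae_eq_integral_abs : h0 => /(_ measurableT) h0.
have {}h0 := h0 (measurable_int mu i).
have z := L2_zero_ae; apply: L2_ext.
apply: filterS2 h0 z => t /(_ I) /= [ft0] /(_ I) -> _; apply/eqP.
by have /eqP := ft0; rewrite mulf_eq0 orbb.
Qed.

HB.instance Definition _ := Lmodule_isInner.Build R L2
  dotC dotDl dotZl dot_ge0 dot_eq0.

End L2.

(* M neurons with the uniform weights 1/M: the inner product is the one of
   L_2 for the uniform probability on the M neurons, so that the finite-width
   formulas are the infinite-width ones for this probability. In particular
   the Jacobian in v composed with its adjoint is the Gram matrix G(u). *)
Definition finite_param (R : realType) (d M : nat) : Type :=
  ('rV[R]_M * 'M[R]_(M, d))%type.

Section FiniteParam.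
Context (R : realType) (d M : nat).
Local Notation W := (finite_param R d M).

HB.instance Definition _ := GRing.Lmodule.on W.

Definition finite_dot (w z : W) : R :=
  M%:R^-1 * \sum_(i < M) (w.1 0 i * z.1 0 i + \sum_(j < d) w.2 i j * z.2 i j).

Let dotC w z : finite_dot w z = finite_dot z w.
Proof.
congr (_ * _); apply: eq_bigr => i _; rewrite mulrC; congr (_ + _).
by apply: eq_bigr => j _; rewrite mulrC.
Qed.

Let dotDl (w w' z : W) : finite_dot (w + w') z = finite_dot w z + finite_dot w' z.
Proof.
rewrite -mulrDr -big_split; congr (_ * _); apply: eq_bigr => i _ /=.
rewrite mxE mulrDl addrACA -big_split; congr (_ + _).
by apply: eq_bigr => j _ /=; rewrite mxE mulrDl.
Qed.

Let dotZl a (w z : W) : finite_dot (a *: w) z = a * finite_dot w z.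
Proof.
rewrite mulrCA mulr_sumr; congr (_ * _); apply: eq_bigr => i _ /=.
rewrite mxE mulrDr mulrA; congr (_ + _); rewrite mulr_sumr.
by apply: eq_bigr => j _ /=; rewrite mxE mulrA.
Qed.

Let dot_ge0 (w : W) : 0 <= finite_dot w w.
Proof.
rewrite mulr_ge0// sumr_ge0// => i _; rewrite addr_ge0 -?expr2 ?sqr_ge0//.
by rewrite sumr_ge0// => j _; rewrite -expr2 sqr_ge0.
Qed.

Let dot_eq0 (w : W) : finite_dot w w = 0 -> w = 0.
Proof.
have s0 i : 0 <= \sum_(j < d) w.2 i j * w.2 i j.
  by rewrite sumr_ge0// => j _; rewrite -expr2 sqr_ge0.
have t0 i : 0 <= w.1 0 i * w.1 0 i + \sum_(j < d) w.2 i j * w.2 i j.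
  by rewrite addr_ge0 -?expr2 ?sqr_ge0.
move=> /eqP; rewrite mulf_eq0 invr_eq0 psumr_eq0// => H.
have {}H i : (w.1 0 i == 0) && (\sum_(j < d) w.2 i j * w.2 i j == 0).
  case/orP: H => [|/allP/(_ i (mem_index_enum _))] /=.
    by rewrite pnatr_eq0 => /eqP M0; exfalso; case: i => i; rewrite M0.
  by rewrite paddr_eq0 -?expr2 ?sqr_ge0// expf_eq0.
apply/eqP; rewrite -pair_eqE; apply/andP; split; apply/eqP/matrixP => i j.
  by rewrite ord1 mxE; apply/eqP; case/andP: (H j).
rewrite mxE; case/andP: (H i) => _; rewrite psumr_eq0; last first.
  by move=> k _; rewrite -expr2 sqr_ge0.
by move=> /allP/(_ j (mem_index_enum _)) /=; rewrite mulf_eq0 orbb => /eqP.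
Qed.

HB.instance Definition _ := Lmodule_isInner.Build R W
  dotC dotDl dotZl dot_ge0 dot_eq0.
End FiniteParam.

Notation borelRd R d := (g_sigma_algebraType (@open 'rV[R]_d)).

(* L_2(nu, R^d) is represented by its d coordinates in L_2(nu). *)
Definition L2_param (R : realType) (d : nat)
    (nu : {measure set (borelRd R d) -> \bar R}) : Type :=
  (L2 nu * {ffun 'I_d -> L2 nu})%type.

Section L2Param.
Context (R : realType) (d : nat).
Variable nu : {measure set (borelRd R d) -> \bar R}.
Local Notation W := (L2_param nu).

HB.instance Definition _ := GRing.Lmodule.on W.

Definition L2_param_dot (w z : W) : R :=
  inner w.1 z.1 + \sum_(j < d) inner (w.2 j) (z.2 j).

Let dotC w z : L2_param_dot w z = L2_param_dot z w.
Proof. by congr (_ + _); [|apply: eq_bigr => j _]; rewrite innerC. Qed.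

Let dotDl (w w' z : W) :
  L2_param_dot (w + w') z = L2_param_dot w z + L2_param_dot w' z.
Proof.
rewrite /L2_param_dot innerDl addrACA -big_split; congr (_ + _).
by apply: eq_bigr => j _ /=; rewrite ffunE innerDl.
Qed.

Let dotZl a (w z : W) : L2_param_dot (a *: w) z = a * L2_param_dot w z.
Proof.
rewrite /L2_param_dot innerZl mulrDr mulr_sumr; congr (_ + _).
by apply: eq_bigr => j _ /=; rewrite ffunE innerZl.
Qed.

Let dot_ge0 (w : W) : 0 <= L2_param_dot w w.
Proof. by rewrite addr_ge0 ?inner_ge0// sumr_ge0// => j _; exact: inner_ge0. Qed.

Let L2_eq0 (f : L2 nu) : inner f f == 0 -> f = 0.
Proof.
by move=> /eqP f0; apply/eqP; rewrite -normr_eq0 normr_inner f0 sqrtr0.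
Qed.

Let dot_eq0 (w : W) : L2_param_dot w w = 0 -> w = 0.
Proof.
move=> /eqP; rewrite paddr_eq0 ?inner_ge0//; last first.
  by rewrite sumr_ge0// => j _; exact: inner_ge0.
rewrite psumr_eq0; last by move=> j _; exact: inner_ge0.
case/andP => /L2_eq0 w1 /allP w2.
rewrite [w]surjective_pairing w1; congr pair; apply/ffunP => j; rewrite ffunE.
by apply: L2_eq0; apply: w2; rewrite mem_index_enum.
Qed.

HB.instance Definition _ := Lmodule_isInner.Build R W
  dotC dotDl dotZl dot_ge0 dot_eq0.
End L2Param.

(* The architecture; the base measure nu is a Borel probability on R^d. *)
Variant network (R : realType) (d : nat) : Type :=
| FiniteWidth of nat
| InfiniteWidth of probability (borelRd R d) R.

Arguments FiniteWidth {R d}.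

Section Network.
Context (R : realType) (d : nat).
Implicit Types (net : network R d) (nu : probability (borelRd R d) R).

Definition param_space net : innerType R :=
  match net with
  | FiniteWidth M => finite_param R d M
  | InfiniteWidth nu => L2_param nu
  end.

Definition finite_preact M (w : finite_param R d M) (i : 'I_M) (x : 'rV[R]_d) : R :=
  \sum_(j < d) w.2 i j * x 0 j.

Definition L2_preact nu (w : L2_param nu) (c : 'rV[R]_d) (x : 'rV[R]_d) : R :=
  \sum_(j < d) w.2 j c * x 0 j.

Definition model net (gamma : R -> R) : param_space net -> 'rV[R]_d -> R :=
  match net return param_space net -> 'rV[R]_d -> R with
  | FiniteWidth M => fun w x =>
      M%:R^-1 * \sum_(i < M) w.1 0 i * gamma (finite_preact w i x)
  | InfiniteWidth nu => fun w x =>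
      \int[nu]_c (w.1 c * gamma (L2_preact w c x))
  end.

Definition gram net (gamma : R -> R) N (x : 'I_N -> 'rV[R]_d) :
    param_space net -> 'M[R]_N :=
  match net return param_space net -> 'M[R]_N with
  | FiniteWidth M => fun w => \matrix_(n, n')
      (M%:R^-1 * \sum_(i < M)
         gamma (finite_preact w i (x n)) * gamma (finite_preact w i (x n')))
  | InfiniteWidth nu => fun w => \matrix_(n, n')
      \int[nu]_c (gamma (L2_preact w c (x n)) * gamma (L2_preact w c (x n')))
  end.

(* nu is concentrated on X, charges every nonempty relatively open subset of X,
   and has a finite second moment. *)
Definition admissible (X : set 'rV[R]_d) net : Prop :=
  match net with
  | FiniteWidth M => (0 < M)%N
  | InfiniteWidth nu =>
      [/\ nu.-negligible (~` X : set (borelRd R d)),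
          forall (c : 'rV[R]_d) (U : set (borelRd R d)),
            X c -> open (U : set 'rV[R]_d) -> U c -> (0 < nu U)%E
        & (\int[nu]_c (\sum_(j < d) (c : 'rV[R]_d) 0 j ^+ 2)%:E < +oo)%E]
  end.

(* The integrals defining f_w(x_n) (for every v) and G(u) converge. *)
Definition well_defined net (gamma : R -> R) N (x : 'I_N -> 'rV[R]_d) : Prop :=
  match net with
  | FiniteWidth M => True
  | InfiniteWidth nu => forall (w : L2_param nu) (n : 'I_N),
      (fun c : borelRd R d => gamma (L2_preact w c (x n))) \in Lfun nu 2%:E
  end.

Definition outputs net gamma N (x : 'I_N -> 'rV[R]_d) (w : param_space net) :
    'rV[R]_N :=
  \row_n model gamma w (x n).

End Network.

Section Outputs.
Context (R : realType) (N : nat).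

(* R^N carries kappa times the Euclidean inner product: kappa = 1 gives the
   Euclidean structure, kappa = 1/N that of L_2 of the empirical measure. *)
Definition odot (kappa : R) (a b : 'rV[R]_N) : R :=
  kappa * \sum_(n < N) a 0 n * b 0 n.

Definition onorm kappa (a : 'rV[R]_N) : R := Num.sqrt (odot kappa a a).

Definition grad kappa (loss : 'rV[R]_N -> R) (y : 'rV[R]_N) : 'rV[R]_N :=
  kappa^-1 *: \row_n 'D_(delta_mx 0 n) loss y.

Definition smooth_fun kappa (L : R) (loss : 'rV[R]_N -> R) : Prop :=
  (forall y, differentiable loss y) /\
  forall y z, onorm kappa (grad kappa loss y - grad kappa loss z)
              <= L * onorm kappa (y - z).

Definition strongly_convex kappa (mu : R) (loss : 'rV[R]_N -> R) : Prop :=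
  forall y z t, 0 <= t <= 1 ->
    loss (t *: y + (1 - t) *: z) <=
      t * loss y + (1 - t) * loss z
      - mu / 2 * (t * (1 - t)) * onorm kappa (y - z) ^+ 2.

Definition min_eigenvalue (A : 'M[R]_N) : R := inf [set a | eigenvalue A a].

End Outputs.

Definition continuously_differentiable (R : realType)
    (V U : normedModType R) (f : V -> U) : Prop :=
  (forall w, differentiable f w) /\
  forall w e, 0 < e ->
    \forall w' \near w, forall a, `|'d f w' a - 'd f w a| <= e * `|a|.

Definition twice_continuously_differentiable (R : realType) (g : R -> R) : Prop :=
  (forall z, derivable g z 1) /\ (forall z, derivable (derive1 g) z 1) /\
  continuous (derive1n 2 g).

Definition polynomial_fun (R : realType) (g : R -> R) : Prop :=
  exists p : {poly R}, forall z, g z = p.[z].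

Section GaussNewton.
Context (R : realType) (W : innerType R) (N : nat).
Variables (kappa : R) (F : W -> 'rV[R]_N).
Implicit Types (w : W) (a b : W).

Definition jac w : W -> 'rV[R]_N := 'd F w.

(* J_w^T, through <J_w^T y, a> = <y, J_w a>; such a vector exists (Riesz) and
   is unique when F is differentiable at w. *)
Definition jacT w (y : 'rV[R]_N) : W :=
  xget 0 [set z : W | forall a, inner z a = odot kappa y (jac w a)].

Definition ntk w : 'M[R]_N := lin1_mx (fun y => jac w (jacT w y)).

Definition damping (alpha : R) w : R := alpha * min_eigenvalue (ntk w).

(* Matrices act on row vectors from the right. This is the Woodbury form
   J^T (J J^T + eps H^-1)^-1 H^-1 grad of the field, which makes sense for
   eps = 0 too; gn_fieldP gives back (J^T H J + eps I)^-1 J^T grad. *)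
Definition gn_field (loss : 'rV[R]_N -> R) (H : W -> 'M[R]_N) (alpha : R) w : W :=
  jacT w (grad kappa loss (F w) *m invmx (H w)
          *m invmx (ntk w + damping alpha w *: invmx (H w))).

Lemma gn_fieldP loss (H : W -> 'M[R]_N) alpha w :
  (forall y a, inner (jacT w y) a = odot kappa y (jac w a)) ->
  H w \in unitmx -> ntk w + damping alpha w *: invmx (H w) \in unitmx ->
  let Phi := gn_field loss H alpha w in
  jacT w (jac w Phi *m H w) + damping alpha w *: Phi
    = jacT w (grad kappa loss (F w)).
Proof.
move=> adj uH uB Phi.
have inner_ext (z z' : W) : (forall a, inner z a = inner z' a) -> z = z'.
  move=> zz'; apply/eqP; rewrite -subr_eq0 -normr_eq0 normr_inner.
  by rewrite innerDl -scaleN1r innerZl mulN1r zz' subrr sqrtr0.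
have jacT_lin t (y y' : 'rV[R]_N) : jacT w (t *: y + y') = t *: jacT w y + jacT w y'.
  apply: inner_ext => a; rewrite innerDl innerZl !adj /odot mulrCA -mulrDr.
  congr (_ * _); rewrite mulr_sumr -big_split; apply: eq_bigr => n _ /=.
  by rewrite !mxE mulrDl mulrA.
pose jj (y : 'rV[R]_N) := jac w (jacT w y).
have jj_lin : linear jj.
  by move=> t y y'; rewrite /jj jacT_lin /jac linearP.
pose jjL := HB.pack_for {linear 'rV[R]_N -> 'rV[R]_N} jj
  (GRing.isLinear.Build _ _ _ _ _ jj_lin).
rewrite /Phi /gn_field; set eps := damping _ _; set y := _ *m invmx (ntk w + _).
have -> : jac w (jacT w y) = y *m ntk w by rewrite -[LHS]/(jjL y) -mul_rV_lin1.
rewrite addrC -jacT_lin; congr jacT.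
have -> : eps *: y = (eps *: (y *m invmx (H w))) *m H w.
  by rewrite -scalemxAl mulmxKV.
by rewrite -mulmxDl scalemxAr -mulmxDr addrC mulmxKV// mulmxKV.
Qed.

(* D is the derivative at w of w' |-> J_w', for the operator norm:
   J_w' b = J_w b + D (w' - w) b + o(|w' - w|) |b|, uniformly in b. *)
Definition is_jac_derivative w (D : W -> W -> 'rV[R]_N) : Prop :=
  [/\ \forall w' \near w, differentiable F w',
      forall a, linear (D a),
      forall b, linear (D^~ b)
    & forall e, 0 < e -> \forall w' \near w, forall b,
        onorm kappa (jac w' b - jac w b - D (w' - w) b) <= e * `|w' - w| * `|b|].

Definition bilinear_opnorm (D : W -> W -> 'rV[R]_N) : \bar R :=
  ereal_sup [set (onorm kappa (D ab.1 ab.2))%:E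
            | ab in [set ab : W * W | `|ab.1| <= 1 /\ `|ab.2| <= 1]].

(* The infimum is over the unique derivative of J at w; where J is not
   differentiable it is over the empty set, and the value is +oo. *)
Definition djac_opnorm w : \bar R :=
  ereal_inf [set bilinear_opnorm D | D in is_jac_derivative w].

Definition djac_bound (w0 : W) (rad : R) : \bar R :=
  ereal_sup [set djac_opnorm w | w in ball w0 rad].

End GaussNewton.

Section Flow.
Context (R : realType) (W : normedModType R).
Implicit Types (Phi : W -> W) (T : \bar R) (w : R -> W).

(* w solves w' = - Phi(w), w(0) = w0 on [0, T[; the derivative at 0 is from
   the right. *)
Definition flow_on Phi (w0 : W) T w : Prop :=
  [/\ (0 < T)%E, w 0 = w0,
      h^-1 *: (w h - w 0) @[h --> 0^'+] --> - Phi (w 0)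
    & forall t, 0 < t -> (t%:E < T)%E -> is_derive t 1 w (- Phi (w t))].

(* T is the maximal time of existence, and w the unique solution. *)
Definition maximal_flow Phi (w0 : W) T w : Prop :=
  flow_on Phi w0 T w /\
  forall T' w', flow_on Phi w0 T' w' ->
    (T' <= T)%E /\ forall t, 0 <= t -> (t%:E < T')%E -> w' t = w t.

End Flow.

(* Main.v *)
(* Write A = J J^T, s^2 for its smallest eigenvalue, eps = alpha s^2 and g for
   the gradient of the objective at the outputs. The field is Phi = J^T z with
   z A H + eps z = g (row vectors), so the outputs move with velocity -p, where
   p = z A is the image of g under (H + eps A^-1)^-1.

   As eps A^-1 <= alpha, <g, p> >= |g|^2 / (L_H + alpha), and the
   Polyak-Lojasiewicz inequality makes the objective decay at rate mu_GN. As
   |Phi|^2 = <z, p> and |p| <= |g| / mu_H, also |Phi| <= |g| / (s mu_H); with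
   |g_t| <= (L / mu) |g_0| exp (- mu_GN t / 2) the whole trajectory has length
   at most 2 L |g_0| / (mu mu_H mu_GN s).

   The Jacobian is C-Lipschitz on the ball B(w_0, R) and the tangent directions
   of the linear layer give |J_{w_0}^T y| >= sqrt kappa sigma_0 |y|, so s stays
   at least half this value within distance sqrt kappa sigma_0 / (2 C) of w_0;
   the smallness of g_0 keeps the trajectory in a strictly smaller ball.

   Phi is locally Lipschitz there. Local solutions come from Picard iteration in
   the Hilbert space of parameters, whose antiderivatives are obtained from
   scalar ones by Riesz representation, and the a priori bound on the length
   continues them to all times. *)
Require Import Defs.
From HB Require Import structures.
From mathcomp Require Import all_boot all_order all_algebra.
From mathcomp Require Import ring lra.
From mathcomp Require Import all_classical all_reals all_analysis.
From mathcomp Require Import measurable_realfun.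

Set Implicit Arguments.
Unset Strict Implicit.
Unset Printing Implicit Defensive.
Import Order.TTheory GRing.Theory Num.Theory.
Import numFieldNormedType.Exports.
Local Open Scope classical_set_scope.
Local Open Scope ring_scope.

(** * Inner product spaces *)

(** Outside the ball of radius [r] on which the lower bound for [J^T] is known, [A] may be singular
    and nothing is known about [Phi]. Solutions are therefore always handled together with the
    information [stays], and the a priori estimate improves the open condition at radius [r] to a
    closed one at some [r1 < r]; this gain is what allows continuation. Maximality compares with
    flows that might leave the ball, so uniqueness asks only one of the two solutions to stay.

    Constants: let s0 = sqrt kappa * sigma_0 and let rho be min(R, 1/C). The working radius is r =
    rho * min(1, s0 / 2), where [J^T] keeps the lower bound s0 / 2. The length bound falls below r
    as soon as min(sigma_0, sigma_0^2) <= 2 N s0 min(1, s0 / 2). The two cases of the last minimum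
    explain sigma_0 and sigma_0^2, and N absorbs kappa, which is 1 or 1/N. The 8 collects three
    factors 2: from the integral of exp (- mu_GN t / 2), from the halving of s0, and from the s0 / 2
    in r. *)

Lemma discr_le (R : realType) (a b c : R) : 0 <= c ->
  (forall t, 0 <= a + 2 * t * b + t ^+ 2 * c) -> b ^+ 2 <= a * c.
Proof.
move=> c0 h; have [cE|cN] := eqVneq c 0.
  have [->|bN] := eqVneq b 0; first by rewrite cE expr0n mulr0.
  (* With [c = 0] the expression is affine in [t]; this [t] gives it the value -1. *)
  have := h (- (a + 1) / (2 * b)).
  have -> : a + 2 * (- (a + 1) / (2 * b)) * b = - 1 by field.
  by rewrite cE; lra.
have cp : 0 < c by rewrite lt_neqAle eq_sym cN.
have := h (- b / c).
have -> : a + 2 * (- b / c) * b + (- b / c) ^+ 2 * c = (a * c - b ^+ 2) / c.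
  by field.
by rewrite pmulr_lge0 ?invr_gt0// subr_ge0.
Qed.

Lemma psd_cauchy_schwarz (R : realType) (V : lmodType R) (B : V -> V -> R) :
  (forall x y, B x y = B y x) ->
  (forall x y z, B (x + y) z = B x z + B y z) ->
  (forall a x y, B (a *: x) y = a * B x y) ->
  (forall x, 0 <= B x x) ->
  forall x y, B x y ^+ 2 <= B x x * B y y.
Proof.
move=> BC BD BZ B0 x y; apply: discr_le => // t.
have := B0 (x + t *: y); congr (_ <= _).
by rewrite BD BZ (BC x) (BC y (_ + _)) !BD !BZ (BC y x); ring.
Qed.

Section Inner.
Context (R : realType) (W : innerType R).
Implicit Types (x y z : W) (a : R).

Lemma innerDr x y z : inner x (y + z) = inner x y + inner x z.
Proof. by rewrite innerC innerDl !(innerC x). Qed.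

Lemma innerZr a x y : inner x (a *: y) = a * inner x y.
Proof. by rewrite innerC innerZl innerC. Qed.

Lemma innerNl x y : inner (- x) y = - inner x y.
Proof. by rewrite -scaleN1r innerZl mulN1r. Qed.

Lemma innerNr x y : inner x (- y) = - inner x y.
Proof. by rewrite innerC innerNl innerC. Qed.

Lemma innerBl x y z : inner (x - y) z = inner x z - inner y z.
Proof. by rewrite innerDl innerNl. Qed.

Lemma inner0l x : inner 0 x = 0.
Proof. by rewrite -(scale0r x) innerZl mul0r. Qed.

Lemma sqr_norm_inner x : `|x| ^+ 2 = inner x x.
Proof. by rewrite normr_inner sqr_sqrtr ?inner_ge0. Qed.

Lemma ler_inner_norm x y : `|inner x y| <= `|x| * `|y|.
Proof.
rewrite -(ler_pXn2r (_ : 0 < 2)%N) ?nnegrE ?mulr_ge0// exprMn !sqr_norm_inner.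
rewrite real_normK ?num_real//; apply: psd_cauchy_schwarz => *.
- exact: innerC.
- exact: innerDl.
- exact: innerZl.
- exact: inner_ge0.
Qed.

Lemma inner_ext x y : (forall z, inner x z = inner y z) -> x = y.
Proof.
move=> xy; apply/eqP; rewrite -subr_eq0 -normr_eq0 normr_inner.
by rewrite innerBl xy subrr sqrtr0.
Qed.

(** The test vector [z = x] suffices. Together with [inner_ext], this reduces vector statements to
    scalar ones throughout. *)
Lemma ler_norm_inner x a : 0 <= a ->
  (forall z, inner x z <= a * `|z|) -> `|x| <= a.
Proof.
move=> a0 h; have [->|x0] := eqVneq x 0; first by rewrite normr0.
have := h x; rewrite -sqr_norm_inner expr2 ler_pM2r//.
by rewrite normr_gt0.
Qed.

Lemma parallelogram x y :
  `|x + y| ^+ 2 + `|x - y| ^+ 2 = 2 * `|x| ^+ 2 + 2 * `|y| ^+ 2.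
Proof.
by rewrite !sqr_norm_inner !innerDl !innerDr !innerNl !innerNr (innerC y x); ring.
Qed.

End Inner.

(** Completeness in the only form that is used: minimising sequences, Picard iterates and samples of
    a curve near its end time can all be arranged to have geometrically decaying steps. *)
Definition geometric_complete (R : realType) (W : normedModType R) :=
  forall (u : nat -> W) (c : R),
  (forall n, `|u n.+1 - u n| <= c * 2^-1 ^+ n) ->
  exists l : W, u @ \oo --> l.

Section Geometric.
Context (R : realType) (W : normedModType R).
Implicit Types (u : nat -> W) (c : R).

Lemma geometric_dist u c n k :
  (forall n, `|u n.+1 - u n| <= c * 2^-1 ^+ n) ->
  `|u (n + k)%N - u n| <= 2 * c * 2^-1 ^+ n.
Proof.
move=> h; have c0 : 0 <= c by have := h 0; rewrite expr0 mulr1; exact: le_trans.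
(* The factor [1 - 2^-k] strengthens the induction: it leaves exactly the room for the next step. *)
have H : `|u (n + k)%N - u n| <= 2 * c * 2^-1 ^+ n * (1 - 2^-1 ^+ k).
  elim: k => [|k IH]; first by rewrite addn0 subrr normr0 expr0 subrr mulr0.
  rewrite addnS -(subrKA (u (n + k)%N)).
  apply: le_trans (ler_normD _ _) _; apply: le_trans (lerD (h _) IH) _.
  by rewrite exprS exprD; lra.
apply: le_trans H _; rewrite ler_piMr ?mulr_ge0 ?exprn_ge0 ?invr_ge0//.
Qed.

Lemma geometric_cvg_dist u c l n :
  (forall n, `|u n.+1 - u n| <= c * 2^-1 ^+ n) -> u @ \oo --> l ->
  `|l - u n| <= 2 * c * 2^-1 ^+ n.
Proof.
move=> h ul; apply/ler_addgt0Pr => e e0.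
move/cvgrPdist_lt : ul => /(_ _ e0) [m _ /(_ (n + m)%N) /= /(_ (leq_addl _ _)) lt].
rewrite -(subrKA (u (n + m)%N)) addrC.
apply: le_trans (ler_normD _ _) _; apply: lerD; last exact: ltW.
exact: geometric_dist.
Qed.

End Geometric.

Lemma geometric_lt (R : realType) (c e : R) : 0 < e ->
  exists n, c * 2^-1 ^+ n < e.
Proof.
move=> e0.
have : (fun n => c * 2^-1 ^+ n) @ \oo --> (c * 0 : R).
  by apply: cvgM; [exact: cvg_cst|apply: cvg_expr; rewrite ger0_norm; lra].
rewrite mulr0 => /cvgrPdist_lt/(_ _ e0) [n _ /(_ n (leqnn n))] /=.
by rewrite sub0r normrN => /(le_lt_trans (ler_norm _)); exists n.
Qed.

Lemma real_geometric_complete (R : realType) :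
  geometric_complete (R : normedModType R).
Proof.
move=> u c h; suff : cvg (u @ \oo) by move=> ?; exists (lim (u @ \oo)).
apply/cauchy_cvgP/cauchy_exP => e e0.
have [n ne] := geometric_lt (2 * c) e0.
exists (u n), n => // m /= nm; rewrite -(subnKC nm) -ball_normE /= distrC.
exact: le_lt_trans (geometric_dist _ _ h) ne.
Qed.

Section Riesz.
Context (R : realType) (W : innerType R).
Hypothesis Wc : geometric_complete W.

(** The vector is the minimiser of [J x = |x|^2 - 2 l x], whose Euler equation is [inner z a = l a];
    it is the limit of a minimising sequence. *)
Lemma riesz (l : W -> R) (c0 : R) : linear l -> (forall a, `|l a| <= c0 * `|a|) ->
  exists z, forall a, inner z a = l a.
Proof.
move=> lin bnd0; pose c := `|c0|.
have bnd a : `|l a| <= c * `|a|.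
  by apply: le_trans (bnd0 a) _; rewrite ler_wpM2r// ler_norm.
have lD a b : l (a + b) = l a + l b by have := lin 1 a b; rewrite !scale1r.
have l0 : l 0 = 0 by apply/eqP; rewrite -normr_le0 (le_trans (bnd 0))// normr0 mulr0.
have lZ t a : l (t *: a) = t * l a by have := lin t a 0; rewrite !addr0 l0 addr0.
pose J x := `|x| ^+ 2 - 2 * l x.
pose A := range J.
have J_lb : lbound A (- c ^+ 2).
  move=> _ [x _ <-]; rewrite /J.
  have := le_trans (ler_norm _) (bnd x); have := sqr_ge0 (`|x| - c); nra.
have hA : has_inf A by split; [exists (J 0), 0|exists (- c ^+ 2)].
have infA x : inf A <= J x by apply: inf_lbound; [case: hA|exists x].
(* The precision is the square of [2^-n] because [dist2] controls squared distances. *)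
have ex n : exists x, J x <= inf A + (2^-1 ^+ n) ^+ 2.
  have [] := @inf_adherent _ A ((2^-1 ^+ n) ^+ 2) _ hA.
    by rewrite exprn_gt0// exprn_gt0.
  by move=> _ [x _ <-] /ltW xlt; exists x.
have [u hu] := choice ex.
have h4 : (2^-1 ^+ 2 = 4^-1 :> R) by field.
(* Parallelogram identity, with [J] at the midpoint of [x] and [y] bounded below by [inf A]. *)
have dist2 x y : `|x - y| ^+ 2 <= 2 * (J x - inf A) + 2 * (J y - inf A).
  have := infA (2^-1 *: (x + y)); rewrite /J lZ lD normrZ exprMn.
  have := parallelogram x y; rewrite ger0_norm ?invr_ge0// h4.
  lra.
have uc n : `|u n.+1 - u n| <= 2 * 2^-1 ^+ n.
  rewrite -(ler_pXn2r (_ : 0 < 2)%N) ?nnegrE ?mulr_ge0 ?exprn_ge0//.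
  apply: le_trans (dist2 _ _) _; have := hu n; have := hu n.+1.
  rewrite (exprS _ n).
  have := sqr_ge0 (2^-1 ^+ n : R); lra.
have [z uz] := Wc uc.
(* Continuity of [J] made quantitative: [z] and [u n] are [4 q] apart with [q = 2^-n], so [J z]
   exceeds [J (u n)] by at most a multiple of [q]. *)
have Jz : J z = inf A.
  apply: le_anti; rewrite infA andbT.
  have zu n := geometric_cvg_dist n uc uz.
  apply/ler_addgt0Pr => e e0.
  have [n ne] := geometric_lt (1 + 8 * `|z| + 16 + 8 * c) e0.
  have := hu n; have := zu n; have := bnd (z - u n).
  rewrite -scaleN1r lD lZ mulN1r scaleN1r.
  set q := 2^-1 ^+ n in ne *; have q0 : 0 <= q by rewrite exprn_ge0.
  have q1 : q <= 1 by rewrite exprn_ile1//; lra.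
  have := ler_normD z (u n - z); rewrite addrC subrK (distrC (u n)).
  have c0' : 0 <= c by exact: normr_ge0.
  have := ler_normD (u n) (z - u n); rewrite addrC subrK.
  have : l (u n) - l z <= `|l z - l (u n)| by rewrite distrC ler_norm.
  have := normr_ge0 z; have := normr_ge0 (u n); have := normr_ge0 (z - u n).
  rewrite /J; move: (`|z|) (`|u n|) (`|z - u n|) (`|l z - l (u n)|) ne.
  move=> a b d lzu ne d0 b0 a0 h1 h2 h3 h5 h6 h7.
  have : a ^+ 2 - b ^+ 2 <= 4 * q * (2 * a + 4 * q) by nra.
  have : lzu <= c * (4 * q) by apply: le_trans h5 _; rewrite ler_wpM2l//; lra.
  have : q ^+ 2 <= q by rewrite expr2 ler_piMl.
  by nra.
exists z => a.
(* Minimality along the line [z + t *: a] says that [2 t (inner z a - l a) + t^2 |a|^2] is never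
   negative; its discriminant gives the claim. *)
suff : (inner z a - l a) ^+ 2 <= 0 * `|a| ^+ 2.
  by rewrite mul0r => h; apply/eqP; rewrite -subr_eq0 -sqrf_eq0 eq_le h sqr_ge0.
apply: discr_le (sqr_ge0 _) _.
  move=> t; have := infA (z + t *: a); rewrite -Jz /J lD lZ !sqr_norm_inner.
  by rewrite innerDl !innerDr !innerZl !innerZr (innerC a z); lra.
Qed.

End Riesz.

(** * Derivatives and antiderivatives of curves *)

(** The first-order expansion, free of division: [h = 0] is allowed, so localising, shifting and
    gluing curves need no punctured neighbourhoods. *)
Definition has_deriv (R : realType) (W : normedModType R) (f : R -> W) (t : R) (d : W) :=
  forall e, 0 < e -> exists2 r, 0 < r &
    forall h, `|h| < r -> `|f (t + h) - f t - h *: d| <= e * `|h|.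

Lemma has_derivP (R : realType) (W : normedModType R) (f : R -> W) (t : R) (d : W) :
  is_derive t 1 f d <-> has_deriv f t d.
Proof.
split=> [[df fd] e e0|H].
  have : h^-1 *: (f (h *: 1 + t) - f t) @[h --> 0^'] --> d.
    by rewrite -fd; exact: df.
  move=> /cvgrPdist_lt/(_ _ e0); rewrite near_withinE => /nbhs_ballP[r /= r0 H].
  exists r => // h hr; have [->|h0] := eqVneq h 0.
    by rewrite addr0 subrr scale0r subr0 !normr0 mulr0.
  have := H h; rewrite /ball /= sub0r normrN => /(_ hr h0).
  rewrite /= scaler1 (addrC h) => /ltW H1.
  have -> : f (t + h) - f t - h *: d = - (h *: (d - h^-1 *: (f (t + h) - f t))).
    by rewrite scalerBr scalerA divff// scale1r opprB.
  by rewrite normrN normrZ mulrC ler_wpM2r.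
have H1 : h^-1 *: (f (h *: 1 + t) - f t) @[h --> 0^'] --> d.
  apply/cvgrPdist_le => e /H[r r0 {}H].
  rewrite near_withinE; apply/nbhs_ballP; exists r => // h.
  rewrite /ball /= sub0r normrN scaler1 (addrC h) => /H H1 h0.
  have -> : d - h^-1 *: (f (t + h) - f t) = - (h^-1 *: (f (t + h) - f t - h *: d)).
    by rewrite (scalerBr _ _ (h *: d)) scalerA mulVf// scale1r opprB.
  by rewrite normrN normrZ normfV mulrC ler_pdivrMr ?normr_gt0.
apply: DeriveDef; last exact/cvg_lim.
by apply/cvg_ex; exists d.
Qed.

Section HasDeriv.
Context (R : realType) (W : normedModType R).
Implicit Types (f g : R -> W) (t : R) (d : W).

Lemma has_deriv_near f g t d r : 0 < r ->
  (forall s, `|s - t| < r -> g s = f s) -> has_deriv f t d -> has_deriv g t d.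
Proof.
move=> r0 gf H e /H[q q0 {}H]; exists (Num.min r q); first by rewrite lt_min r0.
move=> h; rewrite lt_min => /andP[hr hq].
by rewrite !gf ?subrr ?normr0 ?(addrC t) ?addrK// addrC; exact: H.
Qed.

Lemma has_deriv_glue f g t d : f t = g t ->
  has_deriv f t d -> has_deriv g t d ->
  has_deriv (fun s => if s <= t then f s else g s) t d.
Proof.
move=> fg Hf Hg e e0; have [q q0 {}Hf] := Hf e e0; have [r r0 {}Hg] := Hg e e0.
exists (Num.min r q); first by rewrite lt_min r0.
move=> h; rewrite lt_min lexx => /andP[/Hg{}Hg /Hf{}Hf].
by case: ifP => _ //; rewrite fg.
Qed.

Lemma has_deriv_cst (a : W) t : has_deriv (fun=> a) t 0.
Proof.
move=> e e0; exists 1 => // h _.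
by rewrite subrr scaler0 subr0 normr0 mulr_ge0// ltW.
Qed.

Lemma has_derivD f g t a b : has_deriv f t a -> has_deriv g t b ->
  has_deriv (fun s => f s + g s) t (a + b).
Proof. by move=> /has_derivP Hf /has_derivP Hg; apply/has_derivP; exact: is_deriveD. Qed.

Lemma has_derivN f t a : has_deriv f t a -> has_deriv (fun s => - f s) t (- a).
Proof. by move=> /has_derivP Hf; apply/has_derivP; exact: is_deriveN. Qed.

Lemma has_derivB f g t a b : has_deriv f t a -> has_deriv g t b ->
  has_deriv (fun s => f s - g s) t (a - b).
Proof. by move=> Hf /has_derivN; exact: has_derivD. Qed.

Lemma has_deriv_shift f t c d : has_deriv f (t - c) d ->
  has_deriv (fun s => f (s - c)) t d.
Proof.
move=> H e /H[r r0 {}H]; exists r => // h /H.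
by rewrite (addrAC t).
Qed.

Lemma has_deriv_cont f t d : has_deriv f t d -> {for t, continuous f}.
Proof.
move=> /has_derivP[df _]; apply/differentiable_continuous.
exact/derivable1_diffP.
Qed.

End HasDeriv.

Lemma has_derivZid (R : realType) (W : normedModType R) (d : W) (t : R) :
  has_deriv (fun s : R => s *: d) t d.
Proof.
move=> e e0; exists 1 => // h _.
by rewrite scalerDl (addrC (t *: d)) addrK subrr normr0 mulr_ge0// ltW.
Qed.

Lemma has_derivMr (R : realType) (f : R -> R) (t d c : R) :
  has_deriv f t d -> has_deriv (fun s => f s * c) t (d * c).
Proof.
move=> /has_derivP Hf; apply/has_derivP.
have -> : (fun s => f s * c) = c *: f by apply/funext => s; exact: mulrC.
by rewrite (mulrC d); exact: is_deriveZ.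
Qed.

Lemma has_deriv_inner (R : realType) (W : innerType R) (f : R -> W) (t : R) (d a : W) :
  has_deriv f t d -> has_deriv (fun s => inner (f s) a) t (inner d a).
Proof.
move=> H e e0; have a1 : 0 < `|a| + 1 by rewrite ltr_wpDl.
have [|r r0 {}H] := H (e / (`|a| + 1)); first by rewrite divr_gt0.
exists r => // h /H{}H.
have -> : inner (f (t + h)) a - inner (f t) a - h *: inner d a =
    inner (f (t + h) - f t - h *: d) a by rewrite !innerBl innerZl.
apply: le_trans (ler_inner_norm _ _) _; apply: le_trans (ler_wpM2r _ H) _ => //.
rewrite mulrAC ler_wpM2r// mulrAC ler_pdivrMr// ler_wpM2l ?(ltW e0)//.
by rewrite lerDl.
Qed.

Lemma has_deriv_sqr_norm (R : realType) (W : innerType R) (f : R -> W) (t : R) (d : W) :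
  has_deriv f t d -> has_deriv (fun s => `|f s| ^+ 2) t (2 * inner (f t) d).
Proof.
move=> H e e0.
have d1 : 0 < `|d| + 1 by rewrite ltr_wpDl.
have [|r1 r10 H1] := H 1; first exact: ltr01.
have p0 : 0 < 2 * `|f t| + 1 by rewrite ltr_wpDl ?mulr_ge0.
have [|r2 r20 H2] := H (e / 2 / (2 * `|f t| + 1)); first by rewrite !divr_gt0.
(* Below this radius the quadratic remainder, at most [(|h| (|d| + 1))^2], is at most
   [e / 2 * |h|]. *)
pose r3 := e / 2 / (`|d| + 1) ^+ 2.
have r30 : 0 < r3 by rewrite !divr_gt0// exprn_gt0.
exists (Num.min r1 (Num.min r2 r3)); first by rewrite !lt_min r10 r20.
move=> h; rewrite !lt_min => /and3P[/H1{}H1 /H2{}H2 /ltW h3].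
rewrite !sqr_norm_inner; set q := f (t + h) - f t - h *: d in H1 H2.
have dE : f (t + h) - f t = q + h *: d by rewrite subrK.
have fE : f (t + h) = f t + (f (t + h) - f t) by rewrite addrCA subrr addr0.
have -> : inner (f (t + h)) (f (t + h)) - inner (f t) (f t)
    - h *: (2 * inner (f t) d : R) =
    2 * inner (f t) q + `|f (t + h) - f t| ^+ 2.
  rewrite sqr_norm_inner {1 2}fE; move: dE; move: (f (t + h) - f t) => z dE.
  have fz : inner (f t) z = inner (f t) q + h * inner (f t) d.
    by rewrite dE innerDr innerZr.
  rewrite innerDl (innerDr (f t)) (innerDr z) (innerC z (f t)) fz /GRing.scale /=.
  ring.
apply: le_trans (ler_normD _ _) _.
rewrite [X in _ <= X](_ : _ = e / 2 * `|h| + e / 2 * `|h|); last first.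
  by rewrite -mulrDl -splitr.
apply: lerD.
  rewrite normrM ger0_norm//; apply: le_trans (ler_wpM2l _ (ler_inner_norm _ _)) _ => //.
  rewrite mulrA; apply: le_trans (ler_wpM2l _ H2) _; first by rewrite mulr_ge0.
  rewrite mulrA ler_wpM2r// mulrCA ler_piMr ?divr_ge0 ?(ltW e0)//.
  by rewrite ler_pdivrMr// mul1r lerDl.
rewrite normrX normr_id dE.
have : `|q + h *: d| <= `|h| * (`|d| + 1).
  by apply: le_trans (ler_normD _ _) _; rewrite normrZ; lra.
move=> H3; apply: le_trans (_ : (`|h| * (`|d| + 1)) ^+ 2 <= _).
  by rewrite lerXn2r ?nnegrE// mulr_ge0// ltW.
rewrite exprMn expr2 -mulrA mulrC ler_wpM2r//.
by rewrite -ler_pdivlMr ?exprn_gt0.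
Qed.

Lemma deriv_le0_nincr (R : realType) (f df : R -> R) (a b : R) : a <= b ->
  (forall t, a <= t <= b -> has_deriv f t (df t)) ->
  (forall t, a <= t <= b -> df t <= 0) -> f b <= f a.
Proof.
move=> ab H df0.
have [||c /[!in_itv]/= cab E] := @MVT_segment R f df a b ab.
- move=> t /[!in_itv]/= /andP[/ltW at' /ltW tb]; apply/has_derivP; apply: H.
  by rewrite at' tb.
- apply: derivable_within_continuous => t; rewrite in_itv /= => tab.
  by have /has_derivP[] := H _ tab.
by rewrite -subr_le0 E mulr_le0_ge0 ?df0// subr_ge0.
Qed.

(** Mean value inequality by duality: for each [z] the scalar function [inner (f t) z - g t * |z|]
    has a nonpositive derivative. *)
Lemma deriv_norm_le (R : realType) (W : innerType R) (f df : R -> W)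
    (g dg : R -> R) (a b : R) : a <= b ->
  (forall t, a <= t <= b -> has_deriv f t (df t)) ->
  (forall t, a <= t <= b -> has_deriv g t (dg t)) ->
  (forall t, a <= t <= b -> `|df t| <= dg t) -> `|f b - f a| <= g b - g a.
Proof.
move=> ab Hf Hg H.
have g0 : 0 <= g b - g a.
  rewrite subr_ge0 -lerN2.
  apply: (@deriv_le0_nincr _ (fun t => - g t) (fun t => - dg t)) => // t tab.
    exact/has_derivN/Hg.
  by rewrite oppr_le0 (le_trans _ (H _ tab)).
apply: ler_norm_inner => // z.
have := @deriv_le0_nincr _ (fun t => inner (f t) z - g t * `|z|)
  (fun t => inner (df t) z - dg t * `|z|) a b ab.
rewrite innerBl mulrBl => h; suff : inner (f b) z - g b * `|z| <=
  inner (f a) z - g a * `|z| by lra.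
apply: h => t tab.
  apply: has_derivB; first exact/has_deriv_inner/Hf.
  exact/has_derivMr/Hg.
rewrite subr_le0 (le_trans (ler_norm _))// (le_trans (ler_inner_norm _ _))//.
by rewrite ler_wpM2r ?H.
Qed.

Lemma has_deriv_opp (R : realType) (W : normedModType R) (f : R -> W) (t : R) (d : W) :
  has_deriv f (- t) d -> has_deriv (fun s => - f (- s)) t d.
Proof.
move=> H e /H[r r0 {}H]; exists r => // h hr.
have := H (- h); rewrite normrN => /(_ hr); congr (_ <= _).
by rewrite -[LHS]normrN scaleNr !opprD !opprK.
Qed.

(** The integral from [a], which is differentiated strictly beyond its lower end only. *)
Lemma half_line_antiderivative (R : realType) (h : R -> R) (a : R) : continuous h ->
  exists P : R -> R, forall t, a < t -> has_deriv P t (h t).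
Proof.
move=> ch; eexists => t at'; apply/has_derivP.
have [||D E] := @continuous_FTC1_closed R h a t (t + 1) _ _ at' (ch t).
- by rewrite ltrDl.
- apply: continuous_compact_integrable; first exact: segment_compact.
  exact: continuous_subspaceT.
by apply: DeriveDef; [exact: D | rewrite -derive1E].
Qed.

(** One integral from -1 covers the positive times, a reflected one the negative times. Both are
    defined around 0, so after subtraction of their values there they glue differentiably. *)
Lemma scalar_antiderivative (R : realType) (h : R -> R) : continuous h ->
  exists P, P 0 = 0 /\ forall t, has_deriv P t (h t).
Proof.
move=> ch.
have [P HP] := half_line_antiderivative (-1) ch.
have [Q HQ] : exists Q : R -> R, forall t, -1 < t -> has_deriv Q t (h (- t)).
  apply: (@half_line_antiderivative _ (h \o -%R)) => t.
  by apply: continuous_comp; [exact: opp_continuous|exact: ch].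
pose p s := P s - P 0; pose q s := - Q (- s) - - Q 0.
have Hp t : -1 < t -> has_deriv p t (h t).
  by move=> /HP/has_derivB/(_ (has_deriv_cst (P 0) t)); rewrite subr0.
have Hq t : t < 1 -> has_deriv q t (h t).
  move=> t1; rewrite -(subr0 (h t)); apply: has_derivB (has_deriv_cst _ _).
  apply: has_deriv_opp; rewrite -{2}(opprK t); apply: HQ.
  by rewrite ltrN2.
exists (fun s => if s <= 0 then q s else p s).
split=> [|t]; first by rewrite lexx /q oppr0 subrr.
have [t0|t0|->] := ltgtP t 0.
- apply: (@has_deriv_near _ _ q _ _ _ (- t)) => [|s st|]; first by rewrite oppr_gt0.
    by rewrite ifT//; move: st; rewrite ltr_norml => /andP[_]; lra.
  by apply: Hq; lra.
- apply: (@has_deriv_near _ _ p _ _ _ t) => [//|s st|].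
    rewrite ifF//; apply/negbTE; rewrite -ltNge.
    by move: st; rewrite ltr_norml => /andP[+ _]; lra.
  by apply: Hp; lra.
- by apply: has_deriv_glue; [rewrite /p /q oppr0 !subrr|apply: Hq|apply: Hp]; lra.
Qed.

Lemma deriv_unique (R : realType) (P Q h : R -> R) :
  P 0 = 0 -> Q 0 = 0 -> (forall t, has_deriv P t (h t)) ->
  (forall t, has_deriv Q t (h t)) -> forall t, P t = Q t.
Proof.
move=> P0 Q0 HP HQ t; apply/eqP; rewrite -subr_eq0; apply/eqP.
have D (s : R) : is_derive s 1 (fun s : R => P s - Q s) (0 : R).
  by apply/has_derivP; rewrite -(subrr (h s)); exact: has_derivB.
rewrite (is_derive_0_is_cst t 0 D).
by rewrite P0 Q0 subrr.
Qed.

Lemma deriv_abs_le_itv (R : realType) (f df : R -> R) (a b M : R) : a <= b ->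
  (forall s, a <= s <= b -> has_deriv f s (df s)) ->
  (forall s, a <= s <= b -> `|df s| <= M) -> `|f b - f a| <= M * (b - a).
Proof.
move=> ab Hf HM.
(* Used with [c = 1] and [c = -1], one for each side of the absolute value. *)
have D c s : a <= s <= b -> has_deriv (fun s => c * f s - s * M) s (c * df s - M).
  move=> sab; apply: has_derivB; last exact: has_derivZid.
  rewrite mulrC; apply: has_deriv_near (has_derivMr _ (Hf _ sab)) => //.
  by move=> r _; rewrite mulrC.
have le0 c s : `|c| = 1 -> a <= s <= b -> c * df s - M <= 0.
  move=> c1 /HM; rewrite subr_le0 -[leLHS]mul1r -c1 -normrM.
  exact: le_trans (ler_norm _).
rewrite ler_norml; apply/andP; split.
  have := deriv_le0_nincr ab (D (-1)) (fun s => le0 _ s (normrN1 _)); lra.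
have := deriv_le0_nincr ab (D 1) (fun s => le0 _ s (normr1 _)); lra.
Qed.

Lemma deriv_abs_le (R : realType) (f df : R -> R) (t h M : R) :
  (forall s, `|s - t| <= `|h| -> has_deriv f s (df s)) ->
  (forall s, `|s - t| <= `|h| -> `|df s| <= M) -> `|f (t + h) - f t| <= M * `|h|.
Proof.
move=> Hf HM; have [h0|h0] := leP 0 h.
  have -> : M * `|h| = M * (t + h - t) by rewrite ger0_norm// addrAC subrr add0r.
  apply: deriv_abs_le_itv => [|s st|s st]; [lra|apply: Hf|apply: HM];
    by rewrite !ger0_norm; lra.
rewrite distrC; have -> : M * `|h| = M * (t - (t + h)) by rewrite ltr0_norm//; lra.
apply: deriv_abs_le_itv => [|s st|s st]; [lra|apply: Hf|apply: HM];
  by rewrite ler0_norm ?ltr0_norm; lra.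
Qed.

(** At a fixed time the scalar antiderivatives of [inner (f s) a] depend linearly on [a], since
    antiderivatives vanishing at 0 are unique, and are bounded by [B * |t| * |a|]; these are the
    hypotheses of [riesz]. *)
Lemma antiderivative (R : realType) (W : innerType R) (f : R -> W) (B : R) :
  geometric_complete W -> continuous f -> (forall t, `|f t| <= B) ->
  exists I, I 0 = 0 /\ forall t, has_deriv I t (f t).
Proof.
move=> Wc cf fB.
have hc a : continuous (fun t => inner (f t) a).
  move=> t; apply/cvgrPdist_lt => e e0.
  have a1 : 0 < `|a| + 1 by rewrite ltr_wpDl.
  have /cvgrPdist_lt/(_ _ (divr_gt0 e0 a1)) := cf t.
  apply: filterS => s H; rewrite -innerBl.
  apply: le_lt_trans (ler_inner_norm _ _) _.
  rewrite ltr_pdivlMr// in H; apply: le_lt_trans H.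
  by rewrite ler_wpM2l// lerDl.
have [P HP] := choice (fun a => scalar_antiderivative (hc a)).
have P0 a : P a 0 = 0 by have [] := HP a.
have DP a t : has_deriv (P a) t (inner (f t) a) by have [] := HP a.
have Plin t : linear (P^~ t).
  move=> c a b; pose Q s := P a s * c + P b s.
  rewrite (_ : c *: _ + _ = Q t); last by rewrite /Q /GRing.scale /= mulrC.
  apply: (@deriv_unique _ (P (c *: a + b)) Q _ _ _ (DP _)) => // [|s].
    by rewrite /Q !P0 mul0r addr0.
  rewrite innerDr innerZr mulrC.
  by apply: has_derivD => //; exact: has_derivMr.
have Pbnd t a : `|P a t| <= B * `|t| * `|a|.
  have := @deriv_abs_le _ (P a) (fun s => inner (f s) a) 0 t (B * `|a|).
  rewrite add0r P0 subr0 mulrAC; apply => s _; first exact: DP.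
  by apply: le_trans (ler_inner_norm _ _) _; rewrite ler_wpM2r.
have [I HI] := choice (fun t => riesz Wc (Plin t) (Pbnd t)).
exists I; split; first by apply: inner_ext => a; rewrite HI P0 inner0l.
(* The radius comes from continuity of [f] in norm, so the estimate below is uniform in the test
   vector [a]. *)
move=> t e e0; have /cvgrPdist_le/(_ _ e0)/nbhs_ballP[r /= r0 H] := cf t.
exists r => // h hr; apply: ler_norm_inner => [|a]; first by rewrite mulr_ge0// ltW.
rewrite !innerBl innerZl !HI; apply: le_trans (ler_norm _) _.
pose Q s := P a s - s * inner (f t) a.
have -> : P a (t + h) - P a t - h * inner (f t) a = Q (t + h) - Q t.
  by rewrite /Q; ring.
rewrite mulrAC; apply: (@deriv_abs_le _ _ (fun s => inner (f s) a - inner (f t) a)).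
  move=> s _; apply: has_derivB => //.
  exact: has_derivZid.
move=> s st; rewrite -innerBl; apply: le_trans (ler_inner_norm _ _) _.
rewrite ler_wpM2r// distrC; apply: H; rewrite -ball_normE /= distrC.
exact: le_lt_trans st hr.
Qed.

(** * Local existence *)

Section Picard.
Context (R : realType) (W : innerType R) (Psi : W -> W).
Hypothesis Wc : geometric_complete W.
Variables (q : W) (r B K : R).
Hypotheses (r_gt0 : 0 < r) (B_ge0 : 0 <= B) (K_ge0 : 0 <= K).
Hypothesis Psi_bnd : forall x, `|x - q| <= r -> `|Psi x| <= B.
Hypothesis Psi_lip : forall x y, `|x - q| <= r -> `|y - q| <= r ->
  `|Psi x - Psi y| <= K * `|x - y|.
Variable tau : R.
Hypotheses (tau_gt0 : 0 < tau) (B_tau : B * tau <= r) (K_tau : K * tau <= 2^-1).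

(** Clamping time to [[-tau, tau]] makes the field along a curve bounded and continuous on the whole
    line, as [antiderivative] requires. *)
Let clamp (t : R) : R := Num.max (- tau) (Num.min t tau).

Let clampE t : `|t| <= tau -> clamp t = t.
Proof.
rewrite ler_norml => /andP[t1 t2]; rewrite /clamp min_l// max_r//.
Qed.

Let clamp_norm t : `|clamp t| <= tau.
Proof.
rewrite ler_norml /clamp le_max lexx /= ge_max ge_min lexx orbT andbT.
by rewrite lerNl (le_trans _ (ltW tau_gt0))// oppr_le0 ltW.
Qed.

Let clamp_lip s t : `|clamp s - clamp t| <= `|s - t|.
Proof.
have st1 := ler_norm (s - t); have st2 := ler_norm (t - s).
rewrite distrC in st2; rewrite ler_norml; apply/andP.
rewrite /clamp /Order.max /Order.min; have t0 := tau_gt0.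
move: (`|s - t|) st1 st2 => N st1 st2.
by split; case: (ltP s tau) => ?; case: (ltP t tau) => ?; do ?[case: (ltP (- tau) _) => ?]; lra.
Qed.

(** A class preserved by the Picard map and by pointwise limits; as [B * tau <= r], its members stay
    in the ball where [Psi] is controlled during clamped times. *)
Let curve (w : R -> W) := w 0 = q /\ forall s t, `|w s - w t| <= B * `|s - t|.

Let curve_in w t : curve w -> `|w (clamp t) - q| <= r.
Proof.
move=> [<- wlip]; apply: le_trans (wlip _ _) _; rewrite subr0.
by apply: le_trans B_tau; rewrite ler_wpM2l.
Qed.

Let field_along (w : R -> W) t := Psi (w (clamp t)).

Let field_along_lip w s t : curve w ->
  `|field_along w s - field_along w t| <= K * B * `|s - t|.
Proof.
move=> cw; apply: le_trans (Psi_lip _ _) _; rewrite ?curve_in//.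
rewrite -mulrA ler_wpM2l//; apply: le_trans (cw.2 _ _) _.
by rewrite ler_wpM2l// clamp_lip.
Qed.

Let lip_continuous (f : R -> W) c :
  (forall s t, `|f s - f t| <= c * `|s - t|) -> continuous f.
Proof.
move=> f_lip t; apply/cvgrPdist_lt => e e0; apply/nbhs_ballP.
have c1 : 0 < `|c| + 1 by rewrite ltr_wpDl.
exists (e / (`|c| + 1)); first by rewrite /= divr_gt0.
move=> s; rewrite /ball /= ltr_pdivlMr// => st.
apply: le_lt_trans (f_lip _ _) _; apply: le_lt_trans st.
rewrite mulrC ler_wpM2l//; have := ler_norm c; lra.
Qed.

Let picard_ex w : curve w -> exists v, curve v /\
  forall t, has_deriv v t (field_along w t).
Proof.
move=> cw.
have [||I [I0 HI]] := @antiderivative _ _ (field_along w) B Wc.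
- by apply: lip_continuous => s t; exact: field_along_lip.
- by move=> t; apply: Psi_bnd; exact: curve_in.
exists (fun t => q + I t); split; last first.
  move=> t; rewrite -[field_along w t]add0r.
  by apply: has_derivD => //; exact: has_deriv_cst.
split=> [|s t]; first by rewrite I0 addr0.
rewrite opprD addrACA subrr add0r.
wlog st : s t / t <= s.
  move=> H; have [|/ltW] := leP t s; first exact: H.
  by move/H; rewrite distrC (distrC s).
rewrite (ger0_norm (_ : 0 <= s - t)) ?subr_ge0// mulrC mulrBl.
apply: (@deriv_norm_le _ _ _ (field_along w) (fun t => t * B) (fun=> B)) => // u _.
  exact: has_derivZid.
by apply: Psi_bnd; exact: curve_in.
Qed.

Let next w : R -> W := xget (fun=> q) [set v | curve v /\
  forall t, has_deriv v t (field_along w t)].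

Let nextP w : curve w -> curve (next w) /\
  forall t, has_deriv (next w) t (field_along w t).
Proof. by move=> /picard_ex; exact: xgetPex. Qed.

(** The contraction factor [1 / 2] comes from [K * tau <= 1 / 2] and is the ratio that
    [geometric_complete] expects. *)
Let next_contract w v c : 0 <= c -> curve w -> curve v ->
  (forall t, `|t| <= tau -> `|w t - v t| <= c) ->
  forall t, `|t| <= tau -> `|next w t - next v t| <= c / 2.
Proof.
move=> c0 cw cv wv t ttau.
have [[nw0 _] Hw] := nextP cw; have [[nv0 _] Hv] := nextP cv.
have lip s : `|field_along w s - field_along v s| <= K * c.
  apply: le_trans (Psi_lip _ _) _; rewrite ?curve_in//.
  by rewrite ler_wpM2l// wv.
have key s : 0 <= s -> `|s| <= tau -> (`|next w s - next v s| <= c / 2) *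
    (`|next w (- s) - next v (- s)| <= c / 2).
  move=> s0 stau; have Kc : s * (K * c) <= c / 2.
    rewrite mulrA (mulrC s) [leRHS]mulrC ler_wpM2r//.
    by apply: le_trans K_tau; rewrite ler_wpM2l// -(ger0_norm s0).
  split; apply: le_trans Kc.
    have := @deriv_norm_le _ _ (fun s => next w s - next v s)
      (fun s => field_along w s - field_along v s)
      (fun s => s * (K * c)) (fun=> K * c) 0 s s0.
    rewrite nw0 nv0 mul0r !subrr !subr0; apply=> // u _.
      exact: has_derivB.
    exact: has_derivZid.
  have := @deriv_norm_le _ _ (fun s => next w s - next v s)
      (fun s => field_along w s - field_along v s)
      (fun s => s * (K * c)) (fun=> K * c) (- s) 0 _.
  rewrite oppr_le0 nw0 nv0 mul0r !subrr !sub0r normrN mulNr opprK; apply=> // u _.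
      exact: has_derivB.
  exact: has_derivZid.
have [t0|t0] := leP 0 t; first by have [] := key _ t0 ttau.
have [] := key (- t); rewrite ?normrN ?opprK// oppr_ge0 ltW//.
Qed.

Lemma picard : exists w : R -> W, w 0 = q /\
  forall t, `|t| < tau -> has_deriv w t (Psi (w t)) /\ `|w t - q| <= B * `|t|.
Proof.
pose u n := iter n next (fun=> q).
have cu n : curve (u n).
  elim: n => [|n IH]; last by have [] := nextP IH.
  by split => // s t; rewrite subrr normr0 mulr_ge0.
have du n t : `|t| <= tau -> `|u n.+1 t - u n t| <= r * 2^-1 ^+ n.
  move=> ttau; elim: n t ttau => [|n IH] t ttau.
    rewrite expr0 mulr1 {2}/u /=; have [c0 cl] := cu 1.
    have := cl t 0; rewrite c0 subr0 => /le_trans; apply.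
    by apply: le_trans B_tau; rewrite ler_wpM2l.
  rewrite exprSr mulrA; apply: (next_contract _ (cu n.+1) (cu n) IH) => //.
  by rewrite mulr_ge0 ?exprn_ge0 ?invr_ge0// ltW.
have ex s : exists l : W, `|s| <= tau -> u ^~ s @ \oo --> l.
  have [stau|] := leP `|s| tau; last by exists 0.
  by have [l ul] := Wc (fun n => du n s stau); exists l.
have [w0 Hw0] := choice ex; pose w s := w0 (clamp s).
have wu n s : `|s| <= tau -> `|w s - u n s| <= 2 * r * 2^-1 ^+ n.
  move=> stau; rewrite /w clampE//.
  by apply: (@geometric_cvg_dist _ _ (u ^~ s)) (Hw0 s stau) => m; exact: du.
have ww s : w s = w (clamp s) by rewrite /w (clampE (clamp_norm s)).
have cw : curve w.
  split.
    apply/eqP; rewrite -subr_eq0 -normr_le0; apply/ler_addgt0Pr => e e0.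
    have [n ne] := geometric_lt (2 * r) e0.
    have [un0 _] := cu n; have := wu n 0; rewrite normr0 un0 => /(_ (ltW tau_gt0)).
    by move=> /le_trans; apply; rewrite add0r ltW.
  move=> s t; apply: le_trans (_ : B * `|clamp s - clamp t| <= _); last first.
    by rewrite ler_wpM2l// clamp_lip.
  rewrite (ww s) (ww t).
  apply/ler_addgt0Pr => e e0; have [n ne] := geometric_lt (4 * r) e0.
  have h1 := wu n _ (clamp_norm s); have h2 := wu n _ (clamp_norm t).
  have h3 := (cu n).2 (clamp s) (clamp t).
  rewrite -(subrKA (u n (clamp s))) -[X in _ + X](subrKA (u n (clamp t))).
  apply: le_trans (ler_normD _ _) _; apply: le_trans (lerD (lexx _) (ler_normD _ _)) _.
  by move: h2; rewrite distrC; lra.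
(* The limit [w] is known only as a pointwise limit, so the solution returned is [next w], which is
   differentiable by construction and coincides with [w] on [[-tau, tau]]. *)
have [[nw0 nwl] Hw] := nextP cw.
exists (next w); split => // t ttau.
have nwE s : `|s| <= tau -> next w s = w s.
  move=> stau; apply/eqP; rewrite -subr_eq0 -normr_le0; apply/ler_addgt0Pr => e e0.
  have [n ne] := geometric_lt (2 * r) e0.
  have c0 : 0 <= 2 * r * 2^-1 ^+ n by rewrite !mulr_ge0 ?exprn_ge0 ?invr_ge0// ltW.
  have h1 := next_contract c0 cw (cu n) (fun s => wu n s) stau.
  have h2 := wu n.+1 s stau; move: h2; rewrite /u iterS -/(u n) exprS => h2.
  rewrite -(subrKA (next (u n) s)); apply: le_trans (ler_normD _ _) _.
  by move: h2; rewrite distrC; lra.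
split; last by rewrite -nw0 -[X in _ * `|X|]subr0; exact: nwl.
by rewrite nwE ?ltW// ww; exact: Hw.
Qed.
End Picard.

(** * Global flows *)

Lemma has_deriv_expR (R : realType) (c t : R) :
  has_deriv (fun t : R => expR (c * t)) t (expR (c * t) * c).
Proof.
have D1 : is_derive t (1 : R) (fun t : R => c * t : R) c.
  apply/has_derivP; rewrite -[X in has_deriv _ _ X]mul1r.
  apply: has_deriv_near (has_derivMr c (has_derivZid (1 : R) t)) => // s _.
  by rewrite /GRing.scale /= mulr1 mulrC.
by apply/has_derivP; exact: is_derive1_comp (is_derive_expR (c * t)) D1.
Qed.

(** [f t * exp (- c t)] is nonincreasing. The sign of [c] is free: positive rates serve uniqueness,
    negative ones the decay of the objective. *)
Lemma gronwall (R : realType) (f df : R -> R) (a b c : R) : a <= b ->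
  (forall t, a <= t <= b -> has_deriv f t (df t)) ->
  (forall t, a <= t <= b -> df t <= c * f t) -> f b <= f a * expR (c * (b - a)).
Proof.
move=> ab Hf H.
pose g t := f t * expR (- c * t).
have : g b <= g a.
  apply: (@deriv_le0_nincr _ g (fun t => (df t - c * f t) * expR (- c * t))) => // t tab.
    have /has_derivP Df := Hf _ tab; apply/has_derivP.
    have /has_derivP De := has_deriv_expR (- c) t.
    have := is_deriveM Df De; rewrite /GRing.scale /= => /is_derive_eq; apply.
    by ring.
  by rewrite mulr_le0_ge0 ?expR_ge0// subr_le0 H.
rewrite /g -(ler_pM2r (expR_gt0 (c * b))) -mulrA -expRD mulNr addNr expR0 mulr1.
by rewrite -mulrA -expRD; congr (_ <= _ * expR _); ring.
Qed.

Section Flow.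
Context (R : realType) (W : innerType R) (Psi : W -> W).
Hypothesis Wc : geometric_complete W.
Variables (w0 : W) (r : R).
Hypothesis r_gt0 : 0 < r.
Hypothesis Psi_loc_lip : forall p, `|p - w0| < r -> exists d K, [/\ 0 < d, 0 <= K &
  forall x y, `|x - p| < d -> `|y - p| < d -> `|Psi x - Psi y| <= K * `|x - y|].

(* Prolonging by the tangent line at time 0 makes the derivative at 0 two-sided
   and the prolonged solutions unique on the whole line. *)
Definition solves (T : \bar R) (w : R -> W) :=
  (forall s, s <= 0 -> w s = w0 + s *: Psi w0) /\
  forall t, 0 <= t -> (t%:E < T)%E -> has_deriv w t (Psi (w t)).

Definition stays (T : \bar R) (w : R -> W) :=
  forall t, 0 <= t -> (t%:E < T)%E -> `|w t - w0| < r.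

Lemma solves0 T w : solves T w -> w 0 = w0.
Proof. by case=> -> //; rewrite scale0r addr0. Qed.

Lemma solvesW T T' w : (T <= T')%E -> solves T' w -> solves T w.
Proof. by move=> TT' [w1 w2]; split=> // t t0 tT; apply: w2 => //; exact: lt_le_trans TT'. Qed.

Lemma staysW T T' w : (T <= T')%E -> stays T' w -> stays T w.
Proof. by move=> TT' H t t0 tT; apply: H => //; exact: lt_le_trans TT'. Qed.

Lemma has_deriv_near_lt (f : R -> W) t d e : has_deriv f t d -> 0 < e ->
  exists2 h, 0 < h & forall s, `|s - t| < h -> `|f s - f t| < e.
Proof.
move=> /has_deriv_cont/cvgrPdist_lt/(_ _) H e0.
have /nbhs_ballP[h h0 {}H] := H e e0; exists h => // s st.
by rewrite distrC; apply: H; rewrite -ball_normE /= distrC.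
Qed.

(** Gronwall for the squared distance, which vanishes at [s] and grows at rate at most [2 * K].
    Continuity keeps both curves where [Psi] is Lipschitz, so only the common value at [s] must lie
    in the ball. *)
Lemma local_uniqueness w z s b : s <= b ->
  `|w s - w0| < r -> w s = z s ->
  (forall t, s <= t <= b -> has_deriv w t (Psi (w t))) ->
  (forall t, s <= t <= b -> has_deriv z t (Psi (z t))) ->
  exists2 h, 0 < h & forall t, s <= t -> t <= b -> t < s + h -> w t = z t.
Proof.
move=> sb wr wz Dw Dz; have [d [K [d0 K0 HK]]] := Psi_loc_lip wr.
have ss : s <= s <= b by rewrite lexx.
have [h1 h10 H1] := has_deriv_near_lt (Dw _ ss) d0.
have [h2 h20 H2] := has_deriv_near_lt (Dz _ ss) d0.
exists (Num.min h1 h2); first by rewrite lt_min h10.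
move=> t st tb; rewrite -ltrBlDl lt_min => /andP[th1 th2].
have close u : s <= u <= t -> (`|w u - w s| < d) * (`|z u - w s| < d).
  move=> /andP[su ut]; rewrite {2}wz; split; [apply: H1|apply: H2];
  by rewrite ger0_norm ?subr_ge0//; lra.
have sub u : s <= u <= t -> s <= u <= b by move=> /andP[-> /le_trans->].
have := @gronwall _ (fun u => `|w u - z u| ^+ 2)
  (fun u => 2 * inner (w u - z u) (Psi (w u) - Psi (z u))) s t (2 * K) st.
rewrite wz subrr normr0 expr0n mul0r => /(_ _ _)/wrap H.
apply/eqP; rewrite -subr_eq0 -normr_eq0 -sqrf_eq0 eq_le sqr_ge0 andbT.
case: H => // [u ut|u ut]; first exact/has_deriv_sqr_norm/has_derivB/Dz/sub/ut/Dw/sub.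
have [wu zu] := close _ ut.
rewrite -mulrA ler_wpM2l//; apply: le_trans (ler_norm _) _.
apply: le_trans (ler_inner_norm _ _) _.
by rewrite expr2 mulrA mulrC ler_wpM2r// HK.
Qed.

(** Let [s] be the infimum of the times of disagreement: the curves agree at [s] by continuity and a
    little beyond it by [local_uniqueness]. At [s] the curve [z] is in the ball because [w] is, so
    [z] needs no assumption of staying. *)
Lemma uniqueness T w z : solves T w -> stays T w -> solves T z ->
  forall t, (t%:E < T)%E -> w t = z t.
Proof.
move=> Sw stw Sz t1 t1T.
have [t10|/ltW t10] := leP t1 0; first by rewrite Sw.1 ?Sz.1.
apply: contrapT => neq.
pose E := [set t | 0 <= t <= t1 /\ w t <> z t].
have Et1 : E t1 by split=> //; rewrite t10 lexx.
have hE : has_inf E by split; [exists t1|exists 0 => t [/andP[]]].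
pose s := inf E.
have s0 : 0 <= s by apply: lb_le_inf; [exists t1|move=> t [/andP[]]].
have st1 : s <= t1 by apply: inf_lbound => //; case: hE.
have below t : 0 <= t -> t < s -> w t = z t.
  move=> t0 ts; apply: contrapT => tE.
  have : s <= t.
    apply: inf_lbound; first by case: hE.
    by split=> //; rewrite t0 (le_trans (ltW ts)).
  by rewrite leNgt ts.
have ltT t : t <= t1 -> (t%:E < T)%E by move=> ?; apply: le_lt_trans t1T; rewrite lee_fin.
have ws : w s = z s.
  move: s0; rewrite le_eqVlt => /predU1P[<-|s0]; first by rewrite (solves0 Sw) (solves0 Sz).
  apply/eqP; rewrite -subr_eq0 -normr_le0; apply/ler_addgt0Pr => e e0; rewrite add0r.
  have e2 : 0 < e / 2 by rewrite divr_gt0.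
  have [h1 h10 H1] := has_deriv_near_lt (Sw.2 _ (ltW s0) (ltT _ st1)) e2.
  have [h2 h20 H2] := has_deriv_near_lt (Sz.2 _ (ltW s0) (ltT _ st1)) e2.
  (* [s - h] is a nonnegative time before [s], where the curves agree, and within both continuity
     radii. *)
  pose h := Num.min s (Num.min h1 h2) / 2.
  have [hs [hh1 hh2]] : h <= s /\ (h < h1 /\ h < h2).
    have : Num.min s (Num.min h1 h2) <= s by rewrite ge_min lexx.
    have : Num.min s (Num.min h1 h2) <= h1 by rewrite !ge_min lexx orbT.
    have : Num.min s (Num.min h1 h2) <= h2 by rewrite !ge_min lexx !orbT.
    by rewrite /h; lra.
  have h0 : 0 < h by rewrite divr_gt0// !lt_min s0 h10.
  have := H1 (s - h); have := H2 (s - h).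
  rewrite below ?subr_ge0 ?ltrBlDr ?ltrDl//.
  rewrite addrAC subrr add0r normrN gtr0_norm// => /(_ hh2) zs /(_ hh1) wsh.
  rewrite -(subrKA (z (s - h))) (le_trans (ler_normD _ _))// distrC.
  by rewrite (splitr e) lerD// ltW.
have [|t /andP[st tt1]|t /andP[st tt1]|h h0 Hh] := @local_uniqueness w z s t1 st1 _ ws.
- exact: stw (ltT _ st1).
- exact: Sw.2 (le_trans s0 st) (ltT _ tt1).
- exact: Sz.2 (le_trans s0 st) (ltT _ tt1).
have : s + h <= s.
  apply: lb_le_inf; first by exists t1.
  move=> t [/andP[t0 tt1] wzt]; rewrite leNgt; apply/negP => th.
  have [ts|ts] := ltP t s; first by apply: wzt; exact: below.
  by apply: wzt; exact: Hh.
by rewrite gerDl leNgt h0.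
Qed.

(** The time [tau] is uniform over the starting points near [p]. This is what continuation needs,
    since it restarts from points that only approach [p]. *)
Lemma local_existence p : `|p - w0| < r -> exists d tau, [/\ 0 < d, 0 < tau &
  forall q, `|q - p| < d -> exists y : R -> W, y 0 = q /\
    forall t, `|t| < tau -> has_deriv y t (Psi (y t)) /\ `|y t - w0| < r].
Proof.
move=> pr; have [d0 [K [d00 K0 HK]]] := Psi_loc_lip pr.
pose d := Num.min d0 (r - `|p - w0|).
have dp : 0 < d by rewrite lt_min d00 subr_gt0.
have dd0 : d <= d0 by rewrite ge_min lexx.
have dr : d <= r - `|p - w0| by rewrite ge_min lexx orbT.
pose B := `|Psi p| + K * d.
have B0 : 0 <= B by rewrite addr_ge0// mulr_ge0// ltW.
have B1 : 0 < B + 1 by rewrite ltr_wpDl.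
have K1 : 0 < K + 1 by rewrite ltr_wpDl.
(* The first term gives [B * tau <= d / 4], the second [K * tau <= 1 / 2]; the added 1 keeps the
   denominators positive. Starting within [d / 2] of [p], the curve stays within [d] of it. *)
pose tau := Num.min (d / 4 / (B + 1)) (2^-1 / (K + 1)).
exists (d / 2), tau; split; rewrite ?lt_min ?divr_gt0//.
move=> q qp.
have near_p x : `|x - q| <= d / 4 -> `|x - p| < d.
  move=> xq; rewrite -(subrKA q) (le_lt_trans (ler_normD _ _))//; lra.
have tau0 : 0 < tau by rewrite lt_min !divr_gt0.
have [|||||w [w0q Hw]] := @picard _ _ Psi Wc q (d / 4) B K _ B0 K0 _ _ tau tau0.
- by rewrite divr_gt0.
- move=> x /near_p xp; rewrite -(subrK (Psi p) (Psi x)) addrC.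
  apply: le_trans (ler_normD _ _) _; rewrite lerD2l.
  apply: le_trans (HK _ _ _ _) _; rewrite ?subrr ?normr0 ?(lt_le_trans xp)//.
  by rewrite ler_wpM2l// ltW.
- by move=> x y /near_p xp /near_p yp; apply: HK; exact: lt_le_trans dd0.
- apply: le_trans (_ : B * (d / 4 / (B + 1)) <= _).
    by rewrite ler_wpM2l// ge_min lexx.
  rewrite mulrA ler_pdivrMr// mulrC ler_wpM2l ?divr_ge0 ?ltW//; lra.
- apply: le_trans (_ : K * (2^-1 / (K + 1)) <= _).
    by rewrite ler_wpM2l// ge_min lexx orbT.
  rewrite mulrA ler_pdivrMr//; lra.
exists w; split=> // t ttau; have [D wq] := Hw t ttau; split=> //.
have : `|w t - p| < d.
  apply: near_p; apply: le_trans wq _.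
  apply: le_trans (_ : B * (d / 4 / (B + 1)) <= _).
    by rewrite ler_wpM2l// (le_trans (ltW ttau))// ge_min lexx.
  rewrite mulrA ler_pdivrMr// mulrC ler_wpM2l ?divr_ge0 ?ltW//; lra.
move=> wp; rewrite -(subrKA p) (le_lt_trans (ler_normD _ _))//; lra.
Qed.

(** Solutions on shorter intervals agree by uniqueness, so the diagonal choice, at each time [t] a
    solution reaching beyond [t], is locally one of them. *)
Lemma solves_union S : (0 < S)%E ->
  (forall T : R, (T%:E < S)%E -> exists w, solves T%:E w /\ stays T%:E w) ->
  exists w, solves S w /\ stays S w.
Proof.
move=> S0 H.
have ex t : exists Tw : R * (R -> W), (t%:E < S)%E ->
    [/\ t < Tw.1, (Tw.1%:E < S)%E, solves Tw.1%:E Tw.2 & stays Tw.1%:E Tw.2].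
  have [tS|] := boolP (t%:E < S)%E; last by exists (0, fun=> w0).
  have [T tT TS] : exists2 T, t < T & (T%:E < S)%E.
    move: tS {H S0}; case: S => [s| |] //=; last by exists (t + 1); rewrite ?ltrDl ?ltry.
    by rewrite lte_fin => ts; exists ((t + s) / 2); rewrite ?lte_fin; lra.
  by have [w [? ?]] := H _ TS; exists (T, w).
have [V HV] := choice ex.
pose w t := (V t).2 t.
have wV t s : (t%:E < S)%E -> s < (V t).1 -> w s = (V t).2 s.
  move=> tS sV; have [tV VS Sv stv] := HV t tS.
  have sS : (s%:E < S)%E by apply: lt_trans VS; rewrite lte_fin.
  have [sV' VS' Sv' stv'] := HV s sS; pose T := Num.min (V s).1 (V t).1.
  apply: (@uniqueness T%:E (V s).2).
  - by apply: solvesW Sv'; rewrite lee_fin ge_min lexx.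
  - by apply: staysW stv'; rewrite lee_fin ge_min lexx.
  - by apply: solvesW Sv; rewrite lee_fin ge_min lexx orbT.
  - by rewrite lte_fin lt_min sV'.
exists w; split; [split=> [s s0|t t0 tS]|move=> t t0 tS].
- have [|_ _ [E _] _] := HV s; first by rewrite (le_lt_trans _ S0)// lee_fin.
  exact: E.
- have [tV VS Sv stv] := HV t tS; rewrite (wV t t tS tV).
  apply: (@has_deriv_near _ _ (V t).2 _ _ _ ((V t).1 - t)); rewrite ?subr_gt0//.
    move=> s; rewrite ltr_norml => /andP[_ st]; apply: wV => //; lra.
  by apply: Sv.2; rewrite ?lte_fin.
- by have [tV VS Sv stv] := HV t tS; apply: stv; rewrite ?lte_fin.
Qed.

(** Bounded speed gives the curve a limit [p] at time [s], and [r1 < r] puts [p] inside the open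
    ball. A restart shortly before [s] then runs past [s]. *)
Lemma solves_extend s w (r1 B : R) : 0 < s -> r1 < r ->
  solves s%:E w -> stays s%:E w ->
  (forall t, 0 <= t < s -> `|w t - w0| <= r1 /\ `|Psi (w t)| <= B) ->
  exists s' w', [/\ s < s', solves s'%:E w' & stays s'%:E w'].
Proof.
move=> s0 r1r Sw stw bnd.
have e_ge0 n : 0 <= (2^-1 ^+ n : R) by rewrite exprn_ge0 ?invr_ge0.
have e_gt0 n : 0 < (2^-1 ^+ n : R) by rewrite exprn_gt0 ?invr_gt0.
have e_le1 n : (2^-1 ^+ n : R) <= 1 by rewrite exprn_ile1 ?invr_ge0//; lra.
(* Sampling at times whose distance to [s] halves makes the increments of [u] geometric. *)
pose time n := s - s * 2^-1 ^+ n.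
have time_in n : 0 <= time n < s.
  by rewrite /time subr_ge0 ler_piMr ?(ltW s0)//= gtrBl mulr_gt0.
have B0 : 0 <= B by have [|_] := bnd 0; rewrite ?lexx//; exact: le_trans.
pose u n := w (time n).
have uc n : `|u n.+1 - u n| <= B * s * 2^-1 ^+ n.
  have tle : time n <= time n.+1.
    rewrite /time lerD2l lerN2 ler_wpM2l ?(ltW s0)// exprS.
    by have := e_ge0 n; lra.
  apply: le_trans (_ : time n.+1 * B - time n * B <= _); last first.
    by rewrite -mulrBl mulrC -mulrA ler_wpM2l// /time exprS; have := e_ge0 n; nra.
  apply: (@deriv_norm_le _ _ _ (fun t => Psi (w t)) (fun t => t * B) (fun=> B)) => //.
  - move=> t /andP[t1 t2]; have /andP[a0 _] := time_in n; have /andP[_ bs] := time_in n.+1.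
    by apply: Sw.2; [exact: le_trans t1|rewrite lte_fin (le_lt_trans t2)].
  - by move=> t _; exact: has_derivZid.
  - move=> t /andP[t1 t2]; have /andP[a0 _] := time_in n; have /andP[_ bs] := time_in n.+1.
    by have [] := bnd t; rewrite // (le_trans a0)// (le_lt_trans t2).
have [p up] := Wc uc.
have pu n := geometric_cvg_dist n uc up.
have pr : `|p - w0| < r.
  have rr : 0 < (r - r1) / 2 by lra.
  have [n ne] := geometric_lt (2 * (B * s)) rr.
  have [un _] := bnd _ (time_in n).
  rewrite -(subrKA (u n)) (le_lt_trans (ler_normD _ _))//.
  by have := pu n; rewrite -/(u n) in un; lra.
have [d [tau [d0 tau0 Hloc]]] := local_existence pr.
(* The restart time must satisfy two conditions: [u n] is within [d] of [p], and less than [tau]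
   remains until [s]. *)
have [n [nd ntau]] : exists n, 2 * (B * s) * 2^-1 ^+ n < d /\ s * 2^-1 ^+ n < tau.
  have [n1 h1] := geometric_lt (2 * (B * s)) d0; have [n2 h2] := geometric_lt s tau0.
  exists (n1 + n2)%N; rewrite exprD; split.
    apply: le_lt_trans h1; rewrite ler_wpM2l ?mulr_ge0 ?(ltW s0)//.
    by rewrite ler_piMr.
  apply: le_lt_trans h2; rewrite ler_wpM2l ?(ltW s0)//.
  by rewrite ler_piMl.
have [|y [y0 Hy]] := Hloc (u n); first by rewrite distrC (le_lt_trans (pu n)).
have /andP[t0 ts] := time_in n; set t := time n in t0 ts *.
pose w' v := if v <= t then w v else y (v - t).
have stau : s < t + tau by rewrite /t /time; lra.
exists (t + tau), w'; split=> //; first split.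
- by move=> v v0; rewrite /w' ifT ?Sw.1// (le_trans v0).
- move=> v v0; rewrite lte_fin => vt; have [ltvt|ltvt|->] := ltgtP v t.
  + apply: (@has_deriv_near _ _ w _ _ _ (t - v)); rewrite ?subr_gt0//.
      move=> q; rewrite ltr_norml => /andP[_ qv]; rewrite /w' ifT//; lra.
    rewrite /w' ltW//; apply: Sw.2 => //; rewrite lte_fin; lra.
  + apply: (@has_deriv_near _ _ (fun v => y (v - t)) _ _ _ (v - t)); rewrite ?subr_gt0//.
      move=> q; rewrite ltr_norml => /andP[qv _]; rewrite /w' ifF//.
      by apply/negbTE; rewrite -ltNge; lra.
    rewrite /w' leNgt ltvt/=; apply: has_deriv_shift.
    have [] // := Hy (v - t); rewrite gtr0_norm ?subr_gt0//; lra.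
  + rewrite /w' lexx; apply: has_deriv_glue; first by rewrite subrr y0.
      by apply: Sw.2 => //; rewrite lte_fin.
    apply: has_deriv_shift; rewrite subrr -/(u n) -y0.
    by have [] // := Hy 0; rewrite normr0.
- move=> v v0; rewrite lte_fin => vt; rewrite /w'; case: (leP v t) => ltvt.
    by apply: stw => //; rewrite lte_fin; lra.
  by have [] // := Hy (v - t); rewrite gtr0_norm ?subr_gt0//; lra.
Qed.

Lemma solves_local : exists2 s : R, 0 < s & exists w, solves s%:E w /\ stays s%:E w.
Proof.
have [|d [tau [d0 tau0 /(_ w0)]]] := @local_existence w0; first by rewrite subrr normr0.
rewrite subrr normr0 => /(_ d0)[y [y0 Hy]].
exists tau => //; exists (fun v => if v <= 0 then w0 + v *: Psi w0 else y v); split.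
  split=> [v ->//|v v0]; rewrite lte_fin => vt.
  move: v0; rewrite le_eqVlt => /predU1P[<-|v0].
    rewrite lexx scale0r addr0; apply: has_deriv_glue; first by rewrite scale0r addr0.
      rewrite -[Psi w0]add0r.
      by apply: has_derivD; [exact: has_deriv_cst|rewrite add0r; exact: has_derivZid].
    by have [] // := Hy 0; rewrite ?normr0// y0.
  rewrite leNgt v0 /=; apply: (@has_deriv_near _ _ y _ _ _ v) => //.
    move=> q; rewrite ltr_norml => /andP[qv _]; rewrite ifF//; apply/negbTE; rewrite -ltNge; lra.
  by have [] // := Hy v; rewrite gtr0_norm.
move=> v v0; rewrite lte_fin => vt; case: (leP v 0) => [v0'|v0'].
  have -> : v = 0 by lra.
  by rewrite scale0r addr0 subrr normr0.
by have [] // := Hy v; rewrite gtr0_norm.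
Qed.

(** A finite supremum of the existence times would be attained by [solves_union] and then exceeded
    by [solves_extend]. The estimate is demanded only of solutions already known to stay within
    [r]. *)
Lemma global_existence (r1 B : R) : r1 < r ->
  (forall (T : R) w, solves T%:E w -> stays T%:E w ->
    forall t, 0 <= t < T -> `|w t - w0| <= r1 /\ `|Psi (w t)| <= B) ->
  exists w, solves +oo%E w /\ stays +oo%E w.
Proof.
move=> r1r bnd.
pose P := [set T%:E | T in [set T : R | exists w, solves T%:E w /\ stays T%:E w]].
pose S := ereal_sup P.
have [s s0 [ws [Sws stws]]] := solves_local.
have S0 : (0 < S)%E.
  apply: lt_le_trans (_ : (s%:E <= S)%E); rewrite ?lte_fin//.
  by apply: ereal_sup_ubound; exists s => //; exists ws.
have [|w [Sw stw]] := @solves_union S S0.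
  move=> T TS; have [_ [T' [w [Sw stw] <-] TT']] := ereal_sup_gt TS.
  by exists w; split; [apply: solvesW Sw|apply: staysW stw]; exact: ltW.
case E : S S0 Sw stw => [s'| |] // S0' Sw stw; last by exists w.
have bnd' := bnd _ _ Sw stw.
have [s'' [w' [ss Sw' stw']]] := solves_extend S0' r1r Sw stw bnd'.
suff : (s''%:E <= s'%:E)%E by rewrite lee_fin leNgt ss.
by rewrite -E; apply: ereal_sup_ubound; exists s'' => //; exists w'.
Qed.

Lemma solves_flow_on w : solves +oo%E w -> flow_on (fun x => - Psi x) w0 +oo%E w.
Proof.
move=> Sw; split; [exact: ltry|exact: solves0 Sw| |].
  rewrite opprK; apply/cvgrPdist_le => e e0.
  have [h h0 H] := Sw.2 _ (lexx 0) (ltry _) _ e0.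
  near=> t; have t0 : 0 < t by near: t; exact: nbhs_right_gt.
  have th : `|t| < h by rewrite gtr0_norm//; near: t; exact: nbhs_right_lt.
  have := H _ th; rewrite add0r => H1.
  have -> : Psi (w 0) - t^-1 *: (w t - w 0) = - (t^-1 *: (w t - w 0 - t *: Psi (w 0))).
    by rewrite (scalerBr _ _ (t *: _)) scalerA mulVf ?gt_eqF// scale1r opprB.
  by rewrite normrN normrZ normfV mulrC ler_pdivrMr ?normr_gt0 ?gt_eqF.
by move=> t t0 tT; rewrite opprK; apply/has_derivP; exact: Sw.2 (ltW t0) tT.
Unshelve. all: by end_near. Qed.

(** A competing flow is arbitrary at negative times; its past is replaced by the tangent line, which
    matches its right derivative at 0. *)
Lemma flow_on_solves T z : flow_on (fun x => - Psi x) w0 T z ->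
  solves T (fun t => if t <= 0 then w0 + t *: Psi w0 else z t).
Proof.
move=> [T0 z0 D0 D]; split=> [s ->//|t t0 tT].
move: t0; rewrite le_eqVlt => /predU1P[<-|t0].
  rewrite lexx scale0r addr0 => e e0; move: D0; rewrite opprK z0.
  move=> /cvgrPdist_le/(_ _ e0); rewrite near_withinE => /nbhs_ballP[h h0 H].
  exists h => // s sh; rewrite add0r lexx scale0r addr0; case: (leP s 0) => s0.
    by rewrite (addrC w0) addrK subrr normr0 mulr_ge0// ltW.
  have := H s; rewrite /ball /= sub0r normrN => /(_ sh s0) H1.
  have -> : z s - w0 - s *: Psi w0 = - (s *: (Psi w0 - s^-1 *: (z s - w0))).
    by rewrite scalerBr scalerA divff ?gt_eqF// scale1r opprB.
  by rewrite normrN normrZ mulrC ler_wpM2r.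
rewrite leNgt t0 /=; apply: (@has_deriv_near _ _ z _ _ _ t) => //.
  move=> s; rewrite ltr_norml => /andP[st _]; rewrite ifF//.
  by apply/negbTE; rewrite -ltNge; lra.
by have := D t t0 tT; rewrite opprK => /has_derivP.
Qed.

Lemma solves_maximal w : solves +oo%E w -> stays +oo%E w ->
  maximal_flow (fun x => - Psi x) w0 +oo%E w.
Proof.
move=> Sw stw; split; first exact: solves_flow_on.
move=> T z Fz; split; first exact: leey.
move=> t t0 tT; have Sz := flow_on_solves Fz.
have := uniqueness (solvesW (leey T) Sw) (staysW (leey T) stw) Sz tT.
move=> ->; case: (leP t 0) => // t0'.
have -> : t = 0 by apply: le_anti; rewrite t0 t0'.
by case: Fz => _ -> _ _; rewrite scale0r addr0.
Qed.
End Flow.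

(** * Completeness of the parameter spaces *)

Lemma geometric_bound_cvg (R : realType) (W : normedModType R) (u : nat -> W) (l : W) (c : R) :
  (forall n, `|l - u n| <= c * 2^-1 ^+ n) -> u @ \oo --> l.
Proof.
move=> h; have c0 : 0 <= c by have := h 0; rewrite expr0 mulr1; exact: le_trans.
apply/cvgrPdist_lt => e e0; have [n ne] := geometric_lt c e0.
exists n => // m /= nm; apply: le_lt_trans (h m) _; apply: le_lt_trans ne.
by rewrite ler_wpM2l// ler_wiXn2l ?invr_ge0//; lra.
Qed.

(** Limits are taken component by component and reassembled by [mk]. It serves both widths: real
    components of weight [1 / M], or components in [L2] of weight 1. *)
Lemma complete_of_components (R : realType) (W : innerType R) (V : normedModType R)
    (I : finType) (p : I -> W -> V) (mk : (I -> V) -> W) (c : R) :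
  geometric_complete V -> 0 < c ->
  (forall i w w', p i (w - w') = p i w - p i w') ->
  (forall f i, p i (mk f) = f i) ->
  (forall w, `|w| ^+ 2 = c * \sum_i `|p i w| ^+ 2) ->
  geometric_complete W.
Proof.
move=> Vc c0 pB pK pn u b h.
have b0 : 0 <= b by have := h 0; rewrite expr0 mulr1; exact: le_trans.
have ple i w : `|p i w| <= Num.sqrt c^-1 * `|w|.
  rewrite -(ler_pXn2r (_ : 0 < 2)%N) ?nnegrE ?mulr_ge0 ?sqrtr_ge0// exprMn.
  rewrite sqr_sqrtr ?invr_ge0 ?(ltW c0)// mulrC ler_pdivlMr// pn mulrC ler_wpM2l ?(ltW c0)//.
  by rewrite (bigD1 i)//= lerDl sumr_ge0// => j _; rewrite exprn_ge0.
set C := Num.sqrt c^-1 in ple.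
have C0 : 0 <= C by rewrite sqrtr_ge0.
have hi i n : `|p i (u n.+1) - p i (u n)| <= C * b * 2^-1 ^+ n.
  by rewrite -pB (le_trans (ple _ _))// -mulrA ler_wpM2l.
have [l ul] := choice (fun i => Vc _ _ (hi i)).
exists (mk l).
apply: (@geometric_bound_cvg _ _ _ _ (Num.sqrt (c * #|I|%:R) * (2 * (C * b)))) => n.
rewrite -(ler_pXn2r (_ : 0 < 2)%N) ?nnegrE ?mulr_ge0 ?sqrtr_ge0 ?exprn_ge0 ?invr_ge0//.
rewrite -mulrA exprMn sqr_sqrtr; last by rewrite mulr_ge0// ltW.
rewrite pn -mulrA ler_wpM2l ?(ltW c0)//.
apply: le_trans (_ : \sum_(i : I) (2 * (C * b) * 2^-1 ^+ n) ^+ 2 <= _); last first.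
  by rewrite sumr_const [leRHS]mulr_natl.
apply: ler_sum => i _; rewrite lerXn2r ?nnegrE ?mulr_ge0 ?exprn_ge0 ?invr_ge0//.
by rewrite pB pK; exact: geometric_cvg_dist (hi i) (ul i).
Qed.

Lemma finite_param_complete (R : realType) (d M : nat) :
  geometric_complete (finite_param R d M).
Proof.
(* For [M = 0] the inverse is 0, but a positive weight is required; any value does, as the sums are
   empty. *)
pose c : R := if M is 0 then 1 else M%:R^-1.
pose p (k : 'I_M + 'I_M * 'I_d) (w : finite_param R d M) : R :=
  match k with inl i => w.1 0 i | inr ij => w.2 ij.1 ij.2 end.
pose mk (f : 'I_M + 'I_M * 'I_d -> R) : finite_param R d M :=
  (\row_i f (inl i), \matrix_(i, j) f (inr (i, j))).
apply: (@complete_of_components _ _ _ _ p mk c).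
- exact: real_geometric_complete.
- by rewrite /c; case: (M) => // n; rewrite invr_gt0.
- by move=> [i|[i j]] w w'; rewrite /p /= !mxE.
- by move=> f [i|[i j]]; rewrite /p /= mxE.
- move=> w; rewrite sqr_norm_inner; change (inner w w) with (finite_dot w w).
  rewrite /finite_dot big_split /= big_sumType /=.
  rewrite -(pair_bigA _ (fun i j => `|w.2 i j| ^+ 2)) /=.
  have E (x : R) : `|x| ^+ 2 = x * x by rewrite real_normK ?num_real// expr2.
  under [in RHS]eq_bigr do rewrite E.
  under [X in _ = _ * (_ + X)]eq_bigr do under eq_bigr do rewrite E.
  by rewrite /c; case: (M) w => // w; rewrite !big_ord0 addr0 !mulr0.
Qed.

Section L2complete.
Context d (T : measurableType d) (R : realType).
Variable mu : {measure set T -> \bar R}.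
Implicit Types (f g : L2 mu).

Lemma L2_sqr_norm f (h : T -> R) : measurable_fun setT h -> h = f %[ae mu] ->
  (\int[mu]_t ((h t) ^+ 2)%:E = (`|f| ^+ 2)%:E)%E.
Proof.
move=> mh hf; rewrite sqr_norm_inner.
rewrite -[inner f f]/(\int[mu]_t (f t * f t)) /Rintegral fineK; last first.
  exact: integrable_fin_num (L2_mul_integrable f f).
apply: ae_eq_integral => //.
- by apply/measurable_EFinP; exact: measurable_funX.
- by apply/measurable_EFinP; apply: measurable_funM; exact: L2_measurable.
- by apply: filterS hf => t /(_ I) /= -> _; rewrite expr2.
Qed.

Lemma L2_sub_ae f g : (fun t => f t - g t) = (f - g : L2 mu) %[ae mu].
Proof.
have E := L2_add_ae f (-1 *: g); have E' := L2_scaleE (-1) g.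
rewrite scaleN1r in E; apply: filterS2 E E' => t /(_ I) -> /(_ I) Eg _.
by rewrite -scaleN1r Eg mulN1r.
Qed.

Lemma L2_sqr_dist f g :
  (\int[mu]_t ((f t - g t) ^+ 2)%:E = (`|f - g| ^+ 2)%:E)%E.
Proof.
apply: (L2_sqr_norm _ (L2_sub_ae f g)).
by apply: measurable_funB; exact: L2_measurable.
Qed.

Lemma Lfun2_of_sqr (h : T -> R) : measurable_fun setT h ->
  (\int[mu]_t ((h t) ^+ 2)%:E < +oo)%E -> h \in Lfun mu 2%:E.
Proof.
move=> mh ih; rewrite inE; apply/andP; split; rewrite inE//=.
rewrite /finite_norm unlock poweR_lty// (le_lt_trans _ ih)//.
rewrite le_eqVlt; apply/orP; left; apply/eqP; apply: eq_integral => t _.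
by rewrite /= powR_mulrn// real_normK ?num_real.
Qed.

(** Weighting the squared increments by [4^n] leaves integrals of order [4^-n], so the weighted
    series has a finite sum [s] almost everywhere. At such points the increments are at most
    [sqrt s * 2^-n]. *)
Lemma L2_ae_cvg (v : nat -> L2 mu) (c : R) :
  (forall n, `|v n.+1 - v n| ^+ 2 <= c * 16^-1 ^+ n) ->
  {ae mu, forall t, exists l : R, (fun n => v n t) @ \oo --> l}.
Proof.
move=> h; have c0 : 0 <= c.
  by have := h 0; rewrite expr0 mulr1; apply: le_trans; rewrite exprn_ge0.
pose g n t := (4 ^+ n * (v n.+1 t - v n t) ^+ 2)%:E.
have mg n : measurable_fun setT (g n).
  apply/measurable_EFinP; apply: measurable_funM => //; apply: measurable_funX.
  by apply: measurable_funB; exact: L2_measurable.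
have g0 n t : (0 <= g n t)%E by rewrite lee_fin mulr_ge0 ?sqr_ge0// exprn_ge0.
have ig n : (\int[mu]_t g n t <= (2 * c / (2 ^ (n + 1))%:R)%:E)%E.
  rewrite /g; under eq_integral do rewrite EFinM.
  rewrite ge0_integralZl_EFin; last 4 first.
  - exact: measurableT.
  - by move=> t _; rewrite lee_fin sqr_ge0.
  - apply/measurable_EFinP; apply: measurable_funX.
    by apply: measurable_funB; exact: L2_measurable.
  - by rewrite exprn_ge0.
  rewrite L2_sqr_dist -EFinM lee_fin.
  apply: le_trans (ler_wpM2l _ (h n)) _; first by rewrite exprn_ge0.
  rewrite mulrCA -exprMn addn1 expnS natrM -mulf_div divff// mul1r ler_wpM2l//.
  by rewrite natrX -exprVn lerXn2r ?nnegrE; lra.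
have ifin : (\int[mu]_t (\sum_(n <oo) g n t) < +oo)%E.
  rewrite integral_nneseries//.
  apply: le_lt_trans (_ : (\sum_(n <oo) (2 * c / (2 ^ (n + 1))%:R)%:E < +oo)%E).
    by apply: lee_nneseries => // n _; rewrite integral_ge0.
  have := @cvg_geometric_eseries_half R (2 * c) 0.
  by rewrite expr0 divr1 => /cvg_lim -> //; exact: ltry.
have intg : mu.-integrable setT (fun t => (\sum_(n <oo) g n t)%E).
  apply/integrableP; split; first exact: ge0_emeasurable_sum.
  rewrite (le_lt_trans _ ifin)// le_eqVlt; apply/orP; left; apply/eqP.
  by apply: eq_integral => t _; rewrite gee0_abs// nneseries_ge0.
have := integrable_ae measurableT intg; apply: filterS => t /(_ I) fin.
pose s := fine (\sum_(n <oo) g n t).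
have s0 : 0 <= s by rewrite fine_ge0// nneseries_ge0.
apply: (@real_geometric_complete _ _ (Num.sqrt s)) => n.
rewrite -(ler_pXn2r (_ : 0 < 2)%N) ?nnegrE ?mulr_ge0 ?sqrtr_ge0 ?exprn_ge0 ?invr_ge0//.
rewrite exprMn sqr_sqrtr// real_normK ?num_real//.
have : (g n t <= s%:E)%E.
  rewrite /s fineK//; apply: le_trans (nneseries_lim_ge n.+1 _) => //.
  by rewrite big_nat_recr//= leeDr// sume_ge0.
rewrite lee_fin mulrC -ler_pdivlMr ?exprn_gt0// => /le_trans; apply.
by rewrite ler_wpM2l// -exprVn exprAC lerXn2r ?nnegrE; lra.
Qed.

(** Along the even indices the squared increments decay like [16^-n], as [L2_ae_cvg] asks. The
    almost everywhere limit is then shown by Fatou to be the limit in norm of the full sequence. *)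
Lemma L2_complete_seq (u : nat -> L2 mu) (c : R) :
  (forall n, `|u n.+1 - u n| <= c * 2^-1 ^+ n) -> exists l : L2 mu, u @ \oo --> l.
Proof.
move=> h.
have c0 : 0 <= c by have := h 0; rewrite expr0 mulr1; exact: le_trans.
pose v n : L2 mu := u n.*2.
have uk n k : (n <= k)%N -> `|u k - u n| ^+ 2 <= (2 * c * 2^-1 ^+ n) ^+ 2.
  move=> nk; rewrite lerXn2r ?nnegrE ?mulr_ge0 ?exprn_ge0 ?invr_ge0//.
  by rewrite -(subnKC nk); exact: geometric_dist.
have [] := @L2_ae_cvg v (4 * c ^+ 2).
  move=> n; apply: le_trans (uk _ _ _) _; first by rewrite leq_double.
  have -> (q : R) : (2 * c * q) ^+ 2 = 4 * c ^+ 2 * q ^+ 2 by ring.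
  suff -> : (2^-1 ^+ n.*2) ^+ 2 = 16^-1 ^+ n :> R by [].
  rewrite -exprM -muln2 -mulnA mulnC exprM; congr (_ ^+ _); by field.
move=> A [mA A0 hA].
(* The upper limit exists everywhere and is measurable; it equals the limit wherever the sequence
   converges. *)
pose w t : \bar R := limn_esup (fun n => (v n t)%:E).
pose f t : R := fine (w t).
have mf : measurable_fun setT f.
  apply: measurableT_comp; first exact: fine_measurable.
  by apply: measurable_fun_limn_esup => n; apply/measurable_EFinP; exact: L2_measurable.
have vf : {ae mu, forall t, (fun n => v n t) @ \oo --> f t}.
  exists A; split=> // t /= nt; apply: hA => /= -[l vl]; apply: nt.
  suff -> : f t = l by [].
  have vl' : (fun n => (v n t)%:E) @ \oo --> l%:E by apply: cvg_EFin => //; exact: nearW.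
  rewrite /f /w is_cvg_limn_esupE; last by apply/cvg_ex; exists l%:E.
  by rewrite (cvg_lim _ vl').
(* In Fatou's lemma the index is shifted: [v (m + n)] is [u] at an index at least [n], so [uk]
   bounds its distance to [u n] uniformly in [m]. *)
have dist n : (\int[mu]_t ((f t - u n t) ^+ 2)%:E <= ((2 * c * 2^-1 ^+ n) ^+ 2)%:E)%E.
  pose g m t := ((v (m + n)%N t - u n t) ^+ 2)%:E.
  have mg m : measurable_fun setT (g m).
    apply/measurable_EFinP; apply: measurable_funX.
    by apply: measurable_funB; exact: L2_measurable.
  have g0 m t : (0 <= g m t)%E by rewrite lee_fin sqr_ge0.
  have -> : (\int[mu]_t ((f t - u n t) ^+ 2)%:E = \int[mu]_t limn_einf (g ^~ t))%E.
    apply: ge0_ae_eq_integral => //.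
    - apply/measurable_EFinP; apply: measurable_funX.
      by apply: measurable_funB => //; exact: L2_measurable.
    - rewrite /limn_einf; apply: measurableT_comp => //.
      apply: measurable_fun_limn_esup => m; exact: measurableT_comp.
    - by move=> t _; rewrite lee_fin sqr_ge0.
    - move=> t _; rewrite limn_einf_lim; apply: lime_ge; first exact: is_cvg_einfs.
      by apply: nearW => m; apply: le_ereal_inf_tmp => _ [k _ <-].
    apply: filterS vf => t vt _.
    have gl : g ^~ t @ \oo --> ((f t - u n t) ^+ 2)%:E.
      apply: cvg_EFin; first exact: nearW.
      have vt' : (fun m => v (m + n)%N t) @ \oo --> f t by rewrite (cvg_shiftn n (fun m => v m t)).
      have sq : (fun m => (v (m + n)%N t - u n t) * (v (m + n)%N t - u n t)) @ \oo -->
          (f t - u n t) * (f t - u n t).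
        by apply: cvgM; apply: cvgB => //; exact: cvg_cst.
      exact: sq.
    by rewrite is_cvg_limn_einfE ?(cvg_lim _ gl)//; apply/cvg_ex; eexists; exact: gl.
  apply: le_trans (fatou _ _ _ _) _ => //.
  rewrite limn_einf_lim; apply: lime_le; first exact: is_cvg_einfs.
  apply: nearW => m; rewrite /einfs.
  apply: le_trans (_ : \int[mu]_t g m t <= _)%E.
    by apply: ereal_inf_lbound; exists m => //=.
  rewrite /g L2_sqr_dist lee_fin; apply: uk.
  by rewrite -addnn (leq_trans (leq_addl m n))// leq_addr.
have Lf : f \in Lfun mu 2%:E.
  have -> : f = (fun t => f t - u 0 t) \+ u 0.
    by apply/funext => t /=; rewrite subrK.
  have [_ Ladd] := @Lfun_addr_closed _ _ _ mu 2%:E (lee1n 2).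
  apply: Ladd; last by rewrite /L2_fun; exact: LfunP.
  apply: Lfun2_of_sqr; first by apply: measurable_funB => //; exact: L2_measurable.
  by apply: le_lt_trans (dist 0) _; exact: ltry.
pose l : L2 mu := \pi_(L2 mu)%qT (Lfun_Sub (lee1n 2) Lf).
exists l; apply: (@geometric_bound_cvg _ _ _ _ (2 * c)) => n.
rewrite -(ler_pXn2r (_ : 0 < 2)%N) ?nnegrE ?mulr_ge0 ?exprn_ge0 ?invr_ge0//.
rewrite -lee_fin (le_trans _ (dist n))//.
have mfu : measurable_fun setT (fun t => f t - u n t).
  by apply: measurable_funB => //; exact: L2_measurable.
rewrite (L2_sqr_norm (f := l - u n) mfu)//.
have lf : (l : T -> R) = f %[ae mu] := L2_funE _.
apply: filterS2 lf (L2_sub_ae l (u n)) => t /(_ I) lft /(_ I) <- _.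
by rewrite lft.
Qed.
Lemma L2_complete : geometric_complete (L2 mu).
Proof. exact: L2_complete_seq. Qed.

End L2complete.

Lemma L2_param_complete (R : realType) (d : nat)
    (nu : {measure set (borelRd R d) -> \bar R}) :
  geometric_complete (L2_param nu).
Proof.
pose p (k : 'I_1 + 'I_d) (w : L2_param nu) : L2 nu :=
  if k is inr j then w.2 j else w.1.
pose mk (f : 'I_1 + 'I_d -> L2 nu) : L2_param nu :=
  (f (inl 0), [ffun j => f (inr j)]).
apply: (@complete_of_components _ _ _ _ p mk 1) => //.
- exact: L2_complete.
- by move=> [j|j] w w'; rewrite /p //= !ffunE.
- by move=> f [j|j]; rewrite /p /= ?ffunE ?ord1.
- move=> w; rewrite mul1r sqr_norm_inner; change (inner w w) with (L2_param_dot w w).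
  rewrite /L2_param_dot big_sumType big_ord1 /= sqr_norm_inner; congr (_ + _).
  by apply: eq_bigr => j _; rewrite sqr_norm_inner.
Qed.

Lemma param_space_complete (R : realType) (d : nat) (net : network R d) :
  geometric_complete (param_space net).
Proof.
by case: net => [M|nu]; [exact: finite_param_complete|exact: L2_param_complete].
Qed.

(** * Quadratic forms on the output space *)

Section Odot.
Context (R : realType) (N : nat) (kappa : R).
Implicit Types (a b c : 'rV[R]_N) (t : R).
Local Notation dot := (odot kappa).
Local Notation norm := (onorm kappa).

Lemma odotC a b : dot a b = dot b a.
Proof. by rewrite /odot; congr (_ * _); apply: eq_bigr => n _; rewrite mulrC. Qed.

Lemma odotDl a b c : dot (a + b) c = dot a c + dot b c.
Proof.
rewrite /odot -mulrDr -big_split; congr (_ * _); apply: eq_bigr => n _.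
by rewrite mxE mulrDl.
Qed.

Lemma odotZl t a b : dot (t *: a) b = t * dot a b.
Proof.
rewrite /odot [RHS]mulrCA; congr (_ * _); rewrite mulr_sumr; apply: eq_bigr => n _.
by rewrite mxE mulrA.
Qed.

Lemma odotDr a b c : dot a (b + c) = dot a b + dot a c.
Proof. by rewrite odotC odotDl !(odotC a). Qed.

Lemma odotZr t a b : dot a (t *: b) = t * dot a b.
Proof. by rewrite odotC odotZl odotC. Qed.

Lemma odotNl a b : dot (- a) b = - dot a b.
Proof. by rewrite -scaleN1r odotZl mulN1r. Qed.

Lemma odotNr a b : dot a (- b) = - dot a b.
Proof. by rewrite odotC odotNl odotC. Qed.

Lemma odotBl a b c : dot (a - b) c = dot a c - dot b c.
Proof. by rewrite odotDl odotNl. Qed.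

Lemma odotBr a b c : dot a (b - c) = dot a b - dot a c.
Proof. by rewrite odotDr odotNr. Qed.

Lemma odot0l a : dot 0 a = 0.
Proof. by rewrite -(scale0r a) odotZl mul0r. Qed.

Lemma odot_mulmx (S : 'M[R]_N) a b : S^T = S -> dot (a *m S) b = dot a (b *m S).
Proof.
move=> ST; have E (u v : 'rV[R]_N) : dot u v = kappa * (u *m v^T) 0 0.
  by rewrite /odot mxE; congr (_ * _); apply: eq_bigr => n _; rewrite mxE.
by rewrite !E trmx_mul ST mulmxA.
Qed.

Hypothesis kappa_gt0 : 0 < kappa.

Lemma odot_ge0 a : 0 <= dot a a.
Proof.
by rewrite /odot mulr_ge0 ?(ltW kappa_gt0)// sumr_ge0// => n _; rewrite -expr2 sqr_ge0.
Qed.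

Lemma onorm_ge0 a : 0 <= norm a.
Proof. exact: sqrtr_ge0. Qed.

Lemma sqr_onorm a : norm a ^+ 2 = dot a a.
Proof. by rewrite sqr_sqrtr ?odot_ge0. Qed.

Lemma onorm_le a t : 0 <= t -> (norm a <= t) = (dot a a <= t ^+ 2).
Proof. by move=> t0; rewrite -sqr_onorm ler_pXn2r// nnegrE ?onorm_ge0. Qed.

Lemma ler_odot_onorm a b : `|dot a b| <= norm a * norm b.
Proof.
rewrite -(ler_pXn2r (_ : 0 < 2)%N) ?nnegrE ?mulr_ge0 ?onorm_ge0// exprMn !sqr_onorm.
rewrite real_normK ?num_real//; apply: (psd_cauchy_schwarz odotC odotDl odotZl).
exact: odot_ge0.
Qed.

Lemma odot_le_onorm a b : dot a b <= norm a * norm b.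
Proof. exact: le_trans (ler_norm _) (ler_odot_onorm a b). Qed.

Lemma ler_onormD a b : norm (a + b) <= norm a + norm b.
Proof.
rewrite onorm_le ?addr_ge0 ?onorm_ge0// sqrrD !sqr_onorm odotDl !odotDr (odotC b a).
by have := odot_le_onorm a b; lra.
Qed.

Lemma onormZ t a : norm (t *: a) = `|t| * norm a.
Proof. by rewrite /onorm odotZl odotZr mulrA -expr2 sqrtrM ?sqr_ge0// sqrtr_sqr. Qed.

Lemma onormN a : norm (- a) = norm a.
Proof. by rewrite -scaleN1r onormZ normrN1 mul1r. Qed.

Lemma onormB a b : norm (a - b) = norm (b - a).
Proof. by rewrite -onormN opprB. Qed.

Lemma onorm_eq0 a : norm a = 0 -> a = 0.
Proof.
move=> a0; have := sqr_onorm a; rewrite a0 expr0n /odot => /esym/eqP.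
rewrite mulf_eq0 gt_eqF//= psumr_eq0; last by move=> n _; rewrite -expr2 sqr_ge0.
move=> /allP H; apply/rowP => n; rewrite mxE; apply/eqP.
by have := H n (mem_index_enum _); rewrite mulf_eq0 orbb.
Qed.

Lemma onorm_le_dot a t : 0 <= t -> (forall b, dot a b <= t * norm b) -> norm a <= t.
Proof.
move=> t0 h; have := h a; rewrite -sqr_onorm expr2.
have := onorm_ge0 a; rewrite le_eqVlt => /predU1P[<- //|a0].
by rewrite ler_pM2r.
Qed.

Lemma coord_le_norm a n : `|a 0 n| <= `|a|.
Proof.
by rewrite [leRHS]/Num.norm /= mx_normrE; apply/bigmax_geP; right => /=; exists (0, n).
Qed.

Lemma norm_le_coord a t : 0 <= t -> (forall n, `|a 0 n| <= t) -> `|a| <= t.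
Proof.
move=> t0 h; rewrite [leLHS]/Num.norm /= mx_normrE; apply/bigmax_leP; split=> // -[i j] _.
by rewrite /= ord1.
Qed.

Lemma onorm_le_norm a : norm a <= Num.sqrt (kappa * N%:R) * `|a|.
Proof.
rewrite onorm_le ?mulr_ge0 ?sqrtr_ge0// exprMn sqr_sqrtr; last first.
  by rewrite mulr_ge0// ltW.
rewrite /odot -mulrA ler_wpM2l ?(ltW kappa_gt0)//.
apply: le_trans (_ : \sum_(n < N) `|a| ^+ 2 <= _); last first.
  by rewrite sumr_const card_ord [leRHS]mulr_natl.
apply: ler_sum => n _; rewrite -expr2 -real_normK ?num_real//.
by rewrite lerXn2r ?nnegrE// coord_le_norm.
Qed.

Lemma norm_le_onorm a : `|a| <= (Num.sqrt kappa)^-1 * norm a.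
Proof.
have sk : 0 < Num.sqrt kappa by rewrite sqrtr_gt0.
apply: norm_le_coord => [|n]; first by rewrite mulr_ge0 ?onorm_ge0 ?invr_ge0 ?sqrtr_ge0.
rewrite mulrC ler_pdivlMr// -(ler_pXn2r (_ : 0 < 2)%N) ?nnegrE ?mulr_ge0 ?onorm_ge0 ?sqrtr_ge0//.
rewrite exprMn sqr_onorm sqr_sqrtr ?(ltW kappa_gt0)// real_normK ?num_real// mulrC.
rewrite /odot ler_wpM2l ?(ltW kappa_gt0)// (bigD1 n)//= -expr2 lerDl.
by rewrite sumr_ge0// => j _; rewrite -expr2 sqr_ge0.
Qed.

End Odot.

Lemma continuous_sum (R : realType) (T : topologicalType) (I : finType) (f : I -> T -> R) :
  (forall i, continuous (f i)) -> continuous (fun x => \sum_i f i x).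
Proof.
move=> cf x; apply: (@cvg_big R I +%R 0 xpredT (@add_continuous R)) => // i _.
exact: cf.
Qed.

Section Rayleigh.
Context (R : realType) (N : nat).
Variable S : 'M[R]_N.
Hypotheses (N_gt0 : (0 < N)%N) (S_sym : S^T = S).
Local Notation dot := (odot (1 : R)).

Lemma continuous_coord_mul (f : 'rV[R]_N -> 'rV[R]_N) :
  (forall n, continuous (fun y => f y 0 n)) -> continuous (fun y => dot y (f y)).
Proof.
move=> cf y; rewrite /odot.
under eq_fun do rewrite mul1r.
apply: continuous_sum => n {}y.
apply: (@continuousM R 'rV[R]_N (fun y => y 0 n) (fun y => f y 0 n)).
  exact: coord_continuous.
exact: cf.
Qed.

(** A minimiser of the quadratic form on the unit sphere. It gives at once an eigenvector and the
    lower bound for the form, hence the identification of [min_eigenvalue] with the minimal Rayleigh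
    quotient. *)
Lemma rayleigh_min : exists (y : 'rV[R]_N) (l : R), [/\ y != 0, y *m S = l *: y &
  forall z, l * dot z z <= dot z (z *m S)].
Proof.
pose q (z : 'rV[R]_N) := dot z (z *m S).
have cq : continuous q.
  apply: continuous_coord_mul => n y.
  under eq_fun do rewrite mxE.
  apply: (@continuous_sum R 'rV[R]_N) => m {}y.
  apply: (@continuousM R 'rV[R]_N (fun y => y 0 m) (fun=> S m n)).
    exact: coord_continuous.
  exact: cst_continuous.
have cd : continuous (fun z : 'rV[R]_N => dot z z).
  by apply: continuous_coord_mul => n; exact: coord_continuous.
(* The unit sphere, written as a closed subset of the compact box that contains it. *)
pose A := [set z : 'rV[R]_N | forall i, [set` `[(-1 : R), 1]] (z 0 i)] `&` [set z | dot z z = 1].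
have cA : compact A.
  apply: compact_closedI.
    apply: (@rV_compact R N (fun=> [set` `[(-1 : R), 1]])) => i.
    exact: segment_compact.
  apply: (@closed_comp _ _ (fun z : 'rV[R]_N => dot z z) [set 1]) => [z _|]; first exact: cd.
  exact: closed_eq.
have unit z : dot z z = 1 -> A z.
  move=> z1; split=> // i /=; rewrite in_itv /= -ler_norml.
  have := norm_le_onorm (ltr01 : 0 < (1 : R)) z.
  rewrite /onorm z1 sqrtr1 invr1 mulr1; apply: le_trans.
  exact: coord_le_norm.
have A0 : A !=set0.
  exists (delta_mx 0 (Ordinal N_gt0)); apply: unit.
  rewrite /odot mul1r (bigD1 (Ordinal N_gt0))//= big1 => [|i ni].
    by rewrite mxE !eqxx mulr1 addr0.
  by rewrite mxE (negbTE ni) mul0r.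
have [y /set_mem[_ /= yy] ymin] := EVT_min_rV A0 cA (continuous_subspaceT cq).
have hom z : q y * dot z z <= q z.
  have := odot_ge0 (ltr01 : 0 < (1 : R)) z; rewrite le_eqVlt => /predU1P[z0|z0].
    suff -> : z = 0 by rewrite /q !odot0l mulr0.
    by apply: (@onorm_eq0 _ _ _ (ltr01 : 0 < (1 : R))); rewrite /onorm -z0 sqrtr0.
  have s0 : 0 < Num.sqrt (dot z z) by rewrite sqrtr_gt0.
  have s2 : (Num.sqrt (dot z z))^-1 ^+ 2 = (dot z z)^-1.
    by rewrite exprVn sqr_sqrtr// ltW.
  have qZ c : q (c *: z) = c ^+ 2 * q z.
    by rewrite /q -scalemxAl odotZl odotZr expr2 mulrA.
  have dZ c : dot (c *: z) (c *: z) = c ^+ 2 * dot z z.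
    by rewrite odotZl odotZr expr2 mulrA.
  have := ymin ((Num.sqrt (dot z z))^-1 *: z).
  rewrite qZ s2 mulrC ler_pdivlMr//; apply; rewrite inE; apply: unit.
  by rewrite dZ s2 mulVf// gt_eqF.
exists y, (q y); split=> //.
  by apply/eqP => y0; move: yy; rewrite y0 odot0l => /eqP; rewrite eq_sym oner_eq0.
(* The form of [S - q y] is nonnegative by [hom] and vanishes at [y]; Cauchy-Schwarz puts [y] in its
   kernel, which is the eigenvalue equation. *)
pose B a b := dot a (b *m S - q y *: b).
have BC a b : B a b = B b a.
  by rewrite /B !odotBr !odotZr (odotC _ a b) -odot_mulmx// (odotC _ (a *m S)).
have BD a b c : B (a + b) c = B a c + B b c by rewrite /B odotDl.
have BZ t a b : B (t *: a) b = t * B a b by rewrite /B odotZl.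
have B0 a : 0 <= B a a by rewrite /B odotBr odotZr subr_ge0 hom.
have By a : B a y = 0.
  have := psd_cauchy_schwarz BC BD BZ B0 a y.
  have -> : B y y = 0 by rewrite {1}/B odotBr odotZr yy mulr1 subrr.
  by rewrite mulr0 => h; apply/eqP; rewrite -sqrf_eq0 eq_le h sqr_ge0.
apply/eqP; rewrite -subr_eq0; apply/eqP.
apply: (@onorm_eq0 _ _ _ (ltr01 : 0 < (1 : R))).
by rewrite /onorm -/(B _ y) By sqrtr0.
Qed.

Lemma min_eigenvalue_attained : eigenvalue S (min_eigenvalue S).
Proof.
have [y [l [y0 yS ymin]]] := rayleigh_min.
suff -> : min_eigenvalue S = l by apply/eigenvalueP; exists y.
have El : eigenvalue S l by apply/eigenvalueP; exists y.
have lb : lbound [set a | eigenvalue S a] l.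
  move=> a /eigenvalueP[z zS z0]; have := ymin z; rewrite zS odotZr.
  rewrite ler_pM2r// lt_neqAle odot_ge0// andbT eq_sym.
  apply: contra z0 => /eqP zz; apply/eqP.
  by apply: (@onorm_eq0 _ _ _ (ltr01 : 0 < (1 : R))); rewrite /onorm zz sqrtr0.
apply: le_anti; apply/andP; split.
  by apply: inf_lbound => //; exists l.
by apply: lb_le_inf => //; exists l.
Qed.

Lemma min_eigenvalue_le kappa z : 0 < kappa ->
  min_eigenvalue S * odot kappa z z <= odot kappa z (z *m S).
Proof.
move=> k0; have [y [l [y0 yS ymin]]] := rayleigh_min.
have E (u v : 'rV[R]_N) : odot kappa u v = kappa * dot u v by rewrite /odot mul1r.
rewrite !E mulrCA ler_wpM2l ?(ltW k0)//.
apply: le_trans (ymin z); rewrite ler_wpM2r ?odot_ge0//.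
apply: inf_lbound; last by apply/eigenvalueP; exists y.
exists l => a /eigenvalueP[x xS x0]; have := ymin x; rewrite xS odotZr.
rewrite ler_pM2r// lt_neqAle odot_ge0// andbT eq_sym.
apply: contra x0 => /eqP xx; apply/eqP.
by apply: (@onorm_eq0 _ _ _ (ltr01 : 0 < (1 : R))); rewrite /onorm xx sqrtr0.
Qed.

End Rayleigh.

(** * The damped Gauss-Newton system *)

Section Damped.
Context (R : realType) (N : nat) (kappa : R).
Hypothesis k_gt0 : 0 < kappa.
Local Notation dot := (odot kappa).
Local Notation norm := (onorm kappa).
Variables (A H : 'M[R]_N) (m muH LH alpha : R).
Hypotheses (m_gt0 : 0 < m) (muH_gt0 : 0 < muH) (LH_gt0 : 0 < LH) (alpha_ge0 : 0 <= alpha).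
Hypotheses (A_sym : A^T = A) (H_sym : H^T = H).
Hypothesis A_lb : forall y, m * dot y y <= dot y (y *m A).
Hypothesis H_lb : forall y, muH * dot y y <= dot y (y *m H).
Hypothesis H_ub : forall y, dot y (y *m H) <= LH * dot y y.
Let eps := alpha * m.

Let eps_ge0 : 0 <= eps. Proof. by rewrite mulr_ge0// ltW. Qed.

Lemma form_unitmx (S : 'M[R]_N) c : 0 < c ->
  (forall y, c * dot y y <= dot y (y *m S)) -> S \in unitmx.
Proof.
move=> c0 h; rewrite -row_free_unit -kermx_eq0; apply/rowV0P => y /sub_kermxP yS.
have := h y; rewrite yS (odotC _ y 0) odot0l pmulr_rle0// => y0.
by apply: (onorm_eq0 k_gt0); apply/eqP; rewrite sqrtr_eq0.
Qed.

Lemma norm_mulA_ge y : m * norm y <= norm (y *m A).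
Proof.
have := onorm_ge0 kappa y; rewrite le_eqVlt => /predU1P[<-|y0].
  by rewrite mulr0 onorm_ge0.
rewrite -(ler_pM2r y0) -mulrA -expr2 sqr_onorm// mulrC (mulrC (norm _)).
by rewrite mulrC (le_trans (A_lb y))// odot_le_onorm.
Qed.

(** Cauchy-Schwarz in the form of [H], applied to [y H] and [y]: with [X = |y H|^2] it gives
    [X^2 <= (LH X) (LH |y|^2)]. *)
Lemma norm_mulH_le y : norm (y *m H) <= LH * norm y.
Proof.
rewrite onorm_le ?mulr_ge0 ?onorm_ge0 ?(ltW LH_gt0)// exprMn sqr_onorm//.
have HH z : 0 <= dot z (z *m H).
  by apply: le_trans (H_lb z); rewrite mulr_ge0 ?odot_ge0// ltW.
have := @psd_cauchy_schwarz _ _ (fun a b => dot a (b *m H)) _ _ _ HH (y *m H) y.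
move=> /(_ _ _ _)/wrap[].
- by move=> a b; rewrite odotC odot_mulmx.
- by move=> a b c; rewrite odotDl.
- by move=> t a b; rewrite odotZl.
have := odot_ge0 k_gt0 (y *m H); set X := dot (y *m H) (y *m H).
rewrite le_eqVlt => /predU1P[<- _|X0 h].
  by rewrite mulr_ge0 ?sqr_ge0 ?odot_ge0.
rewrite -(ler_pM2l X0) -expr2; apply: le_trans h _.
have -> : X * (LH ^+ 2 * dot y y) = (LH * X) * (LH * dot y y) by ring.
by rewrite ler_pM// H_ub.
Qed.

(** Pairing the equation with [q A] leaves the term of [H] plus [eps * dot q (q A)], which is
    nonnegative. *)
Lemma damped_normA q g : q *m A *m H + eps *: q = g -> norm (q *m A) <= norm g / muH.
Proof.
move=> E; rewrite ler_pdivlMr//.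
have := onorm_ge0 kappa (q *m A); rewrite le_eqVlt => /predU1P[<-|p0].
  by rewrite mul0r onorm_ge0.
rewrite -(ler_pM2r p0); apply: le_trans (odot_le_onorm k_gt0 g (q *m A)).
rewrite -E odotDl odotZl -mulrA mulrCA -expr2 sqr_onorm//.
apply: le_trans (H_lb _) _; rewrite odotC lerDl mulr_ge0//.
by apply: le_trans (A_lb q); rewrite mulr_ge0 ?odot_ge0// ltW.
Qed.

Lemma damped_norm q g : q *m A *m H + eps *: q = g -> norm q <= norm g / (m * muH).
Proof.
move=> /damped_normA h; rewrite invfM mulrA mulrAC ler_pdivlMr// mulrC.
exact: le_trans (norm_mulA_ge q) h.
Qed.

Lemma damped_solution (g : 'rV[R]_N) (z := g *m invmx H *m invmx (A + eps *: invmx H)) :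
  z *m A *m H + eps *: z = g.
Proof.
have uH : H \in unitmx by exact: form_unitmx H_lb.
have uB : A + eps *: invmx H \in unitmx.
  apply: (form_unitmx m_gt0) => y; apply: le_trans (A_lb y) _.
  rewrite mulmxDr odotDr lerDl -scalemxAr odotZr mulr_ge0//.
  rewrite -{1}(mulmxKV uH y) odotC; apply: le_trans (H_lb _).
  by rewrite mulr_ge0 ?odot_ge0// ltW.
have -> : eps *: z = (eps *: (z *m invmx H)) *m H by rewrite -scalemxAl mulmxKV.
by rewrite -mulmxDl scalemxAr -mulmxDr /z mulmxKV// mulmxKV.
Qed.

(* With p = z A the equation reads g = (H + eps A^-1) p; the estimate says that
   this operator is at most LH + alpha, A^-1 being at most 1/m. *)
Lemma damped_descent z g : z *m A *m H + eps *: z = g ->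
  dot g g <= (LH + alpha) * dot g (z *m A).
Proof.
move=> E; set p := z *m A in E *.
have uA : A \in unitmx by exact: form_unitmx A_lb.
pose q := g *m invmx A; have qA : q *m A = g by rewrite mulmxKV.
have K0 : 0 < LH + alpha by rewrite ltr_pwDl.
set K := LH + alpha in K0 *.
have amgm (S : 'M[R]_N) a b : S^T = S -> (forall y, 0 <= dot y (y *m S)) ->
    2 * K * dot a (b *m S) <= K ^+ 2 * dot a (a *m S) + dot b (b *m S).
  move=> S_sym S0; have := S0 (K *: a - b).
  rewrite mulmxBl -scalemxAl odotBl !odotBr !odotZl !odotZr.
  by rewrite (odotC _ b (a *m S)) (odot_mulmx _ a b S_sym) expr2; lra.
have H0 y : 0 <= dot y (y *m H).
  by apply: le_trans (H_lb _); rewrite mulr_ge0 ?odot_ge0// ltW.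
have A0 y : 0 <= dot y (y *m A).
  by apply: le_trans (A_lb _); rewrite mulr_ge0 ?odot_ge0// ltW.
have h1 := amgm H p g H_sym H0; have h2 := amgm A z q A_sym A0.
rewrite qA -/p in h2.
have qg : m * dot q g <= dot g g.
  apply: le_trans (_ : m * (norm q * norm g) <= _).
    by rewrite ler_wpM2l ?(ltW m_gt0)// odot_le_onorm.
  rewrite mulrA -(sqr_onorm k_gt0) expr2 ler_wpM2r ?onorm_ge0//.
  by rewrite -[in leRHS]qA norm_mulA_ge.
have gg : dot g g = dot p (g *m H) + eps * dot z g.
  by rewrite -{1}E odotDl odotZl odot_mulmx.
have gp : dot g p = dot p (p *m H) + eps * dot z p.
  by rewrite -{1}E odotDl odotZl odotC.
have h3 := H_ub g.
have h2' : 2 * K * (eps * dot z g) <= K ^+ 2 * (eps * dot z p) + eps * dot q g.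
  by have := ler_wpM2l eps_ge0 h2; lra.
have h4 : eps * dot q g <= alpha * dot g g.
  by rewrite /eps -mulrA ler_wpM2l.
(* [h1] and [h2'] are weighted arithmetic-geometric inequalities in the forms of [H] and [A]. Their
   leftovers [dot g (g *m H)] and [eps * dot q g] are at most [LH] and [alpha] times [dot g g],
   whence the choice [K = LH + alpha]. *)
have key : 2 * K * dot g g <= K ^+ 2 * dot g p + K * dot g g.
  have e1 : 2 * K * dot g g = 2 * K * dot p (g *m H) + 2 * K * (eps * dot z g).
    by rewrite {1}gg mulrDr.
  have e2 : K ^+ 2 * dot g p = K ^+ 2 * dot p (p *m H) + K ^+ 2 * (eps * dot z p).
    by rewrite gp mulrDr.
  have e3 : K * dot g g = LH * dot g g + alpha * dot g g by rewrite /K mulrDl.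
  lra.
by rewrite -(ler_pM2l K0); lra.
Qed.

End Damped.

(** The difference of two solutions solves the first system, with the changes of data as right-hand
    side; [damped_norm] then yields Lipschitz dependence without differentiating an inverse. *)
Lemma damped_diff (R : realType) (N : nat) (A A' H H' : 'M[R]_N) (z z' : 'rV[R]_N) (e e' : R) :
  (z - z') *m A *m H + e *: (z - z') =
  (z *m A *m H + e *: z) - (z' *m A' *m H' + e' *: z')
  + ((z' *m A' - z' *m A) *m H + (z' *m A' *m H' - z' *m A' *m H)) + (e' - e) *: z'.
Proof.
rewrite !mulmxBl.
set a1 := z *m A *m H; set a2 := z' *m A *m H.
set a3 := z' *m A' *m H'; set a4 := z' *m A' *m H.
by apply/rowP => n; rewrite !mxE; ring.
Qed.

(** * The Jacobian *)

Section Differential.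
Context (R : realType) (V U : normedModType R).
Implicit Types (G : V -> U) (x : V).

Lemma diff_bounded G x : differentiable G x ->
  exists2 c, 0 <= c & forall h, `|'d G x h| <= c * `|h|.
Proof.
move=> dG; have /linear_bounded_continuous/linear_boundedP[c [_ H]] :=
  diff_continuous dG.
exists (Num.max c 0 + 1); first by rewrite addr_ge0// le_max lexx orbT.
by apply: H; rewrite ltr_pwDr// le_max lexx.
Qed.

Lemma has_deriv_diff G (f : R -> V) (t : R) d :
  differentiable G (f t) -> has_deriv f t d -> has_deriv (G \o f) t ('d G (f t) d).
Proof.
move=> dG /has_derivP[/derivable1_diffP df <-]; apply/has_derivP.
have dGf := differentiable_comp df dG.
by apply: DeriveDef; [exact/derivable1_diffP|rewrite !deriveE// diff_comp].
Qed.

Lemma has_deriv_segment (a d : V) (t : R) : has_deriv (fun s : R => a + s *: d) t d.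
Proof.
rewrite -[X in has_deriv _ _ X]add0r.
by apply: has_derivD; [exact: has_deriv_cst|exact: has_derivZid].
Qed.

End Differential.

Lemma has_deriv_odot (R : realType) (N : nat) (kappa : R) (g : R -> 'rV[R]_N) (t : R) d y :
  0 < kappa -> has_deriv g t d ->
  has_deriv (fun s => odot kappa y (g s)) t (odot kappa y d).
Proof.
move=> k0 H e e0; pose c := Num.sqrt (kappa * N%:R) * onorm kappa y + 1.
have c0 : 0 < c by rewrite ltr_pwDr// mulr_ge0 ?sqrtr_ge0 ?onorm_ge0.
have [|r r0 {}H] := H (e / c); first by rewrite divr_gt0.
exists r => // h /H{}H.
rewrite /GRing.scale /= -odotZr -!odotBr; apply: le_trans (ler_odot_onorm k0 _ _) _.
apply: le_trans (ler_wpM2l (onorm_ge0 _ _) (onorm_le_norm k0 _)) _.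
rewrite mulrA (mulrC (onorm _ _)).
apply: le_trans (ler_wpM2l _ H) _; first by rewrite mulr_ge0 ?sqrtr_ge0 ?onorm_ge0.
rewrite mulrA ler_wpM2r// mulrCA ler_piMr ?(ltW e0)//.
by rewrite ler_pdivrMr// mul1r /c lerDl.
Qed.

Lemma ball_segment (R : realType) (W : normedModType R) (w0 w w' : W) (r s : R) :
  `|w - w0| < r -> `|w' - w0| < r -> 0 <= s <= 1 ->
  `|w' + s *: (w - w') - w0| < r.
Proof.
move=> wr wr' /andP[s0 s1].
have -> : w' + s *: (w - w') - w0 = s *: (w - w0) + (1 - s) *: (w' - w0).
  by rewrite (scalerBl _ _ (w' - w0)) scale1r addrCA -scalerBr opprB addrA subrK addrAC.
apply: le_lt_trans (ler_normD _ _) _; rewrite !normrZ !ger0_norm ?subr_ge0//.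
have [->|s'] := eqVneq s 0; first by rewrite mul0r add0r subr0 mul1r.
have : s * `|w - w0| < s * r by rewrite ltr_pM2l// lt_neqAle eq_sym s'.
have : (1 - s) * `|w' - w0| <= (1 - s) * r by rewrite ler_wpM2l ?subr_ge0// ltW.
lra.
Qed.

Section Jacobian.
Context (R : realType) (W : innerType R) (N : nat) (kappa : R) (F : W -> 'rV[R]_N).
Hypothesis Wc : geometric_complete W.
Hypothesis k_gt0 : 0 < kappa.
Local Notation dot := (odot kappa).
Local Notation norm := (onorm kappa).
Local Notation J := (jac F).
Local Notation JT := (jacT kappa F).
Local Notation A := (ntk kappa F).

Lemma jac_linear w : linear (J w). Proof. by move=> t a b; exact: linearP. Qed.

Lemma jacB w a b : J w (a - b) = J w a - J w b. Proof. exact: linearB. Qed.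

Lemma jac_bounded w : differentiable F w ->
  exists2 c, 0 <= c & forall a, norm (J w a) <= c * `|a|.
Proof.
move=> /diff_bounded[c c0 h]; exists (Num.sqrt (kappa * N%:R) * c).
  by rewrite mulr_ge0 ?sqrtr_ge0.
move=> a; apply: le_trans (onorm_le_norm k_gt0 _) _.
by rewrite -mulrA ler_wpM2l ?sqrtr_ge0//; exact: h.
Qed.

(** By [riesz] the set inside [jacT] is inhabited, so its default value 0 is not what is chosen. *)
Lemma inner_jacT w y a : differentiable F w -> inner (JT w y) a = dot y (J w a).
Proof.
move=> dF; have [c c0 h] := jac_bounded dF.
have lin : linear (fun a => dot y (J w a)).
  by move=> t u v; rewrite jac_linear odotDr odotZr.
have bnd u : `|dot y (J w u)| <= norm y * c * `|u|.
  apply: le_trans (ler_odot_onorm k_gt0 _ _) _.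
  by rewrite -mulrA ler_wpM2l ?onorm_ge0.
have [z hz] := riesz Wc lin bnd.
exact: (@xgetPex _ 0 [set z : W | forall a, inner z a = dot y (J w a)] (ex_intro _ z hz)).
Qed.

Lemma jacTB w y z : differentiable F w -> JT w (y - z) = JT w y - JT w z.
Proof.
move=> dF; apply: inner_ext => a.
by rewrite innerBl !inner_jacT// odotBl.
Qed.

Lemma jacT_linear w : differentiable F w -> linear (JT w).
Proof.
move=> dF t y z; apply: inner_ext => a.
by rewrite innerDl innerZl !inner_jacT// odotDl odotZl.
Qed.

Lemma mul_ntk w y : differentiable F w -> y *m A w = J w (JT w y).
Proof.
move=> dF; pose jj (y : 'rV[R]_N) := J w (JT w y).
have jj_lin : linear jj by move=> t u v; rewrite /jj jacT_linear// jac_linear.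
pose jjL := HB.pack_for {linear 'rV[R]_N -> 'rV[R]_N} jj
  (GRing.isLinear.Build _ _ _ _ _ jj_lin).
by rewrite -[RHS]/(jjL y) -mul_rV_lin1.
Qed.

Lemma dot_ntk w y z : differentiable F w -> dot y (z *m A w) = inner (JT w y) (JT w z).
Proof. by move=> dF; rewrite mul_ntk// inner_jacT. Qed.

Lemma ntk_sym w : differentiable F w -> (A w)^T = A w.
Proof.
move=> dF; have E (i j : 'I_N) : dot (delta_mx 0 i) (delta_mx 0 j *m A w) = kappa * A w j i.
  rewrite -rowE /odot (bigD1 i)//= big1 => [|n ni].
    by rewrite !mxE !eqxx mul1r addr0.
  by rewrite !mxE (negbTE ni) andbF mul0r.
apply/matrixP => i j; rewrite mxE; apply: (mulfI (lt0r_neq0 k_gt0)).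
by rewrite -!E !dot_ntk// innerC.
Qed.

Lemma sqr_norm_jacT w y : differentiable F w -> `|JT w y| ^+ 2 = dot y (y *m A w).
Proof. by move=> dF; rewrite dot_ntk// sqr_norm_inner. Qed.

Variables (w0 : W) (rad C : R).
Hypothesis C_ge0 : 0 <= C.
Hypothesis C_bound : (djac_bound kappa F w0 rad <= C%:E)%E.

Lemma djac_ball w : `|w - w0| < rad -> (djac_opnorm kappa F w <= C%:E)%E.
Proof.
move=> wr; apply: le_trans C_bound; apply: ereal_sup_ubound; exists w => //.
by rewrite -ball_normE /= distrC.
Qed.

(** A finite bound on the infimum forces a derivative to exist; the slack [e] stands in for
    attainment. Homogeneity extends the bound from unit vectors. *)
Lemma jac_derivative_ex w e : `|w - w0| < rad -> 0 < e ->
  exists D, is_jac_derivative kappa F w D /\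
    forall a b, norm (D a b) <= (C + e) * (`|a| * `|b|).
Proof.
move=> wr e0; have lt : (djac_opnorm kappa F w < (C + e)%:E)%E.
  by apply: le_lt_trans (djac_ball wr) _; rewrite lte_fin ltrDl.
have [_ [D HD <-] Dlt] := ereal_inf_lt lt.
exists D; split=> // a b; have [_ lin1 lin2 _] := HD.
have lin0 (g : W -> 'rV[R]_N) : linear g -> (forall t a, g (t *: a) = t *: g a).
  move=> lg t u; have g0 : g 0 = 0.
    have := lg 1 0 0; rewrite !scale1r addr0 => /esym/eqP.
    by rewrite -subr_eq0 addrK => /eqP.
  by have := lg t u 0; rewrite !addr0 g0 addr0.
have DZ1 t u v : D (t *: u) v = t *: D u v by rewrite -[LHS]/((D^~ v) (t *: u)) lin0.
have DZ2 t u v : D u (t *: v) = t *: D u v by rewrite lin0.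
have unit u v : `|u| <= 1 -> `|v| <= 1 -> norm (D u v) <= C + e.
  move=> u1 v1; rewrite -lee_fin; apply: le_trans (ltW Dlt).
  by apply: ereal_sup_ubound; exists (u, v).
have unitn (u : W) : `| (`|u|^-1 *: u) | <= 1.
  rewrite normrZ normfV normr_id; have [->|u0] := eqVneq `|u| 0.
    by rewrite mulr0.
  by rewrite mulVf.
have uE (u : W) : `|u| *: (`|u|^-1 *: u) = u.
  have [->|u0] := eqVneq u 0; first by rewrite !scaler0.
  by rewrite scalerA divff ?normr_eq0// scale1r.
rewrite -{1}(uE a) -{1}(uE b) DZ1 DZ2 scalerA onormZ ger0_norm ?mulr_ge0//.
by rewrite mulrC ler_wpM2r ?mulr_ge0// unit.
Qed.

Lemma ball_differentiable w : `|w - w0| < rad -> differentiable F w.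
Proof.
move=> /jac_derivative_ex/(_ ltr01)[D [[H _ _ _] _]].
exact: nbhs_singleton H.
Qed.

(** Mean value inequality along the segment from [w'] to [w], for the scalar function
    [dot y (J (z s) b)]; the slack [eta] is finally absorbed in [e]. *)
Lemma jac_lipschitz w w' b : `|w - w0| < rad -> `|w' - w0| < rad ->
  norm (J w b - J w' b) <= C * `|w - w'| * `|b|.
Proof.
move=> wr wr'; apply/ler_addgt0Pr => e e0.
pose X := `|w - w'| * `|b|; have X0 : 0 <= X by rewrite mulr_ge0.
pose eta := e / (X + 1); have eta0 : 0 < eta by rewrite divr_gt0// ltr_wpDl.
suff : norm (J w b - J w' b) <= (C + eta) * X.
  move=> /le_trans; apply; rewrite mulrDl mulrA lerD2l /eta mulrAC ler_pdivrMr ?ltr_wpDl//.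
  by rewrite ler_wpM2l ?(ltW e0)// lerDl.
pose z (s : R) := w' + s *: (w - w').
have zr s : 0 <= s <= 1 -> `|z s - w0| < rad by exact: ball_segment.
have ex s : exists D, 0 <= s <= 1 -> is_jac_derivative kappa F (z s) D /\
    forall a b, norm (D a b) <= (C + eta) * (`|a| * `|b|).
  have [/zr/jac_derivative_ex/(_ eta0)[D HD]|] := boolP (0 <= s <= 1).
    by exists D.
  by exists (fun _ _ => 0).
have [D HD] := choice ex.
have d01 s y : 0 <= s <= 1 ->
    has_deriv (fun s => dot y (J (z s) b)) s (dot y (D s (w - w') b)).
  move=> s01; have [[_ lin1 lin2 Hs] _] := HD s s01.
  move=> q q0; pose c := norm y * X + 1.
  have c0 : 0 < c by rewrite ltr_wpDl// mulr_ge0 ?onorm_ge0.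
  have /nbhs_ballP[r /= r0 {}Hs] := Hs (q / c) (divr_gt0 q0 c0).
  have d0 : 0 < `|w - w'| + 1 by rewrite ltr_wpDl.
  exists (r / (`|w - w'| + 1)); first by rewrite divr_gt0.
  move=> h; rewrite ltr_pdivlMr// => hr.
  have zh : z (s + h) - z s = h *: (w - w').
    by rewrite /z scalerDl addrA (addrC (w' + _)) addrK.
  have := Hs (z (s + h)); rewrite -ball_normE /= distrC zh normrZ => /(_ _ b) H.
  rewrite /GRing.scale /= -odotZr -!odotBr; apply: le_trans (ler_odot_onorm k_gt0 _ _) _.
  have -> : h *: D s (w - w') b = D s (h *: (w - w')) b.
    have lg := lin2 b; have g0 : D s 0 b = 0.
      have := lg 1 0 0; rewrite !scale1r addr0 => /esym/eqP.
      by rewrite -subr_eq0 addrK => /eqP.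
    by have := lg h (w - w') 0; rewrite !addr0 g0 addr0.
  apply: le_trans (ler_wpM2l (onorm_ge0 _ _) (H _)) _.
    by apply: le_lt_trans hr; rewrite ler_wpM2l// lerDl.
  have -> : norm y * (q / c * (`|h| * `|w - w'|) * `|b|) = q * `|h| * (norm y * X / c).
    by rewrite /X; ring.
  rewrite ler_piMr ?mulr_ge0 ?(ltW q0)//.
  by rewrite ler_pdivrMr// mul1r /c lerDl.
apply: (onorm_le_dot k_gt0).
  by rewrite mulr_ge0 ?addr_ge0 ?(ltW eta0).
move=> y; rewrite odotC odotBr.
have := @deriv_abs_le_itv _ (fun s => dot y (J (z s) b)) (fun s => dot y (D s (w - w') b))
  0 1 (norm y * ((C + eta) * X)) ler01.
have z1 : z 1 = w by rewrite /z scale1r addrC subrK.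
rewrite z1 /z scale0r addr0 subr0 mulr1 mulrC => h.
apply: le_trans (ler_norm _) (h _ _) => u u01; first exact: d01.
apply: le_trans (ler_odot_onorm k_gt0 _ _) _.
by rewrite [leRHS]mulrC ler_wpM2l ?onorm_ge0//; have [_] := HD u u01.
Qed.

Lemma jacT_lipschitz w w' y : `|w - w0| < rad -> `|w' - w0| < rad ->
  `|JT w y - JT w' y| <= C * `|w - w'| * norm y.
Proof.
move=> wr wr'; apply: ler_norm_inner => [|a]; first by rewrite !mulr_ge0 ?onorm_ge0.
rewrite innerBl {1}(inner_jacT y a (ball_differentiable wr)).
rewrite (inner_jacT y a (ball_differentiable wr')).
rewrite -odotBr; apply: le_trans (odot_le_onorm k_gt0 _ _) _.
rewrite mulrAC mulrC ler_wpM2r ?onorm_ge0//; exact: jac_lipschitz.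
Qed.

Hypothesis rad_gt0 : 0 < rad.

Lemma jac_bounded_ball : exists2 c, 0 <= c &
  forall w a, `|w - w0| < rad -> norm (J w a) <= c * `|a|.
Proof.
have w0r : `|w0 - w0| < rad by rewrite subrr normr0.
have [c c0 h] := jac_bounded (ball_differentiable w0r).
exists (C * rad + c); first by rewrite addr_ge0// mulr_ge0// ltW.
move=> w a wr; rewrite -(subrK (J w0 a) (J w a)).
apply: le_trans (ler_onormD k_gt0 _ _) _; rewrite mulrDl lerD//.
apply: le_trans (jac_lipschitz _ wr w0r) _.
by rewrite ler_wpM2r// ler_wpM2l// ltW.
Qed.

Lemma norm_jacT_le c w y : differentiable F w -> 0 <= c ->
  (forall a, norm (J w a) <= c * `|a|) -> `|JT w y| <= c * norm y.
Proof.
move=> dF c0 h; apply: ler_norm_inner => [|a]; first by rewrite mulr_ge0 ?onorm_ge0.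
rewrite inner_jacT//; apply: le_trans (odot_le_onorm k_gt0 _ _) _.
by rewrite mulrAC mulrC ler_wpM2r ?onorm_ge0.
Qed.

Lemma outputs_lipschitz c w w' :
  (forall v a, `|v - w0| < rad -> norm (J v a) <= c * `|a|) -> 0 <= c ->
  `|w - w0| < rad -> `|w' - w0| < rad -> norm (F w - F w') <= c * `|w - w'|.
Proof.
move=> h c0 wr wr'; apply: (onorm_le_dot k_gt0); first by rewrite mulr_ge0.
move=> y; rewrite odotC odotBr.
pose z (s : R) := w' + s *: (w - w').
have zr s : 0 <= s <= 1 -> `|z s - w0| < rad by exact: ball_segment.
have z1 : z 1 = w by rewrite /z scale1r addrC subrK.
have z0 : z 0 = w' by rewrite /z scale0r addr0.
have := @deriv_abs_le_itv _ (fun s => dot y (F (z s))) (fun s => dot y (J (z s) (w - w')))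
  0 1 (norm y * (c * `|w - w'|)) ler01.
rewrite z1 z0 subr0 mulr1 mulrC => H.
apply: le_trans (ler_norm _) (H _ _) => s s01.
  apply: (has_deriv_odot y k_gt0); apply: (has_deriv_diff (ball_differentiable (zr _ s01))).
  exact: has_deriv_segment.
apply: le_trans (ler_odot_onorm k_gt0 _ _) _.
by rewrite [leRHS]mulrC ler_wpM2l ?onorm_ge0// h// zr.
Qed.

Lemma ntk_lipschitz c w w' y :
  (forall v a, `|v - w0| < rad -> norm (J v a) <= c * `|a|) -> 0 <= c ->
  `|w - w0| < rad -> `|w' - w0| < rad ->
  norm (y *m A w - y *m A w') <= 2 * C * c * `|w - w'| * norm y.
Proof.
move=> h c0 wr wr'; have dF := ball_differentiable wr; have dF' := ball_differentiable wr'.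
rewrite {1}(mul_ntk y dF) (mul_ntk y dF').
have -> : J w (JT w y) - J w' (JT w' y) =
    J w (JT w y - JT w' y) + (J w (JT w' y) - J w' (JT w' y)) by rewrite jacB subrKA.
apply: le_trans (ler_onormD k_gt0 _ _) _.
have h1 : norm (J w (JT w y - JT w' y)) <= c * (C * `|w - w'| * norm y).
  by apply: le_trans (h _ _ wr) _; rewrite ler_wpM2l// jacT_lipschitz.
have h2 : norm (J w (JT w' y) - J w' (JT w' y)) <= C * `|w - w'| * (c * norm y).
  apply: le_trans (jac_lipschitz _ wr wr') _; rewrite ler_wpM2l ?mulr_ge0//.
  by apply: norm_jacT_le => // a; exact: h.
apply: le_trans (lerD h1 h2) _; lra.
Qed.

End Jacobian.

(** * The objective and the spectrum of the preconditioner *)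

Section Loss.
Context (R : realType) (N : nat) (kappa : R) (loss : 'rV[R]_N -> R) (L mu : R) (ystar : 'rV[R]_N).
Hypotheses (k_gt0 : 0 < kappa) (L_gt0 : 0 < L) (mu_gt0 : 0 < mu).
Hypotheses (loss_ge0 : forall y, 0 <= loss y) (loss_min : loss ystar = 0).
Hypotheses (loss_smooth : smooth_fun kappa L loss) (loss_cvx : strongly_convex kappa mu loss).
Local Notation dot := (odot kappa).
Local Notation norm := (onorm kappa).
Local Notation g := (grad kappa loss).

Lemma diff_loss y h : 'd loss y h = dot (g y) h.
Proof.
have dl : differentiable loss y by exact: loss_smooth.1.
rewrite {1}(row_sum_delta h) linear_sum /odot mulr_sumr; apply: eq_bigr => n _.
rewrite linearZ /= !mxE deriveE// /GRing.scale /= mulrA mulrA divff ?gt_eqF// mul1r mulrC.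
by [].
Qed.

Lemma loss_deriv y h : has_deriv (fun t : R => loss (y + t *: h)) 0 (dot (g y) h).
Proof.
pose f (t : R) := y + t *: h.
have D : has_deriv (loss \o f) 0 ('d loss (f 0) h).
  by apply: has_deriv_diff; [exact: loss_smooth.1|exact: has_deriv_segment].
by rewrite diff_loss /f scale0r addr0 in D.
Qed.

Lemma grad_min : g ystar = 0.
Proof.
apply: (onorm_eq0 k_gt0); apply: le_anti; rewrite onorm_ge0 andbT.
apply: (onorm_le_dot k_gt0) => // h; rewrite mul0r; apply/ler_addgt0Pr => e e0.
have [r r0 H] := loss_deriv ystar (- h) e0.
have r2 : 0 < r / 2 by rewrite divr_gt0.
have := H (r / 2); rewrite gtr0_norm// scale0r addr0 loss_min subr0 add0r.
have lt : r / 2 < r by lra.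
move=> /(_ lt); rewrite odotNr /GRing.scale /= mulrN opprK => /(le_trans (ler_norm _)) H1.
have h0 := loss_ge0 (ystar + (r / 2) *: - h).
by rewrite -(ler_pM2l r2) add0r (mulrC _ e); lra.
Qed.

(** Strong convexity between [y] and the minimiser, divided by the weight [t] of [y]; the error
    factor [1 - t] disappears for small [t]. *)
Lemma loss_quadratic_growth y : mu / 2 * norm (y - ystar) ^+ 2 <= loss y.
Proof.
apply/ler_addgt0Pr => e e0; set n := norm _ ^+ 2.
have n0 : 0 <= n by rewrite exprn_ge0 ?onorm_ge0.
have c0 : 0 < mu * n + e by rewrite ltr_wpDl// mulr_ge0// ltW.
pose t := e / (mu * n + e).
have t0 : 0 < t by rewrite divr_gt0.
have t1 : t <= 1 by rewrite ler_pdivrMr// mul1r lerDr mulr_ge0// ltW.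
have := loss_cvx y ystar (_ : 0 <= t <= 1); rewrite t1 (ltW t0) => /(_ isT).
rewrite loss_min mulr0 addr0 -/n => h.
have h0 := loss_ge0 (t *: y + (1 - t) *: ystar).
have : t * (mu / 2 * (1 - t) * n) <= t * loss y by lra.
rewrite ler_pM2l// => h1.
have te : t * (mu * n + e) = e by rewrite /t divfK// gt_eqF.
have : t * (mu * n) <= e by rewrite -[leRHS]te ler_pM2l// lerDl ltW.
lra.
Qed.

(** Strong convexity, differentiated at [y] towards [ystar], gives [key]; the square of
    [norm (g y) - mu * n] completes the bound. *)
Lemma polyak_lojasiewicz y : 2 * mu * loss y <= norm (g y) ^+ 2.
Proof.
set n := norm (y - ystar).
have n0 : 0 <= n by exact: onorm_ge0.
suff key : loss y + dot (g y) (ystar - y) + mu / 2 * n ^+ 2 <= 0.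
  have : - dot (g y) (ystar - y) <= norm (g y) * n.
    by rewrite -odotNr opprB; exact: odot_le_onorm.
  have := sqr_ge0 (norm (g y) - mu * n); have := mu_gt0; nra.
apply/ler_addgt0Pr => e e0; rewrite add0r.
have e2 : 0 < e / 2 by rewrite divr_gt0.
have [r r0 H] := loss_deriv y (ystar - y) e2.
have c0 : 0 < mu * n ^+ 2 + e by rewrite ltr_wpDl// mulr_ge0 ?exprn_ge0// ltW.
pose t := Num.min (r / 2) (e / (mu * n ^+ 2 + e)).
have t0 : 0 < t by rewrite lt_min !divr_gt0.
have tr : t < r by rewrite gt_min; apply/orP; left; lra.
have te : t <= e / (mu * n ^+ 2 + e) by rewrite ge_min lexx orbT.
have t1 : t <= 1.
  by apply: le_trans te _; rewrite ler_pdivrMr// mul1r lerDr mulr_ge0 ?exprn_ge0// ltW.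
have tmn : t * (mu * n ^+ 2) <= e.
  apply: le_trans (_ : t * (mu * n ^+ 2 + e) <= _); first by rewrite ler_pM2l// lerDl ltW.
  by rewrite -ler_pdivlMr.
have := H t; rewrite gtr0_norm// => /(_ tr); rewrite scale0r addr0 add0r.
rewrite ler_norml => /andP[H1 _].
have := loss_cvx ystar y (_ : 0 <= t <= 1); rewrite t1 (ltW t0) => /(_ isT).
have -> : t *: ystar + (1 - t) *: y = y + t *: (ystar - y).
  by rewrite scalerBl scale1r scalerBr addrA addrAC addrC addrA.
rewrite loss_min mulr0 add0r onormB -/n => h.
move: H1; rewrite {2}/GRing.scale /= => H1.
rewrite -(ler_pM2l t0); nra.
Qed.

(** The gradient vanishes at [ystar], so smoothness bounds it by the distance to [ystar], and
    quadratic growth bounds that distance. *)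
Lemma grad_le_loss y : norm (g y) ^+ 2 <= 2 * L ^+ 2 / mu * loss y.
Proof.
have h1 : norm (g y) <= L * norm (y - ystar).
  by have := loss_smooth.2 y ystar; rewrite grad_min subr0.
have h2 := loss_quadratic_growth y.
apply: le_trans (_ : (L * norm (y - ystar)) ^+ 2 <= _).
  by rewrite lerXn2r ?nnegrE ?mulr_ge0 ?onorm_ge0// ltW.
rewrite exprMn; have -> : 2 * L ^+ 2 / mu * loss y = L ^+ 2 * (2 / mu * loss y) by ring.
rewrite ler_wpM2l ?exprn_ge0 ?(ltW L_gt0)// mulrAC ler_pdivlMr//; lra.
Qed.

End Loss.

Section Spectrum.
Context (R : realType) (N : nat) (kappa : R).
Hypotheses (k_gt0 : 0 < kappa) (N_gt0 : (0 < N)%N).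
Local Notation dot := (odot kappa).
Local Notation norm := (onorm kappa).

Lemma spectrum_lb (S : 'M[R]_N) c y : S^T = S ->
  (forall a, eigenvalue S a -> c <= a) -> c * dot y y <= dot y (y *m S).
Proof.
move=> S_sym h; apply: le_trans (min_eigenvalue_le N_gt0 S_sym y k_gt0).
by rewrite ler_wpM2r ?odot_ge0// h//; exact: min_eigenvalue_attained.
Qed.

Lemma spectrum_ub (S : 'M[R]_N) c y : S^T = S ->
  (forall a, eigenvalue S a -> a <= c) -> dot y (y *m S) <= c * dot y y.
Proof.
move=> S_sym h; rewrite -lerN2 -mulNr -odotNr -mulmxN; apply: spectrum_lb.
  by rewrite linearN /= S_sym.
move=> a /eigenvalueP[v vS v0]; rewrite lerNl; apply: h.
apply/eigenvalueP; exists v => //.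
by move: vS; rewrite mulmxN scaleNr => <-; rewrite opprK.
Qed.

Lemma min_eigenvalue_ge (S : 'M[R]_N) c : S^T = S ->
  (forall y, c * dot y y <= dot y (y *m S)) -> c <= min_eigenvalue S.
Proof.
move=> S_sym h; have /eigenvalueP[y yS y0] := min_eigenvalue_attained N_gt0 S_sym.
have := h y; rewrite yS odotZr ler_pM2r//.
rewrite lt_neqAle odot_ge0// andbT eq_sym; apply: contra y0 => /eqP yy.
by apply/eqP/(onorm_eq0 k_gt0); rewrite /onorm yy sqrtr0.
Qed.

Lemma min_eigenvalue_perturb (S S' : 'M[R]_N) k : S^T = S -> S'^T = S' ->
  (forall y, norm (y *m S - y *m S') <= k * norm y) ->
  min_eigenvalue S - k <= min_eigenvalue S'.
Proof.
move=> S_sym S'_sym h; apply: min_eigenvalue_ge => // y.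
have := min_eigenvalue_le N_gt0 S_sym y k_gt0.
have := odot_le_onorm k_gt0 y (y *m S - y *m S'); rewrite odotBr.
have : norm y * norm (y *m S - y *m S') <= k * dot y y.
  by rewrite -(sqr_onorm k_gt0) expr2 mulrA (mulrC k) -mulrA ler_wpM2l ?onorm_ge0.
lra.
Qed.

Lemma entry_le_norm (S : 'M[R]_N) i j : `|S i j| <= `|S|.
Proof.
by rewrite [leRHS]/Num.norm /= mx_normrE; apply/bigmax_geP; right => /=; exists (i, j).
Qed.

Lemma norm_le_entry (S : 'M[R]_N) t : 0 <= t -> (forall i j, `|S i j| <= t) -> `|S| <= t.
Proof.
move=> t0 h; rewrite [leLHS]/Num.norm /= mx_normrE; apply/bigmax_leP; split=> // -[i j] _.
Qed.

Lemma onorm_mulmx_le : exists2 c, 0 <= c &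
  forall (S : 'M[R]_N) y, norm (y *m S) <= c * `|S| * norm y.
Proof.
exists (Num.sqrt (kappa * N%:R) * (N%:R * (Num.sqrt kappa)^-1)).
  by rewrite !mulr_ge0 ?sqrtr_ge0 ?invr_ge0 ?sqrtr_ge0.
move=> S y; apply: le_trans (onorm_le_norm k_gt0 _) _.
rewrite -!mulrA ler_wpM2l ?sqrtr_ge0//.
apply: le_trans (_ : N%:R * (`|S| * `|y|) <= _); last first.
  by rewrite ler_wpM2l// mulrCA ler_wpM2l// norm_le_onorm.
apply: norm_le_coord => [|n]; first by rewrite !mulr_ge0.
rewrite mxE; apply: le_trans (ler_norm_sum _ _ _) _.
apply: le_trans (_ : \sum_(m < N) `|S| * `|y| <= _); last first.
  by rewrite sumr_const card_ord [leRHS]mulr_natl.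
apply: ler_sum => m _; rewrite normrM mulrC ler_pM ?entry_le_norm//.
exact: coord_le_norm.
Qed.

(** Near [p] the differential is within 1 of its value at [p], hence bounded by [c + 1]; the mean
    value inequality is applied entry by entry. *)
Lemma C1_locally_lipschitz (W : normedModType R) (H : W -> 'M[R]_N) p :
  continuously_differentiable H -> exists d c, [/\ 0 < d, 0 <= c &
  forall w w' y, `|w - p| < d -> `|w' - p| < d ->
    norm (y *m H w - y *m H w') <= c * `|w - w'| * norm y].
Proof.
move=> [dH cH]; have [c c0 hc] := diff_bounded (dH p).
have /nbhs_ballP[d /= d0 Hd] := cH p 1 ltr01.
have [k k0 hk] := onorm_mulmx_le.
exists d, (k * (c + 1)); split=> // [|w w' y wd w'd]; first by rewrite mulr_ge0// addr_ge0.
rewrite -mulmxBr; apply: le_trans (hk _ _) _.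
rewrite ler_wpM2r ?onorm_ge0// -mulrA ler_wpM2l//.
have b0 : 0 <= (c + 1) * `|w - w'| by rewrite mulr_ge0// addr_ge0.
apply: norm_le_entry => // i j; rewrite !mxE.
pose z (s : R) := w' + s *: (w - w').
have zr s : 0 <= s <= 1 -> `|z s - p| < d by exact: ball_segment.
have z1 : z 1 = w by rewrite /z scale1r addrC subrK.
have z0 : z 0 = w' by rewrite /z scale0r addr0.
have := @deriv_abs_le_itv _ (fun s => H (z s) i j) (fun s => 'd H (z s) (w - w') i j)
  0 1 ((c + 1) * `|w - w'|) ler01.
rewrite z1 z0 subr0 mulr1; apply=> s s01.
  have D : has_deriv (H \o z) s ('d H (z s) (w - w')).
    by apply: has_deriv_diff => //; exact: has_deriv_segment.
  move=> e /D[r r0 hr]; exists r => // h /hr; apply: le_trans.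
  by apply: le_trans (entry_le_norm _ i j); rewrite !mxE.
apply: le_trans (entry_le_norm _ i j) _.
have := Hd (z s); rewrite -ball_normE /= distrC => /(_ (zr s s01) (w - w')).
rewrite mul1r => h1; rewrite -(subrK ('d H p (w - w')) ('d H (z s) (w - w'))).
by rewrite (le_trans (ler_normD _ _))// addrC mulrDl mul1r lerD.
Qed.

End Spectrum.

(** * The Gauss-Newton flow *)

Section GaussNewtonFlow.
Context (R : realType) (W : innerType R) (N : nat) (kappa : R) (F : W -> 'rV[R]_N).
Hypotheses (Wc : geometric_complete W) (N_gt0 : (0 < N)%N) (k_gt0 : 0 < kappa).
Local Notation dot := (odot kappa).
Local Notation norm := (onorm kappa).
Local Notation J := (jac F).
Local Notation JT := (jacT kappa F).
Local Notation A := (ntk kappa F).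
Variables (w0 : W) (rad C : R).
Hypotheses (C_ge0 : 0 <= C) (rad_gt0 : 0 < rad).
Hypothesis C_bound : (djac_bound kappa F w0 rad <= C%:E)%E.

Variables (loss : 'rV[R]_N -> R) (L mu : R) (ystar : 'rV[R]_N).
Hypotheses (L_gt0 : 0 < L) (mu_gt0 : 0 < mu).
Hypotheses (loss_ge0 : forall y, 0 <= loss y) (loss_min : loss ystar = 0).
Hypotheses (loss_smooth : smooth_fun kappa L loss) (loss_cvx : strongly_convex kappa mu loss).
Local Notation g := (grad kappa loss).

Variables (H : W -> 'M[R]_N) (muH LH alpha : R).
Hypotheses (muH_gt0 : 0 < muH) (LH_gt0 : 0 < LH) (alpha_ge0 : 0 <= alpha).
Hypothesis H_sym : forall w, (H w)^T = H w.
Hypothesis H_C1 : continuously_differentiable H.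
Hypothesis H_spec : forall w a, eigenvalue (H w) a -> muH <= a <= LH.
Local Notation Phi := (gn_field kappa F loss H alpha).

Variables (r s : R).
Hypotheses (r_gt0 : 0 < r) (r_le : r <= rad) (s_gt0 : 0 < s).
Hypothesis jacT_lb : forall w y, `|w - w0| < r -> s * norm y <= `|JT w y|.

Let in_rad w : `|w - w0| < r -> `|w - w0| < rad.
Proof. by move=> wr; exact: lt_le_trans r_le. Qed.

Let diffF w : `|w - w0| < r -> differentiable F w.
Proof. by move=> /in_rad; exact: ball_differentiable C_bound w. Qed.

Let m w := min_eigenvalue (A w).

Let m_ge w : `|w - w0| < r -> s ^+ 2 <= m w.
Proof.
move=> wr; have dF := diffF wr.
apply: (min_eigenvalue_ge k_gt0 N_gt0 (ntk_sym Wc k_gt0 dF)) => y.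
rewrite -(sqr_norm_jacT Wc k_gt0 y dF) -(sqr_onorm k_gt0) -exprMn.
by rewrite lerXn2r ?nnegrE ?mulr_ge0 ?onorm_ge0 ?(ltW s_gt0)// jacT_lb.
Qed.

Let m_gt0 w : `|w - w0| < r -> 0 < m w.
Proof. by move=> /m_ge; apply: lt_le_trans; rewrite exprn_gt0. Qed.

Let A_lb w y : `|w - w0| < r -> m w * dot y y <= dot y (y *m A w).
Proof.
by move=> wr; exact: (min_eigenvalue_le N_gt0 (ntk_sym Wc k_gt0 (diffF wr))).
Qed.

Let H_lb w y : muH * dot y y <= dot y (y *m H w).
Proof. by apply: spectrum_lb => // a /H_spec/andP[]. Qed.

Let H_ub w y : dot y (y *m H w) <= LH * dot y y.
Proof. by apply: spectrum_ub => // a /H_spec/andP[]. Qed.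

Let z w := g (F w) *m invmx (H w) *m invmx (A w + damping kappa F alpha w *: invmx (H w)).

Let PhiE w : Phi w = JT w (z w). Proof. by []. Qed.

Let zE w : `|w - w0| < r -> z w *m A w *m H w + (alpha * m w) *: z w = g (F w).
Proof.
move=> wr; exact: (damped_solution k_gt0 (m_gt0 wr) muH_gt0 alpha_ge0
  (fun y => A_lb y wr) (H_lb w)).
Qed.

Let z_norm w : `|w - w0| < r -> norm (z w) <= norm (g (F w)) / (s ^+ 2 * muH).
Proof.
move=> wr; apply: le_trans (damped_norm k_gt0 (m_gt0 wr) muH_gt0 alpha_ge0
  (fun y => A_lb y wr) (H_lb w) (zE wr)) _.
rewrite ler_wpM2l ?onorm_ge0// lef_pV2 ?posrE ?mulr_gt0 ?exprn_gt0 ?m_gt0//.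
by rewrite ler_wpM2r ?(ltW muH_gt0)// m_ge.
Qed.

(** One of the two factors [norm (z w)] and [norm (z w *m A w)] is traded for [|Phi w| / s] by
    [jacT_lb]. Only one power of [s] is lost, against two in [z_norm]. *)
Lemma field_norm w : `|w - w0| < r -> `|Phi w| <= norm (g (F w)) / (s * muH).
Proof.
move=> wr; have dF := diffF wr; rewrite PhiE.
have h1 := damped_normA k_gt0 (m_gt0 wr) muH_gt0 alpha_ge0
  (fun y => A_lb y wr) (H_lb w) (zE wr).
have h2 : `|JT w (z w)| ^+ 2 <= norm (z w) * norm (z w *m A w).
  by rewrite (sqr_norm_jacT Wc k_gt0 _ dF) odot_le_onorm.
have h3 := jacT_lb (z w) wr.
rewrite invfM mulrA mulrAC ler_pdivlMr// mulrC; apply: le_trans h1.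
have := normr_ge0 (JT w (z w)); rewrite le_eqVlt => /predU1P[<-|n0].
  by rewrite mulr0 onorm_ge0.
rewrite -(ler_pM2r n0) -mulrA -expr2.
apply: le_trans (ler_wpM2l (ltW s_gt0) h2) _.
by rewrite mulrA mulrC ler_wpM2l ?onorm_ge0.
Qed.

Lemma field_descent w : `|w - w0| < r ->
  norm (g (F w)) ^+ 2 <= (LH + alpha) * dot (g (F w)) (J w (Phi w)).
Proof.
move=> wr; have dF := diffF wr; rewrite PhiE -(mul_ntk Wc k_gt0 _ dF) sqr_onorm//.
exact: (damped_descent k_gt0 (m_gt0 wr) muH_gt0 LH_gt0 alpha_ge0 (ntk_sym Wc k_gt0 dF)
  (H_sym w) (fun y => A_lb y wr) (H_lb w) (H_ub w) (zE wr)).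
Qed.

(** The damping involves a smallest eigenvalue, which is Lipschitz by [min_eigenvalue_perturb] but
    in general not differentiable; hence the direct comparison through [damped_diff]. *)
Lemma field_locally_lipschitz p : `|p - w0| < r -> exists d K, [/\ 0 < d, 0 <= K &
  forall w w', `|w - p| < d -> `|w' - p| < d -> `|Phi w - Phi w'| <= K * `|w - w'|].
Proof.
move=> pr.
have [c c0 Jc] := jac_bounded_ball k_gt0 C_ge0 C_bound rad_gt0.
have [dH [KH [dH0 KH0 Hlip]]] := C1_locally_lipschitz k_gt0 p H_C1.
pose d := Num.min dH (r - `|p - w0|).
have d0 : 0 < d by rewrite lt_min dH0 subr_gt0.
have inr w : `|w - p| < d -> `|w - w0| < r.
  rewrite lt_min => /andP[_ wd]; rewrite -(subrKA p).
  by apply: le_lt_trans (ler_normD _ _) _; lra.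
pose G := norm (g (F p)) + L * (c * d).
pose Z := G / (s ^+ 2 * muH).
have sm0 : 0 < s ^+ 2 * muH by rewrite mulr_gt0 ?exprn_gt0.
have glip w w' : `|w - w0| < r -> `|w' - w0| < r ->
    norm (g (F w) - g (F w')) <= L * (c * `|w - w'|).
  move=> wr w'r; apply: le_trans (loss_smooth.2 _ _) _; rewrite ler_wpM2l ?(ltW L_gt0)//.
  exact: (outputs_lipschitz k_gt0 C_bound Jc c0 (in_rad wr) (in_rad w'r)).
have gG w : `|w - p| < d -> norm (g (F w)) <= G.
  move=> wd; rewrite -(subrK (g (F p)) (g (F w))) addrC.
  apply: le_trans (ler_onormD k_gt0 _ _) _; rewrite lerD2l.
  apply: le_trans (glip _ _ (inr _ wd) pr) _.
  by rewrite ler_wpM2l ?(ltW L_gt0)// ler_wpM2l// ltW.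
have zZ w : `|w - p| < d -> norm (z w) <= Z.
  move=> wd; apply: le_trans (z_norm (inr _ wd)) _.
  by rewrite ler_wpM2r ?invr_ge0 ?(ltW sm0)// gG.
have Z0 : 0 <= Z by apply: le_trans (zZ p _); rewrite ?onorm_ge0// subrr normr0.
clearbody Z.
pose KA := 2 * C * c.
have KA0 : 0 <= KA by rewrite !mulr_ge0.
have Alip w w' y : `|w - w0| < r -> `|w' - w0| < r ->
    norm (y *m A w - y *m A w') <= KA * `|w - w'| * norm y.
  move=> wr w'r; exact: (ntk_lipschitz Wc k_gt0 C_ge0 C_bound y Jc c0 (in_rad wr) (in_rad w'r)).
have mlip w w' : `|w - w0| < r -> `|w' - w0| < r -> `|m w - m w'| <= KA * `|w - w'|.
  have key v v' : `|v - w0| < r -> `|v' - w0| < r -> m v - m v' <= KA * `|v - v'|.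
    move=> vr v'r.
    have := min_eigenvalue_perturb k_gt0 N_gt0 (ntk_sym Wc k_gt0 (diffF vr))
      (ntk_sym Wc k_gt0 (diffF v'r)) (fun y => Alip v v' y vr v'r).
    by rewrite lerBlDr => h; rewrite lerBlDl.
  move=> wr w'r; rewrite ler_norml; apply/andP; split; last exact: key.
  by rewrite lerNl opprB distrC key.
have An w y : `|w - w0| < r -> norm (y *m A w) <= c ^+ 2 * norm y.
  move=> wr; have dF := diffF wr; rewrite (mul_ntk Wc k_gt0 y dF).
  apply: le_trans (Jc _ _ (in_rad wr)) _; rewrite expr2 -mulrA ler_wpM2l//.
  by apply: (norm_jacT_le Wc k_gt0) => // a; exact: Jc (in_rad wr).
(* The four terms are the variations of the gradient, of [A], of [H] and of the damping. *)
pose Kz := (L * c + LH * (KA * Z) + KH * (c ^+ 2 * Z) + alpha * KA * Z) / (s ^+ 2 * muH).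
have zlip w w' : `|w - p| < d -> `|w' - p| < d ->
    norm (z w - z w') <= Kz * `|w - w'|.
  move=> wd w'd; have wr := inr _ wd; have w'r := inr _ w'd.
  have wH : `|w - p| < dH by move: wd; rewrite lt_min => /andP[].
  have w'H : `|w' - p| < dH by move: w'd; rewrite lt_min => /andP[].
  set h := (z w - z w') *m A w *m H w + (alpha * m w) *: (z w - z w').
  have hn := damped_norm k_gt0 (m_gt0 wr) muH_gt0 alpha_ge0
    (fun y => A_lb y wr) (H_lb w) (erefl h).
  have {}hn : norm (z w - z w') <= norm h / (s ^+ 2 * muH).
    apply: le_trans hn _.
    rewrite ler_wpM2l ?onorm_ge0// lef_pV2 ?posrE ?mulr_gt0 ?exprn_gt0 ?m_gt0//.
    by rewrite ler_wpM2r ?(ltW muH_gt0)// m_ge.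
  apply: le_trans hn _; rewrite /Kz [leRHS]mulrAC ler_wpM2r ?invr_ge0 ?(ltW sm0)//.
  have hE : h = (g (F w) - g (F w')) + ((z w' *m A w' - z w' *m A w) *m H w
      + (z w' *m A w' *m H w' - z w' *m A w' *m H w)) + (alpha * m w' - alpha * m w) *: z w'.
    apply: etrans (damped_diff (A w) (A w') (H w) (H w') (z w) (z w')
      (alpha * m w) (alpha * m w')) _.
    congr (_ - _ + _ + _); [exact: zE wr|exact: zE w'r].
  set D := `|w - w'|; have D0 : 0 <= D by exact: normr_ge0.
  have Dsym : `|w' - w| = D by rewrite distrC.
  have t1 := glip _ _ wr w'r.
  have t2 : norm ((z w' *m A w' - z w' *m A w) *m H w) <= LH * (KA * D * Z).
    apply: le_trans (norm_mulH_le k_gt0 muH_gt0 LH_gt0 (H_sym w) (H_lb w) (H_ub w) _) _.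
    rewrite ler_wpM2l ?(ltW LH_gt0)// (le_trans (Alip _ _ _ w'r wr))// Dsym.
    by rewrite ler_wpM2l ?mulr_ge0// zZ.
  have t3 : norm (z w' *m A w' *m H w' - z w' *m A w' *m H w) <= KH * D * (c ^+ 2 * Z).
    apply: le_trans (Hlip _ _ _ w'H wH) _; rewrite Dsym ler_wpM2l ?mulr_ge0//.
    by apply: le_trans (An _ _ w'r) _; rewrite ler_wpM2l ?exprn_ge0// zZ.
  have t4 : norm ((alpha * m w' - alpha * m w) *: z w') <= alpha * (KA * D) * Z.
    rewrite onormZ -mulrBr normrM (ger0_norm alpha_ge0) ler_pM ?mulr_ge0 ?onorm_ge0 ?zZ//.
    by rewrite ler_wpM2l// -Dsym mlip.
  rewrite hE; apply: le_trans (ler_onormD k_gt0 _ _) _.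
  apply: le_trans (lerD (ler_onormD k_gt0 _ _) (lexx _)) _.
  apply: le_trans (lerD (lerD (lexx _) (ler_onormD k_gt0 _ _)) (lexx _)) _.
  rewrite -/D in t1; lra.
have Kz0 : 0 <= Kz.
  rewrite /Kz divr_ge0 ?(ltW sm0)// !addr_ge0 ?mulr_ge0 ?exprn_ge0 ?(ltW L_gt0) ?(ltW LH_gt0)//.
clearbody Kz.
exists d, (c * Kz + C * Z); split=> // [|w w' wd w'd].
  by rewrite addr_ge0 ?mulr_ge0.
have wr := inr _ wd; have w'r := inr _ w'd.
rewrite !PhiE -(subrKA (JT w (z w'))) -(jacTB Wc k_gt0 _ _ (diffF wr)).
apply: le_trans (ler_normD _ _) _; rewrite mulrDl lerD//.
  rewrite -mulrA; apply: le_trans (norm_jacT_le Wc k_gt0 _ (diffF wr) c0 _) _.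
    by move=> a; exact: Jc (in_rad wr).
  by rewrite ler_wpM2l// zlip.
apply: le_trans (jacT_lipschitz Wc k_gt0 C_ge0 C_bound _ (in_rad wr) (in_rad w'r)) _.
by rewrite mulrAC ler_wpM2r// ler_wpM2l// zZ.
Qed.

Let muGN := 2 * mu / (LH * (1 + alpha / muH)).

Let muH_le_LH : muH <= LH.
Proof.
have /H_spec/andP[] := min_eigenvalue_attained N_gt0 (H_sym w0).
exact: le_trans.
Qed.

Let muGN_gt0 : 0 < muGN.
Proof.
by rewrite divr_gt0 ?mulr_gt0// ltr_pwDl// divr_ge0// ltW.
Qed.

(** [LH + alpha <= LH * (1 + alpha / muH)] because [muH <= LH]: the rate in the statement is weaker
    than the one the descent estimate gives. *)
Let muGN_le : muGN * (LH + alpha) <= 2 * mu.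
Proof.
have q0 : 0 < 1 + alpha / muH by rewrite ltr_pwDl// divr_ge0// ltW.
rewrite /muGN mulrAC ler_pdivrMr ?mulr_gt0// ler_pM2l ?mulr_gt0//.
rewrite mulrDr mulr1 lerD2l mulrCA ler_peMr// ler_pdivlMr//.
by rewrite mul1r.
Qed.

Let Psi w := - Phi w.

Lemma loss_decay T w : solves Psi w0 T%:E w -> stays w0 r T%:E w ->
  forall t, 0 <= t < T -> loss (F (w t)) <= loss (F w0) * expR (- muGN * t).
Proof.
move=> Sw stw t /andP[t0 tT].
have ltT u : u <= t -> (u%:E < T%:E)%E by move=> ut; rewrite lte_fin (le_lt_trans ut).
have := @gronwall _ (fun u => loss (F (w u)))
  (fun u => - dot (g (F (w u))) (J (w u) (Phi (w u)))) 0 t (- muGN) t0.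
rewrite subr0 (solves0 Sw); apply=> u /andP[u0 ut].
  have wr := stw u u0 (ltT _ ut).
  have D1 : has_deriv (F \o w) u (J (w u) (- Phi (w u))).
    by apply: has_deriv_diff; [exact: diffF|exact: Sw.2 (ltT _ ut)].
  have := @has_deriv_diff _ _ _ loss (F \o w) u _ (loss_smooth.1 _) D1.
  by rewrite (diff_loss k_gt0 loss_smooth) -odotNr /jac linearN.
have wr := stw u u0 (ltT _ ut).
have h1 := field_descent wr.
have h2 := polyak_lojasiewicz k_gt0 mu_gt0 loss_min loss_smooth loss_cvx (F (w u)).
have K0 : 0 < LH + alpha by rewrite ltr_pwDl.
rewrite mulNr lerN2 -(ler_pM2l K0); apply: le_trans h1; apply: le_trans h2.
by rewrite mulrA ler_wpM2r// mulrC.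
Qed.

Let g0 := norm (g (F w0)).
(** The speed bound at time 0, enlarged by [L / mu]: the price of going from gradient to objective
    at time 0 and back at time [t]. *)
Let B := L * g0 / (mu * s * muH).

Let B_ge0 : 0 <= B.
Proof.
by rewrite divr_ge0 ?mulr_ge0 ?onorm_ge0 ?(ltW L_gt0) ?(ltW mu_gt0) ?(ltW s_gt0) ?(ltW muH_gt0).
Qed.

Lemma speed_decay T w : solves Psi w0 T%:E w -> stays w0 r T%:E w ->
  forall t, 0 <= t < T -> `|Psi (w t)| <= B * expR (- (muGN / 2) * t).
Proof.
move=> Sw stw t /[dup] tT /andP[t0 tT'].
have wr : `|w t - w0| < r by apply: stw => //; rewrite lte_fin.
rewrite /Psi normrN; apply: le_trans (field_norm wr) _.
have h : norm (g (F (w t))) <= L * g0 / mu * expR (- (muGN / 2) * t).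
  have n0 : 0 <= L * g0 / mu by rewrite divr_ge0 ?mulr_ge0 ?onorm_ge0 ?(ltW L_gt0) ?(ltW mu_gt0).
  rewrite -(ler_pXn2r (_ : 0 < 2)%N) ?nnegrE ?onorm_ge0 ?(mulr_ge0 n0) ?expR_ge0//.
  apply: le_trans (grad_le_loss k_gt0 L_gt0 mu_gt0 loss_ge0 loss_min loss_smooth loss_cvx _) _.
  rewrite exprMn -expRM_natl.
  have -> : 2%:R * (- (muGN / 2) * t) = - muGN * t by field.
  apply: le_trans (ler_wpM2l _ (loss_decay Sw stw tT)) _.
    by rewrite divr_ge0 ?(ltW mu_gt0)// mulr_ge0// exprn_ge0// ltW.
  rewrite mulrA ler_wpM2r ?expR_ge0//.
  have h2 := polyak_lojasiewicz k_gt0 mu_gt0 loss_min loss_smooth loss_cvx (F w0).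
  have -> : (L * g0 / mu) ^+ 2 = L ^+ 2 / mu ^+ 2 * g0 ^+ 2 by rewrite !exprMn exprVn; ring.
  apply: le_trans (ler_wpM2l _ h2); last by rewrite divr_ge0 ?exprn_ge0 ?(ltW L_gt0) ?(ltW mu_gt0).
  by rewrite le_eqVlt; apply/orP; left; apply/eqP; field; rewrite gt_eqF.
have sm : 0 < s * muH by rewrite mulr_gt0.
rewrite ler_pdivrMr//; apply: le_trans h _; rewrite le_eqVlt; apply/orP; left; apply/eqP.
by rewrite /B; field; rewrite !gt_eqF.
Qed.

(** The integral of [B * exp (- muGN t / 2)] over all positive times. *)
Let r1 := 2 / muGN * B.

Lemma distance_bound T w : solves Psi w0 T%:E w -> stays w0 r T%:E w ->
  forall t, 0 <= t < T -> `|w t - w0| <= r1.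
Proof.
move=> Sw stw t /andP[t0 tT].
pose q u := expR (- (muGN / 2) * u) * - r1.
have Dq u : has_deriv q u (B * expR (- (muGN / 2) * u)).
  have := has_derivMr (- r1) (has_deriv_expR (- (muGN / 2)) u); congr has_deriv.
  by rewrite /r1; field; rewrite gt_eqF.
have := @deriv_norm_le _ _ w (fun u => Psi (w u)) q _ 0 t t0 _ (fun u _ => Dq u).
rewrite (solves0 Sw) => h.
apply: le_trans (h _ _) _.
- by move=> u /andP[u0 ut]; apply: Sw.2 => //; rewrite lte_fin (le_lt_trans ut).
- by move=> u /andP[u0 ut]; apply: (speed_decay Sw stw); rewrite u0 (le_lt_trans ut).
rewrite /q mulr0 expR0 mul1r opprK mulrN gerDr oppr_le0 mulr_ge0 ?expR_ge0//.
by apply: mulr_ge0 => //; apply: divr_ge0 => //; exact: ltW muGN_gt0.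
Qed.

Theorem gauss_newton_flow : 2 * L * g0 / (mu * s * muH * muGN) < r ->
  exists w : R -> W,
    [/\ maximal_flow Phi w0 +oo%E w,
        forall t, 0 <= t -> loss (F (w t)) <= loss (F w0) * expR (- muGN * t)
      & forall t, 0 <= t -> `|w t - w0| < r].
Proof.
move=> r1r.
have r1E : r1 < r.
  suff -> : r1 = 2 * L * g0 / (mu * s * muH * muGN) by [].
  by rewrite /r1 /B; field; rewrite !gt_eqF.
have Psi_lip p : `|p - w0| < r -> exists d K, [/\ 0 < d, 0 <= K &
    forall x y, `|x - p| < d -> `|y - p| < d -> `|Psi x - Psi y| <= K * `|x - y|].
  move=> /field_locally_lipschitz[d [K [d0 K0 h]]]; exists d, K; split=> // x y xd yd.
  by rewrite /Psi -opprD normrN h.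
have [|w [Sw stw]] := @global_existence _ _ Psi Wc w0 r r_gt0 Psi_lip r1 B r1E.
  move=> T w Sw stw t tT; split; first exact: (distance_bound Sw stw tT).
  apply: le_trans (speed_decay Sw stw tT) _; rewrite ler_piMr// -expR0 ler_expR.
  by case/andP: tT => t0 _; rewrite mulNr oppr_le0 mulr_ge0// divr_ge0// ltW.
exists w; split.
- have := solves_maximal Psi_lip Sw stw.
  by have -> : (fun x => - Psi x) = Phi by apply/funext => x; rewrite /Psi opprK.
(* The estimates concern finite horizons; [t + 1] is one beyond [t]. *)
- move=> t t0; have ltT : (((t + 1)%:E : \bar R) <= +oo)%E by exact: leey.
  apply: (loss_decay (solvesW ltT Sw) (staysW ltT stw)).
  by rewrite t0 ltrDl ltr01.
- by move=> t t0; apply: stw => //; exact: ltry.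
Qed.

End GaussNewtonFlow.

(** * Networks *)

(** [e n] moves the linear layer along the features of [x n]. The outputs are affine in that layer,
    and the weights [1 / M] of the inner product make the Gram matrix of these directions equal to
    [gram]. *)
Lemma finite_features (R : realType) (d N M : nat) (gamma : R -> R)
    (x : 'I_N -> 'rV[R]_d) (w0 : finite_param R d M) :
  exists e : 'I_N -> finite_param R d M,
    (forall n n', inner (e n) (e n') = gram (net := FiniteWidth M) gamma x w0 n n') /\
    (forall n t, outputs (net := FiniteWidth M) gamma x (w0 + t *: e n) =
      outputs (net := FiniteWidth M) gamma x w0 +
        t *: row n (gram (net := FiniteWidth M) gamma x w0)).
Proof.
pose e n : finite_param R d M := (\row_i gamma (finite_preact w0 i (x n)), 0).
exists e; split=> [n n'|n t].
  rewrite mxE; change (inner (e n) (e n')) with (finite_dot (e n) (e n')).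
  congr (_ * _); apply: eq_bigr => i _; rewrite !mxE big1 ?addr0// => j _.
  by rewrite mxE mul0r.
have w2 : (w0 + t *: e n).2 = w0.2 by rewrite /= scaler0 addr0.
apply/rowP => m; rewrite !mxE /= /finite_preact w2 mulrCA -mulrDr.
congr (_ * _); rewrite mulr_sumr -big_split; apply: eq_bigr => i _ /=.
by rewrite !mxE mulrDl mulrA.
Qed.

Lemma L2_features (R : realType) (d N : nat) (nu : probability (borelRd R d) R)
    (gamma : R -> R) (x : 'I_N -> 'rV[R]_d) (w0 : L2_param nu) :
  well_defined (InfiniteWidth nu) gamma x ->
  exists e : 'I_N -> L2_param nu,
    (forall n n', inner (e n) (e n') = gram (net := InfiniteWidth nu) gamma x w0 n n') /\
    (forall n t, outputs (net := InfiniteWidth nu) gamma x (w0 + t *: e n) =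
      outputs (net := InfiniteWidth nu) gamma x w0
      + t *: row n (gram (net := InfiniteWidth nu) gamma x w0)).
Proof.
move=> wd.
pose f n (c : borelRd R d) := gamma (L2_preact w0 c (x n)).
pose h n : L2 nu := \pi_(L2 nu)%qT (Lfun_Sub (lee1n 2) (wd w0 n)).
have hE n : (h n : borelRd R d -> R) = f n %[ae nu] := L2_funE _.
have mf n : measurable_fun setT (f n).
  by have := wd w0 n; rewrite inE => /andP[]; rewrite inE.
have dotE (u : L2 nu) n : inner u (h n) = \int[nu]_c (u c * f n c).
  change (inner u (h n)) with (L2_dot u (h n)); apply: L2_dotE.
    by apply: measurable_funM => //; exact: L2_measurable.
  by apply: filterS (hE n) => c /(_ I) -> _.
have hh n n' : inner (h n) (h n') = \int[nu]_c (f n c * f n' c).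
  change (inner (h n) (h n')) with (L2_dot (h n) (h n')); apply: L2_dotE.
    exact: measurable_funM.
  by apply: filterS2 (hE n) (hE n') => c /(_ I) -> /(_ I) -> _.
pose e n : L2_param nu := (h n, 0).
exists e; split=> [n n'|n t].
  rewrite mxE; change (inner (e n) (e n')) with (L2_param_dot (e n) (e n')).
  by rewrite /L2_param_dot big1 ?addr0 ?hh// => j _; rewrite ffunE inner0l.
have w2 : (w0 + t *: e n).2 = w0.2 by rewrite /= scaler0 addr0.
apply/rowP => m; rewrite !mxE /= /L2_preact w2.
rewrite -(dotE (w0.1 + t *: h n)) -(dotE w0.1) innerDl innerZl hh.
by [].
Qed.

Lemma net_features (R : realType) (d N : nat) (net : network R d) (gamma : R -> R)
    (x : 'I_N -> 'rV[R]_d) (w0 : param_space net) : well_defined net gamma x ->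
  exists e : 'I_N -> param_space net,
    (forall n n', inner (e n) (e n') = gram gamma x w0 n n') /\
    (forall n t, outputs gamma x (w0 + t *: e n) =
      outputs gamma x w0 + t *: row n (gram gamma x w0)).
Proof.
case: net w0 => [M|nu] w0 wd; [exact: finite_features|exact: L2_features].
Qed.

Lemma gram_sym (R : realType) (d N : nat) (net : network R d) (gamma : R -> R)
    (x : 'I_N -> 'rV[R]_d) (w0 : param_space net) : (gram gamma x w0)^T = gram gamma x w0.
Proof.
case: net w0 => [M|nu] w0; apply/matrixP => i j; rewrite !mxE.
  by congr (_ * _); apply: eq_bigr => k _; rewrite mulrC.
by apply: eq_Rintegral => c _; rewrite mulrC.
Qed.

Lemma has_deriv_unique (R : realType) (W : normedModType R) (f : R -> W) (t : R) (a b : W) :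
  has_deriv f t a -> has_deriv f t b -> a = b.
Proof. by move=> /has_derivP[_ <-] /has_derivP[_ <-]. Qed.

(* The derivative of the network in the linear layer alone gives the bound: the
   vectors e n are tangent to it and have Gram matrix G. *)
Lemma jacT_gram_lb (R : realType) (W : innerType R) (N : nat) (kappa : R)
    (F : W -> 'rV[R]_N) (G : 'M[R]_N) (w0 : W) (e : 'I_N -> W) (y : 'rV[R]_N) :
  geometric_complete W -> (0 < N)%N -> 0 < kappa -> differentiable F w0 ->
  (forall n n', inner (e n) (e n') = G n n') ->
  (forall n t, F (w0 + t *: e n) = F w0 + t *: row n G) -> G^T = G ->
  0 <= min_eigenvalue G ->
  Num.sqrt kappa * Num.sqrt (min_eigenvalue G) * onorm kappa y <= `|jacT kappa F w0 y|.
Proof.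
move=> Wc N_gt0 k_gt0 dF ee Fe G_sym m0.
have Je n : jac F w0 (e n) = row n G.
  have D1 : has_deriv (F \o (fun s => w0 + s *: e n)) 0 ('d F (w0 + 0 *: e n) (e n)).
    by apply: has_deriv_diff; [rewrite scale0r addr0|exact: has_deriv_segment].
  rewrite scale0r addr0 in D1; apply: (has_deriv_unique D1).
  apply: (@has_deriv_near _ _ (fun s => F w0 + s *: row n G) _ _ _ 1) => //.
    by move=> s _; rewrite /= Fe.
  exact: has_deriv_segment.
(* This direction has [J a = y G] and [|a|^2 = q], so [kappa * q = inner (J^T y) a <= |J^T y| * sqrt
   q]; dividing by [sqrt q] leaves the bound. *)
pose a := \sum_n y 0 n *: e n.
have Ja : jac F w0 a = y *m G.
  rewrite /a /jac linear_sum mulmx_sum_row; apply: eq_bigr => n _.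
  by rewrite linearZ /= -/(jac F w0 (e n)) Je.
pose q := odot 1 y (y *m G).
have aa : `|a| ^+ 2 = q.
  rewrite sqr_norm_inner.
  have suml (f : 'I_N -> W) z : inner (\sum_n f n) z = \sum_n inner (f n) z.
    by elim/big_ind2: _ => [|u1 v1 u2 v2 <- <-|//]; rewrite ?inner0l ?innerDl.
  rewrite /a suml /q /odot mul1r; apply: eq_bigr => n _.
  rewrite innerZl innerC suml mxE; congr (_ * _); apply: eq_bigr => m _.
  by rewrite innerZl ee.
have q0 : 0 <= q by rewrite -aa exprn_ge0.
have kq : kappa * q = inner (jacT kappa F w0 y) a.
  by rewrite (inner_jacT Wc k_gt0)// Ja /q /odot mul1r.
have h1 : (kappa * q) ^+ 2 <= `|jacT kappa F w0 y| ^+ 2 * q.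
  rewrite kq -aa -exprMn -real_normK ?num_real// lerXn2r ?nnegrE//.
  exact: ler_inner_norm.
have h2 := min_eigenvalue_le N_gt0 G_sym y (ltr01 : 0 < (1 : R)).
rewrite -(ler_pXn2r (_ : 0 < 2)%N) ?nnegrE ?mulr_ge0 ?onorm_ge0 ?sqrtr_ge0//.
rewrite !exprMn (sqr_onorm k_gt0) !sqr_sqrtr ?(ltW k_gt0)//.
have -> : odot kappa y y = kappa * odot 1 y y by rewrite /odot mul1r.
apply: le_trans (_ : kappa ^+ 2 * q <= _).
  have -> : kappa * min_eigenvalue G * (kappa * odot 1 y y) =
      kappa ^+ 2 * (min_eigenvalue G * odot 1 y y) by ring.
  by rewrite ler_wpM2l// exprn_ge0// ltW.
move: q0; rewrite le_eqVlt => /predU1P[<-|q0]; first by rewrite mulr0 exprn_ge0.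
by rewrite -(ler_pM2r q0); move: h1; rewrite exprMn (expr2 q) mulrA.
Qed.

Lemma djac_bound_ge0 (R : realType) (W : innerType R) (N : nat) (kappa : R)
    (F : W -> 'rV[R]_N) (w0 : W) (rad : R) : 0 < rad -> (0 <= djac_bound kappa F w0 rad)%E.
Proof.
move=> r0; apply: le_trans (_ : djac_opnorm kappa F w0 <= _)%E; last first.
  by apply: ereal_sup_ubound; exists w0 => //; exact: ballxx.
apply: le_ereal_inf_tmp => _ [D _ <-].
apply: le_trans (_ : (onorm kappa (D 0 0))%:E <= _)%E; first by rewrite lee_fin sqrtr_ge0.
by apply: ereal_sup_ubound; exists (0, 0) => //=; rewrite normr0.
Qed.

(* Turns the extended-real smallness condition (with 1/0 = +oo, 1/+oo = 0) into
   a real one: rho plays min(R, 1/C). *)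
Lemma small_gradient_radius (R : realType) (C : \bar R) (rad c tau g : R) :
  (0 <= C)%E -> 0 < rad -> 0 <= g ->
  (g%:E < c%:E * Order.min rad%:E C^-1 * tau%:E)%E ->
  exists C' rho, [/\ C = C'%:E, 0 <= C', 0 < rho <= rad, C' * rho <= 1 & g < c * rho * tau].
Proof.
move=> C0 rad0 g0; case: C C0 => [C'| |] // C0; last first.
  rewrite invey min_r ?lee_fin ?(ltW rad0)// mule0 mul0e lte_fin => g_lt.
  by move: g0; rewrite leNgt g_lt.
rewrite lee_fin in C0; rewrite inver; case: eqP => [->|/eqP C'N].
  rewrite min_l ?leey// -!EFinM lte_fin => h.
  by exists 0, rad; rewrite rad0 lexx mul0r ler01.
have C'0 : 0 < C' by rewrite lt_neqAle eq_sym C'N.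
rewrite -EFin_min -!EFinM lte_fin => h.
exists C', (Num.min rad C'^-1); split=> //.
  by rewrite lt_min rad0 invr_gt0 C'0 ge_min lexx.
by rewrite mulrC -ler_pdivlMr// mul1r ge_min lexx orbT.
Qed.

Theorem proposition3 (R : realType) (d N : nat) (N_gt0 : (0 < N)%N)
    (X : set 'rV[R]_d) (x : 'I_N -> 'rV[R]_d)
    (x_in : forall n, X (x n)) (x_inj : injective x)
    (fstar : 'rV[R]_d -> R)
    (gamma : R -> R) (gamma_nonpoly : ~ polynomial_fun gamma)
    (gamma_C2 : twice_continuously_differentiable gamma)
    (net : network R d) (net_adm : admissible X net)
    (net_wd : well_defined net gamma x)
    (kappa : R) (kappaE : kappa = 1 \/ kappa = N%:R^-1)
    (loss : 'rV[R]_N -> R) (L mu : R) (L_gt0 : 0 < L) (mu_gt0 : 0 < mu)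
    (loss_ge0 : forall y, 0 <= loss y)
    (loss_min : loss (\row_n fstar (x n)) = 0)
    (loss_smooth : smooth_fun kappa L loss)
    (loss_cvx : strongly_convex kappa mu loss)
    (H : param_space net -> 'M[R]_N) (muH LH : R)
    (muH_gt0 : 0 < muH) (LH_gt0 : 0 < LH)
    (H_sym : forall w, (H w)^T = H w)
    (H_C1 : continuously_differentiable H)
    (H_spec : forall w a, eigenvalue (H w) a -> muH <= a <= LH)
    (alpha : R) (alpha_ge0 : 0 <= alpha)
    (w0 : param_space net) (G_unit : gram gamma x w0 \in unitmx)
    (rad : R) (rad_gt0 : 0 < rad) :
  let F := @outputs R d net gamma N x in
  let Phi := gn_field kappa F loss H alpha in
  let sigma02 := min_eigenvalue (gram gamma x w0) in
  let sigma0 := Num.sqrt sigma02 in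
  let mu_GN := 2 * mu / (LH * (1 + alpha / muH)) in
  let C := djac_bound kappa F w0 rad in
  ((onorm kappa (grad kappa loss (F w0)))%:E <
     (mu * muH * mu_GN / (8 * L * N%:R))%:E
     * Order.min rad%:E C^-1 * (Num.min sigma0 sigma02)%:E)%E ->
  exists w : R -> param_space net,
    [/\ maximal_flow Phi w0 +oo%E w,
        forall t, 0 <= t -> loss (F (w t)) <= loss (F w0) * expR (- mu_GN * t),
        loss (F (w t)) @[t --> +oo] --> 0
      & forall t, 0 <= t -> ball w0 rad (w t)].
Proof.
move=> F Phi sigma02 sigma0 mu_GN C small.
have Nr : 1 <= N%:R :> R by rewrite ler1n.
have N0 : 0 < N%:R :> R by rewrite (lt_le_trans ltr01).
have k_gt0 : 0 < kappa by case: kappaE => ->; rewrite ?ltr01 ?invr_gt0.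
have k_le1 : kappa <= 1 by case: kappaE => -> //; rewrite invf_le1.
(* The factor N of the threshold is spent here: it compensates [kappa] for both normalisations. *)
have Nk : 1 <= N%:R * kappa by case: kappaE => ->; rewrite ?mulr1// divff// gt_eqF.
have Wc := @param_space_complete R d net.
set g0 := onorm kappa _ in small.
have g00 : 0 <= g0 by exact: onorm_ge0.
have [C' [rho [CE C'0 /andP[rho0 rho_rad] C'rho g0_lt]]] :=
  small_gradient_radius (djac_bound_ge0 kappa F w0 rad_gt0) rad_gt0 g00 small.
have C_bound : (djac_bound kappa F w0 rad <= C'%:E)%E by rewrite CE.
have muGN0 : 0 < mu_GN by rewrite divr_gt0 ?mulr_gt0// ltr_pwDl// divr_ge0// ltW.
set c := mu * muH * mu_GN / (8 * L * N%:R) in g0_lt.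
have b0 : 0 < mu * muH * mu_GN := mulr_gt0 (mulr_gt0 mu_gt0 muH_gt0) muGN0.
have c0 : 0 < c by apply: divr_gt0 b0 _; rewrite !mulr_gt0.
(* A strict upper bound on the nonnegative [g0] forces the threshold, hence this factor, to be
   positive. *)
have tau0 : 0 < Num.min sigma0 sigma02.
  by rewrite -(pmulr_rgt0 _ (mulr_gt0 c0 rho0)) (le_lt_trans g00).
set tau := Num.min sigma0 sigma02 in g0_lt tau0.
have [t1 t2] : tau <= sigma0 /\ tau <= sigma02 by rewrite /tau !ge_min !lexx orbT.
have s020 : 0 < sigma02 by exact: lt_le_trans t2.
have s00 : 0 < sigma0 by exact: lt_le_trans t1.
have s0E : sigma0 ^+ 2 = sigma02 by rewrite sqr_sqrtr// ltW.
pose s0 := Num.sqrt kappa * sigma0.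
have sk0 : 0 < Num.sqrt kappa by rewrite sqrtr_gt0.
have skE : Num.sqrt kappa ^+ 2 = kappa by rewrite sqr_sqrtr// ltW.
have s0_gt0 : 0 < s0 by rewrite mulr_gt0.
have Nsk : 1 <= N%:R * Num.sqrt kappa.
  apply: le_trans Nk _; rewrite ler_wpM2l// -{1}skE expr2 ler_piMl ?(ltW sk0)//.
  by rewrite -sqrtr1 ler_wsqrtr.
have [e [ee Fe]] := net_features w0 net_wd.
have w0r : `|w0 - w0| < rad by rewrite subrr normr0.
have lb0 y : s0 * onorm kappa y <= `|jacT kappa F w0 y|.
  apply: (jacT_gram_lb y Wc N_gt0 k_gt0 (ball_differentiable C_bound w0r) ee Fe).
    exact: gram_sym.
  exact: ltW.
(* The 1 keeps [r] below [rad]; the [s0 / 2] limits the loss in the lower bound of [J^T] to one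
   half, as [C' * rho <= 1]. *)
pose r := rho * Num.min 1 (s0 / 2).
have r_gt0 : 0 < r by rewrite mulr_gt0// lt_min ltr01 divr_gt0.
have r_rho : r <= rho by rewrite ler_piMr ?(ltW rho0)// ge_min lexx.
have r_rad : r <= rad by exact: le_trans rho_rad.
have C'r : C' * r <= s0 / 2.
  rewrite /r mulrA; apply: le_trans (_ : 1 * Num.min 1 (s0 / 2) <= _).
    by rewrite ler_wpM2r// le_min ler01 divr_ge0// ltW.
  by rewrite mul1r ge_min lexx orbT.
have lb w y : `|w - w0| < r -> s0 / 2 * onorm kappa y <= `|jacT kappa F w y|.
  move=> wr; have wrad : `|w - w0| < rad by exact: lt_le_trans r_rad.
  have h1 := jacT_lipschitz Wc k_gt0 C'0 C_bound y wrad w0r.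
  have h2 : C' * `|w - w0| * onorm kappa y <= s0 / 2 * onorm kappa y.
    rewrite ler_wpM2r ?onorm_ge0//; apply: le_trans C'r.
    by rewrite ler_wpM2l// ltW.
  have h3 := lb0 y.
  move: (jacT kappa F w y) (jacT kappa F w0 y) h1 h3 => a b h1 h3.
  have h4 : `|b| <= `|a| + `|a - b|.
    by rewrite distrC -{1}(subrK a b) addrC ler_normD.
  move: (`|a|) (`|b|) (`|a - b|) (C' * _ * _) h1 h2 h3 h4 => *; lra.
have dist : 2 * L * g0 / (mu * (s0 / 2) * muH * mu_GN) < r.
  have d0 : 0 < mu * (s0 / 2) * muH * mu_GN.
    by apply: mulr_gt0 muGN0; rewrite !mulr_gt0// divr_gt0.
  rewrite ltr_pdivrMr//; apply: lt_le_trans (_ : 2 * L * (c * rho * tau) <= _).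
    by rewrite ltr_pM2l// mulr_gt0.
  have -> : 2 * L * (c * rho * tau) = (mu * muH * mu_GN * rho / 2) * (tau / (2 * N%:R)).
    by rewrite /c; field; rewrite !gt_eqF.
  have -> : r * (mu * (s0 / 2) * muH * mu_GN) =
      (mu * muH * mu_GN * rho / 2) * (Num.min 1 (s0 / 2) * s0) by rewrite /r; field.
  rewrite ler_wpM2l; first by [].
    by apply: divr_ge0 => //; apply: mulr_ge0; apply: ltW.
  rewrite ler_pdivrMr ?mulr_gt0//.
  (* [a1] serves the case where the minimum in [r] is 1, [a2] the case where it is [s0 / 2]. *)
  have a1 : tau <= N%:R * s0.
    apply: le_trans t1 _; rewrite /s0 mulrA ler_peMl// ltW//.
  have a2 : tau <= N%:R * s0 ^+ 2.
    apply: le_trans t2 _; rewrite /s0 exprMn skE s0E mulrA ler_peMl// ltW//.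
  by case: (leP 1 (s0 / 2)) => _; lra.
have [w [w1 w2 w3]] := gauss_newton_flow Wc N_gt0 k_gt0 C'0 rad_gt0 C_bound L_gt0 mu_gt0
  loss_ge0 loss_min loss_smooth loss_cvx muH_gt0 LH_gt0 alpha_ge0 H_sym H_C1 H_spec
  r_gt0 r_rad (divr_gt0 s0_gt0 (ltr0n _ 2)) lb dist.
exists w; split=> //; last first.
  by move=> t t0; rewrite -ball_normE /= distrC (lt_le_trans (w3 t t0)).
apply/cvgrPdist_le => eps eps0; near=> t.
have t0 : 0 <= t by near: t; apply: nbhs_pinfty_ge; exact: num_real.
rewrite sub0r normrN ger0_norm//; apply: le_trans (w2 t t0) _.
have tl : loss (F w0) / (eps * mu_GN) <= t.
  by near: t; apply: nbhs_pinfty_ge; exact: num_real.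
rewrite mulNr expRN ler_pdivrMr ?expR_gt0//.
(* For mere convergence to 0, [1 + x <= exp x] is enough, and it makes the threshold on [t]
   explicit. *)
apply: le_trans (_ : eps * (1 + mu_GN * t) <= _).
  rewrite mulrDr mulr1 ler_wpDl ?(ltW eps0)// mulrA mulrC.
  by rewrite -(ler_pdivrMr _ _ (mulr_gt0 eps0 muGN0)).
by rewrite ler_wpM2l ?(ltW eps0)// expR_ge1Dx.
Unshelve. all: by end_near. Qed.
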